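(* For every positive integer $k$, let $W$ be a Bernoulli$\left(\frac{k}{k+1}\right)$ random variable (so $\mathbb{P}(W=1)=\frac{k}{k+1}$) and let $U_1,\dots,U_k$ be i.i.d. random variables uniformly distributed on the unit ball $B_{0,1}\subset\mathbb{R}^d$ that are independent of $W$. Set $\bar1:=(1,0,\dots,0)\in\mathbb{R}^d$ and define the random variable $$\begin{aligned}D_k:=\ &\frac{\lambda\left(B_{U_1,\|\bar1-U_1\|}\cup\dots\cup B_{U_k,\|\bar1-U_k\|}\cup B_{0,1}\right)}{\lambda(B_{0,1})}\,\mathbb{I}_{\{W=0\}}\\&+\frac{\lambda\left(B_{\bar1,\|\bar1-U_1\|}\cup B_{U_2,\|U_1-U_2\|}\cup B_{U_3,\|U_1-U_3\|}\cup\dots\cup B_{U_k,\|U_1-U_k\|}\cup B_{0,\|U_1\|}\right)}{\lambda(B_{0,1})}\,\mathbb{I}_{\{W=1\}}.\end{aligned}$$ Let $f$ be any probability density function on $\mathbb{R}^d$ and let $x$ be a Lebesgue point of $f$ such that $f(x)>0$. Let $\mu_f$ be the measure with density $f$ and, for each $n\ge1$, let $L_n(x)$ be the cell that contains $x$ in the Voronoi diagram generated by $\{X_1,\dots,X_n\}$, where $X_1,\dots,X_n$ are i.i.d. with distribution $\mu_f$. Then $$\lim_{n\to\infty}\mathbb{E}\left[n^k\mu_f(L_n(x))^k\right]=\mathbb{E}\left[\frac{(k+1)!}{D_k^{k+1}}\right],\qquad\forall k\ge1.$$ Moreover, these limits of the moments uniquely determine a distribution $\mathscr{D}$ on $\mathbb{R}^+$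 with the property that $\mathscr{D}$ does not depend on the choice of $f$ or $x$, and the distribution of $n\mu_f(L_n(x))$ converges weakly to $\mathscr{D}$ as $n\to\infty$.
   Context: $d\ge1$ is an integer, $\|\cdot\|$ is the Euclidean norm on $\mathbb{R}^d$, $\lambda$ is Lebesgue measure, $B_{z,r}$ is the open ball with center $z$ and radius $r$, and $\mathbb{I}_A$ is the indicator of the event $A$. A point $x\in\mathbb{R}^d$ is a Lebesgue point of $f$ if $\lim_{r\to0}\frac{1}{\lambda(B_{x,r})}\int_{B_{x,r}}|f(u)-f(x)|\,du=0$. The Voronoi diagram generated by $\{X_1,\dots,X_n\}$ is the collection of the cells $\{p\in\mathbb{R}^d:\ \|p-X_i\|\le\|p-X_j\|\ \text{for all } j\ne i\}$, $i=1,\dots,n$; the cell indexed by $i$ has nucleus $X_i$. For a fixed point $x$, $L_n(x)$ denotes the cell that contains $x$; it is almost surely unique, and its nucleus is the point among $X_1,\dots,X_n$ nearest to $x$. *)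

(* Defs.v *)
From HB Require Import structures.
From mathcomp Require Import all_boot all_order all_algebra.
From mathcomp Require Import all_classical all_reals all_analysis.

Set Implicit Arguments.
Unset Strict Implicit.
Unset Printing Implicit Defensive.

Import Order.TTheory GRing.Theory Num.Theory.
Import numFieldNormedType.Exports.

Local Open Scope classical_set_scope.
Local Open Scope ring_scope.

(* [lebesgue_measure] lives on [measurableTypeR R]; the same set function on the
   canonical measurable structure of R (the two have the same measurable sets). *)
Definition lebesgueR {R : realType} : set R -> \bar R := @lebesgue_measure R.

Section lebesgueR_measure.
Context {R : realType}.

HB.instance Definition _ := isMeasure.Build _ R R (@lebesgueR R)
  (@measure0 _ _ _ (@lebesgue_measure R))
  (@measure_ge0 _ _ _ (@lebesgue_measure R))
  (@measure_semi_sigma_additive _ _ _ (@lebesgue_measure R)).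

HB.instance Definition _ := Measure_isSigmaFinite.Build _ R R (@lebesgueR R)
  (@sigma_finiteT _ _ _ (@lebesgue_measure R)).

End lebesgueR_measure.

(* R^d is [d.-tuple R] with the product of the Borel sigma-algebras of R (which
   is the Borel sigma-algebra of R^d): row vectors carry neither a measurable
   structure nor the Euclidean norm in the library. *)

Section lebesgue_tuple_step.
Context {R : realType} (n : nat).
Variable m : {sigma_finite_measure set (n.-tuple R) -> \bar R}.

Definition tuple_of_pair (p : R * n.-tuple R) : n.+1.-tuple R :=
  [the n.+1.-tuple R of p.1 :: p.2].

Lemma measurable_tuple_of_pair : measurable_fun [set: _] tuple_of_pair.
Proof. exact: measurable_cons. Qed.

Definition lebesgue_tuple_step : set (n.+1.-tuple R) -> \bar R :=
  pushforward (product_measure1 (@lebesgueR R) m) tuple_of_pair.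

Let lebesgue_tuple_step0 : lebesgue_tuple_step set0 = 0%E.
Proof. by rewrite /lebesgue_tuple_step /pushforward preimage_set0 measure0. Qed.

Let lebesgue_tuple_step_ge0 A : (0 <= lebesgue_tuple_step A)%E.
Proof. by rewrite /lebesgue_tuple_step /pushforward measure_ge0. Qed.

Let lebesgue_tuple_step_sigma_additive : semi_sigma_additive lebesgue_tuple_step.
Proof.
move=> F mF tF mUF; rewrite /lebesgue_tuple_step /pushforward preimage_bigcup.
apply: measure_semi_sigma_additive.
- by move=> k; rewrite -[X in measurable X]setTI; exact: measurable_tuple_of_pair.
- apply/trivIsetP => /= i j _ _ ij; rewrite -preimage_setI.
  by move/trivIsetP : tF => /(_ _ _ _ _ ij) ->//; rewrite preimage_set0.
- rewrite -preimage_bigcup -[X in measurable X]setTI.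
  exact: measurable_tuple_of_pair.
Qed.

HB.instance Definition _ := isMeasure.Build _ _ _ lebesgue_tuple_step
  lebesgue_tuple_step0 lebesgue_tuple_step_ge0
  lebesgue_tuple_step_sigma_additive.

Lemma sigma_finite_lebesgue_tuple_step : sigma_finite setT lebesgue_tuple_step.
Proof.
have /sigma_finiteP[F [FT ndF Foo]] := sigma_finiteT (@lebesgueR R).
have /sigma_finiteP[G [GT ndG Goo]] := sigma_finiteT m.
pose g (t : n.+1.-tuple R) : R * n.-tuple R := (thead t, [tuple of behead t]).
have gK p : g (tuple_of_pair p) = p.
  by case: p => a t; rewrite /g theadE; congr (_, _); exact/val_inj.
have mg : measurable_fun [set: _] g.
  apply: measurable_fun_pair; last exact: measurable_behead.
  exact: measurable_tnth.
exists (fun k => g @^-1` (F k `*` G k)) => [|k].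
  have FGT : \bigcup_k (F k `*` G k) = setT; last first.
    by rewrite -preimage_bigcup FGT preimage_setT.
  rewrite -subTset => -[x y] _.
  have [i _ Fix] : (\bigcup_k F k) x by rewrite -FT.
  have [j _ Gjy] : (\bigcup_k G k) y by rewrite -GT.
  exists (maxn i j) => //; split.
    by move: x Fix; exact/subsetPset/ndF/leq_maxl.
  by move: y Gjy; exact/subsetPset/ndG/leq_maxr.
have [mF Fk] := Foo k; have [mG Gk] := Goo k; split.
  rewrite -[X in measurable X]setTI; apply: mg; first exact: measurableT.
  exact: measurableX.
rewrite /lebesgue_tuple_step /pushforward -comp_preimage.
rewrite (_ : g \o tuple_of_pair = id); last exact/funext.
by rewrite preimage_id product_measure1E// lte_mul_pinfty// ge0_fin_numE.
Qed.

HB.instance Definition _ := Measure_isSigmaFinite.Build _ _ _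
  lebesgue_tuple_step sigma_finite_lebesgue_tuple_step.

End lebesgue_tuple_step.

(* Lebesgue measure on R^d, as the d-fold product of Lebesgue measure on R. *)
Fixpoint lebesgue_tuple {R : realType} (d : nat) :
    {sigma_finite_measure set (d.-tuple R) -> \bar R} :=
  if d is n.+1 then lebesgue_tuple_step (lebesgue_tuple n)
  else dirac ([tuple] : 0.-tuple R).

Section geometry.
Context {R : realType} (d : nat).
Implicit Types (x y z : d.-tuple R) (r : R).

Definition euclidean_dist x y : R :=
  Num.sqrt (\sum_(i < d) (tnth x i - tnth y i) ^+ 2).

Definition eball z r : set (d.-tuple R) := [set y | euclidean_dist z y < r].

Definition origin : d.-tuple R := [tuple 0 | i < d].

(* (1, 0, ..., 0) *)
Definition e1 : d.-tuple R := [tuple (i == 0 :> nat)%:R | i < d].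

Definition unit_ball : set (d.-tuple R) := eball origin 1.

Definition voronoi_cell n (X : 'I_n -> d.-tuple R) (i : 'I_n) :
    set (d.-tuple R) :=
  [set p | forall j, j != i -> euclidean_dist p (X i) <= euclidean_dist p (X j)].

(* The cell containing x; if several cells contain x (a null event for samples
   from a density), the one with the smallest index is taken. *)
Definition voronoi_cell_at n (X : 'I_n -> d.-tuple R) x : set (d.-tuple R) :=
  if [pick i | x \in voronoi_cell X i] is Some i then voronoi_cell X i else set0.

End geometry.

Arguments origin {R d}.
Arguments e1 {R d}.
Arguments unit_ball {R d}.

Section density.
Context {R : realType} (d : nat).
Implicit Types (f : d.-tuple R -> R) (x : d.-tuple R).
Local Open Scope ereal_scope.

Definition probability_density f : Prop :=
  [/\ measurable_fun [set: d.-tuple R] f, (forall y, (0 <= f y)%R) &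
      \int[lebesgue_tuple d]_y (f y)%:E = 1].

Definition density_measure f (A : set (d.-tuple R)) : \bar R :=
  \int[lebesgue_tuple d]_(y in A) (f y)%:E.

Definition lebesgue_point f x : Prop :=
  (fun r : R => (fine (lebesgue_tuple d (eball x r)))^-1%:E *
     \int[lebesgue_tuple d]_(u in eball x r) (`|f u - f x|%R)%:E)
  @ 0^'+ --> 0.

End density.

Section probability.
Context dO {O : measurableType dO} {R : realType} (P : probability O R).
Local Open Scope ereal_scope.

Definition mutually_independent (I : finType) dT (T : measurableType dT)
    (X : I -> O -> T) : Prop :=
  forall (J : {set I}) (A : I -> set T), (forall i, measurable (A i)) ->
    P (\bigcap_(i in [set` J]) (X i @^-1` A i)) =
    \prod_(i in J) P (X i @^-1` A i).

Definition has_law dT (T : measurableType dT) (X : O -> T) (m : set T -> \bar R)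
    : Prop :=
  forall A, measurable A -> P (X @^-1` A) = m A.

Definition iid (I : finType) dT (T : measurableType dT) (m : set T -> \bar R)
    (X : I -> O -> T) : Prop :=
  (forall i, has_law (X i) m) /\ mutually_independent X.

Definition independent_pair dS dT (S : measurableType dS) (T : measurableType dT)
    (X : O -> S) (Y : O -> T) : Prop :=
  forall A B, measurable A -> measurable B ->
    P (X @^-1` A `&` Y @^-1` B) = P (X @^-1` A) * P (Y @^-1` B).

End probability.

(* Y_n (each on its own probability space) converges in distribution to D. *)
Definition cvg_in_law {R : realType} (dO : nat -> measure_display)
    (O : forall n, measurableType (dO n)) (P : forall n, probability (O n) R)
    (Y : forall n, O n -> R) (D : probability R R) : Prop :=
  forall h : R -> R, continuous h -> (exists M, forall y, `|h y| <= M) ->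
    (fun n => 'E_(P n)[h \o Y n])%E @ \oo --> (\int[D]_y (h y)%:E)%E.

Section limit_variable.
Context {R : realType} (d k : nat).

Definition uniform_unit_ball (A : set (d.-tuple R)) : \bar R :=
  (fine (lebesgue_tuple d (A `&` unit_ball)) /
   fine (lebesgue_tuple d unit_ball))%:E.

(* The value of D_k when W = w and (U_1, ..., U_k) = u; indices are shifted by
   one, so U_1 is [nth origin u 0]. *)
Definition Dk (w : bool) (u : k.-tuple (d.-tuple R)) : R :=
  let u1 := nth origin u 0 in
  let region :=
    if w then
      eball e1 (euclidean_dist e1 u1)
      `|` \bigcup_(i in [set i : 'I_k | (0 < i)%N])
            eball (tnth u i) (euclidean_dist u1 (tnth u i))
      `|` eball origin (euclidean_dist u1 origin)
    else
      \bigcup_(i in [set: 'I_k]) eball (tnth u i) (euclidean_dist e1 (tnth u i))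
      `|` unit_ball in
  fine (lebesgue_tuple d region) / fine (lebesgue_tuple d unit_ball).

End limit_variable.

(* Main.v *)
(* On the event that the first sample point is the nucleus of the cell, the k-th power
   of the mass of the cell is the probability that k further independent points fall
   in it.  Hence E[mu(L_N)^k] = N int (1 - mu(V_x p))^(N-1) dmu^(k+1)(p), where V_x p is
   the union of the balls through the first point of p centred at x and at the other
   points.  After rescaling by N^(-1/d), the Lebesgue point replaces mu by f(x) lambda;
   V_x p contains a ball close to x of radius proportional to the diameter of p, which
   controls the tail.  The limit is the integral of exp (- lambda (V_0 p)); splitting it
   according to the farthest point from the origin, rotating that point to the first
   axis and integrating out its radius gives E[(k+1)! / D_k^(k+1)].

   As D_k is bounded below, the limit moments are at most (k+1)! rho^(k+1), so the
   Laplace transforms at small arguments converge by Taylor expansion, and at all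
   multiples of a small step by continuation.  Bernstein polynomials in exp (- h y) then
   give the convergence of the means of piecewise linear ramps, from which the limiting
   distribution function, its uniqueness and weak convergence follow. *)

From HB Require Import structures.
Require Import Defs.
From mathcomp Require Import all_boot all_order all_algebra.
From mathcomp Require Import fingroup perm.
From mathcomp Require Import all_classical all_reals all_analysis.
From mathcomp Require Import measurable_realfun.
From mathcomp Require Import ring lra.

Set Implicit Arguments.
Unset Strict Implicit.
Unset Printing Implicit Defensive.

Import Order.TTheory GRing.Theory Num.Theory.
Import numFieldNormedType.Exports.

Local Open Scope classical_set_scope.
Local Open Scope ring_scope.

(** * Powers of a sigma-finite measure *)

(** Nothing is known about [f] away from [x]. A tuple with a far point must therefore be made
    improbable by mass near [x] alone, and even near [x] the values of [f] need not be close to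
    [f x]: the Lebesgue point is used as an L1 statement about test functions, one factor of the
    power measure at a time.

    The two terms of [D_k] are the two roles of the farthest point: it is the nucleus, or one of the
    [k] other points, which are exchangeable. The radial gamma integral gives k!, so the weights are
    k! and k * k!, that is (k+1)! times the two probabilities of a Bernoulli variable of mean
    k/(k+1).

    The moments grow like k! times a power, so the Taylor series of the Laplace transform at 0 has a
    finite radius. As exp (- s y) <= 1, the remainder at any s >= 0 is no larger than at 0, so one
    step length serves for all continuations. Since the limits of the moments are the same for all
    [f] and [x], a single admissible density, the uniform one at the centre of the unit ball,
    suffices to produce the limit law. *)

Section integral_wrappers.
Context d (T : measurableType d) (R : realType) (m : {measure set T -> \bar R}).
Local Open Scope ereal_scope.
Implicit Types f g : T -> \bar R.

Lemma le_integralT f g : measurable_fun setT f -> measurable_fun setT g ->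
  (forall x, 0 <= f x) -> (forall x, f x <= g x) ->
  \int[m]_x f x <= \int[m]_x g x.
Proof. by move=> mf mg f0 fg; apply: ge0_le_integral => //. Qed.

Lemma integral_indicT (A : set T) : measurable A ->
  \int[m]_x (\1_A x)%:E = m A.
Proof. by move=> mA; rewrite integral_indic// setIT. Qed.

Lemma integral_indicM (A : set T) f : measurable A ->
  \int[m]_x ((\1_A x)%:E * f x) = \int[m]_(x in A) f x.
Proof.
move=> mA; rewrite [RHS]integral_mkcond; apply: eq_integral => x _.
by rewrite patchE indicE; case: (x \in A); rewrite ?mul1e ?mul0e.
Qed.

End integral_wrappers.

Lemma prode_fin_num (R : realType) n (F : 'I_n -> \bar R) :
  (forall i, F i \is a fin_num) -> (\prod_(i < n) F i)%E \is a fin_num.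
Proof.
move=> H; apply: (big_ind (fun x : \bar R => x \is a fin_num)) => // x y.
exact: fin_numM.
Qed.

Lemma prode_gt0 (R : realType) n (F : 'I_n -> \bar R) :
  (forall i, 0 < F i)%E -> (0 < \prod_(i < n) F i)%E.
Proof.
move=> H; apply: (big_ind (fun x : \bar R => 0 < x)%E) => // x y.
exact: mule_gt0.
Qed.

Section power_measure_step.
Context d (T : measurableType d) (R : realType).
Variables (m : {sigma_finite_measure set T -> \bar R}) (n : nat).
Variable p : {sigma_finite_measure set (n.-tuple T) -> \bar R}.
Local Open Scope ereal_scope.

Definition cons_pair (x : T * n.-tuple T) : n.+1.-tuple T :=
  (cons_tuple x.1 x.2).

Lemma measurable_cons_pair : measurable_fun [set: _] cons_pair.
Proof. exact: measurable_cons. Qed.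

Lemma measurable_preimage_cons_pair (A : set (n.+1.-tuple T)) :
  measurable A -> measurable (cons_pair @^-1` A).
Proof. by move=> mA; rewrite -[X in measurable X]setTI; exact: measurable_cons_pair. Qed.

Definition power_step : set (n.+1.-tuple T) -> \bar R :=
  pushforward (product_measure1 m p) cons_pair.

Let power_step0 : power_step set0 = 0.
Proof. by rewrite /power_step /pushforward preimage_set0 measure0. Qed.

Let power_step_ge0 A : 0 <= power_step A.
Proof. by rewrite /power_step /pushforward measure_ge0. Qed.

Let power_step_sigma_additive : semi_sigma_additive power_step.
Proof.
move=> F mF tF mUF; rewrite /power_step /pushforward preimage_bigcup.
apply: measure_semi_sigma_additive.
- by move=> k; exact: measurable_preimage_cons_pair.
- apply/trivIsetP => /= i j _ _ ij; rewrite -preimage_setI.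
  by move/trivIsetP : tF => /(_ _ _ _ _ ij) ->//; rewrite preimage_set0.
- by rewrite -preimage_bigcup; exact: measurable_preimage_cons_pair.
Qed.

HB.instance Definition _ := isMeasure.Build _ _ _ power_step
  power_step0 power_step_ge0 power_step_sigma_additive.

Let sigma_finite_power_step : sigma_finite setT power_step.
Proof.
have /sigma_finiteP[F [FT ndF Foo]] := sigma_finiteT m.
have /sigma_finiteP[G [GT ndG Goo]] := sigma_finiteT p.
pose g (t : n.+1.-tuple T) : T * n.-tuple T := (thead t, [tuple of behead t]).
have gK q : g (cons_pair q) = q.
  by case: q => a t; rewrite /g theadE; congr (_, _); exact/val_inj.
have mg : measurable_fun [set: _] g.
  apply: measurable_fun_pair; last exact: measurable_behead.
  exact: measurable_tnth.
exists (fun k => g @^-1` (F k `*` G k)) => [|k].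
  rewrite -preimage_bigcup; apply/esym; rewrite -subTset => t _.
  have [i _ Fi] : (\bigcup_k F k) (g t).1 by rewrite -FT.
  have [j _ Gj] : (\bigcup_k G k) (g t).2 by rewrite -GT.
  exists (maxn i j) => //; split.
    by move: Fi; exact/subsetPset/ndF/leq_maxl.
  by move: Gj; exact/subsetPset/ndG/leq_maxr.
have [mF Fk] := Foo k; have [mG Gk] := Goo k; split.
  rewrite -[X in measurable X]setTI; apply: mg; first exact: measurableT.
  exact: measurableX.
rewrite /power_step /pushforward -comp_preimage.
rewrite (_ : g \o cons_pair = id); last exact/funext.
by rewrite preimage_id product_measure1E// lte_mul_pinfty// ge0_fin_numE.
Qed.

HB.instance Definition _ := Measure_isSigmaFinite.Build _ _ _
  power_step sigma_finite_power_step.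

Lemma integral_power_step (f : n.+1.-tuple T -> \bar R) :
  measurable_fun setT f -> (forall t, 0 <= f t) ->
  \int[power_step]_t f t = \int[m]_x \int[p]_t f (cons_tuple x t).
Proof.
move=> mf f0; rewrite ge0_integral_pushforward//; last exact: measurable_cons_pair.
rewrite preimage_setT (fubini_tonelli1 (f \o cons_pair))// => [|x]; last exact: f0.
by apply: measurableT_comp => //; exact: measurable_cons_pair.
Qed.

End power_measure_step.

Fixpoint power_measure d (T : measurableType d) (R : realType)
    (m : {sigma_finite_measure set T -> \bar R}) (n : nat) :
    {sigma_finite_measure set (n.-tuple T) -> \bar R} :=
  if n is k.+1 then power_step m (power_measure m k)
  else dirac ([tuple] : 0.-tuple T).

(** Both sides follow the same recursion. The lemmas on power measures thus serve twice: for points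
    of R^d as tuples of reals, and for tuples of such points. *)
Lemma lebesgue_tupleE (R : realType) (d : nat) :
  lebesgue_tuple d = power_measure (@lebesgueR R) d :> (set _ -> \bar R).
Proof.
elim: d => // d IH; apply/funext => A /=.
rewrite /lebesgue_tuple_step /power_step /pushforward /product_measure1.
apply: eq_integral => x _; by rewrite /= IH.
Qed.

Section power_measure_theory.
Context d (T : measurableType d) (R : realType).
Local Open Scope ereal_scope.
Implicit Type m : {sigma_finite_measure set T -> \bar R}.

Definition rect n (A : 'I_n -> set T) : set (n.-tuple T) :=
  [set t | forall i, A i (tnth t i)].

Lemma measurable_rect n (A : 'I_n -> set T) : (forall i, measurable (A i)) ->
  measurable (rect A).
Proof.
move=> mA; rewrite (_ : rect A = \bigcap_(i in [set: 'I_n]) (@tnth n T ^~ i @^-1` A i)).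
  apply: fin_bigcap_measurable => // i _.
  by rewrite -[X in measurable X]setTI; exact: measurable_tnth.
by apply/seteqP; split => [t At i _|t At i]; exact: At.
Qed.

Lemma integral_power0 m (f : 0.-tuple T -> \bar R) : measurable_fun setT f ->
  \int[power_measure m 0]_t f t = f [tuple].
Proof. by move=> mf; rewrite /= integral_dirac//= diracT mul1e. Qed.

Lemma integral_powerS m n (f : n.+1.-tuple T -> \bar R) :
  measurable_fun setT f -> (forall t, 0 <= f t) ->
  \int[power_measure m n.+1]_t f t =
  \int[m]_x \int[power_measure m n]_t f (cons_tuple x t).
Proof. exact: integral_power_step. Qed.

Lemma measurable_integral_cons m n (f : n.+1.-tuple T -> \bar R) :
  measurable_fun setT f -> (forall t, 0 <= f t) ->
  measurable_fun setT
    (fun x => \int[power_measure m n]_t f (cons_tuple x t)).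
Proof.
move=> mf f0.
apply: (measurable_fun_fubini_tonelli_F (f \o @cons_pair _ T n)) => //.
  by apply: measurableT_comp => //; exact: measurable_cons_pair.
by move=> x; exact: f0.
Qed.

Lemma measurable_fun_consl n (x : T) :
  measurable_fun setT (fun t : n.-tuple T => (cons_tuple x t)).
Proof. by apply: measurable_cons. Qed.

Lemma power_rect m n (A : 'I_n -> set T) : (forall i, measurable (A i)) ->
  power_measure m n (rect A) = \prod_(i < n) m (A i).
Proof.
elim: n A => [|n IH] A mA.
  by rewrite big_ord0 /= diracE mem_set//; case.
rewrite /= /power_step /pushforward big_ord_recl.
have -> : @cons_pair _ T n @^-1` rect A = A ord0 `*` rect (fun i => A (lift ord0 i)).
  apply/seteqP; split=> -[x t] /=.
    move=> H; split=> [|i]; first by have := H ord0.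
    by have := H (lift ord0 i); rewrite tnthS.
  by move=> [Ax At] i; case: (unliftP ord0 i) => [j ->|->]//; rewrite tnthS; exact: At.
rewrite product_measure1E//; last exact: measurable_rect.
by rewrite IH.
Qed.

Lemma measurable_tuple_rect n :
  @measurable _ (n.-tuple T) =
  <<s [set B | exists2 A : 'I_n -> set T, (forall i, measurable (A i)) & B = rect A] >>.
Proof.
apply/seteqP; split.
  apply: smallest_sub; first exact: smallest_sigma_algebra.
  move=> A; rewrite -bigcup_seq => -[i /= _ [B mB <-]].
  apply: sub_sigma_algebra; exists (fun j => if j == i then B else setT).
    by move=> j; case: eqP.
  rewrite setTI; apply/seteqP; split => [t Bt j|t /(_ i)]; last by rewrite eqxx.
  by case: eqP => // ->.
apply: smallest_sub; first exact: sigma_algebra_measurable.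
by move=> B [A mA ->]; exact: measurable_rect.
Qed.

(** Rectangles form an intersection-stable generator, and the cubes over an exhaustion of [T]
    exhaust the tuples by sets of finite mass. *)
Lemma power_measure_unique m n (nu : {measure set (n.-tuple T) -> \bar R}) :
  (forall A : 'I_n -> set T, (forall i, measurable (A i)) ->
     nu (rect A) = \prod_(i < n) m (A i)) ->
  forall A, measurable A -> nu A = power_measure m n A.
Proof.
move=> nuE A mA.
have /sigma_finiteP[F [FT ndF Foo]] := sigma_finiteT m.
apply: (measure_unique _ (fun k => rect (fun _ : 'I_n => F k)) (measurable_tuple_rect n)) => //.
- move=> _ _ [B mB ->] [C mC ->]; exists (fun i => B i `&` C i).
    by move=> i; exact: measurableI.
  by apply/seteqP; split => t => [[H1 H2] i|H]; split => // i; have [] := H i.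
- by move=> i; exists (fun=> F i) => // _; have [] := Foo i.
- rewrite -subTset => t _.
  have H i : exists k, F k (tnth t i).
    by have [k _ ?] : (\bigcup_k F k) (tnth t i); [rewrite -FT|exists k].
  have [g Hg] := choice H.
  (* The exhaustion is increasing, so the largest of the finitely many indices serves all
     coordinates. *)
  exists (\max_(i < n) g i)%N => // i.
  have /subsetPset FF := ndF _ _ (@leq_bigmax _ g i); exact: FF.
- by move=> _ [B mB ->]; rewrite nuE//; exact/esym/power_rect.
- move=> k; have mF : measurable (F k) by have [] := Foo k.
  rewrite nuE// ltey_eq; apply/orP; left.
  apply: (big_ind (fun x => x \is a fin_num)) => // [x y|i _]; first exact: fin_numM.
  by rewrite ge0_fin_numE//; have [] := Foo k.
Qed.


End power_measure_theory.

(** * Permutation, ties and perturbation of power measures *)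

Section power_measure_maps.
Context d (T : measurableType d) (R : realType).
Local Open Scope ereal_scope.
Implicit Type m : {sigma_finite_measure set T -> \bar R}.

Lemma power_section m n (A : set (n.+1.-tuple T)) :
  power_measure m n.+1 A =
  \int[m]_x power_measure m n [set t | A (cons_tuple x t)].
Proof.
rewrite /= /power_step /pushforward /product_measure1.
apply: eq_integral => x _ /=; congr (power_measure m n _).
by apply/seteqP; split => t; rewrite /xsection/= inE.
Qed.

Definition tuple_reindex n (s : 'I_n -> 'I_n) (t : n.-tuple T) : n.-tuple T :=
  [tuple tnth t (s i) | i < n].

Lemma measurable_tuple_reindex n (s : 'I_n -> 'I_n) :
  measurable_fun setT (tuple_reindex s).
Proof.
apply/measurable_fun_tnthP => i.
rewrite (_ : _ \o _ = (@tnth n T)^~ (s i)); first exact: measurable_tnth.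
by apply/funext => t /=; rewrite tnth_mktuple.
Qed.

(** The image measure agrees with the power measure on rectangles, where a permutation of the
    entries only permutes the factors of a product. *)
Lemma integral_power_reindex m n (s : {perm 'I_n}) (f : n.-tuple T -> \bar R) :
  measurable_fun setT f -> (forall t, 0 <= f t) ->
  \int[power_measure m n]_t f (tuple_reindex s t) =
  \int[power_measure m n]_t f t.
Proof.
move=> mf f0.
have ms := measurable_tuple_reindex s.
transitivity (\int[pushforward (power_measure m n) (tuple_reindex s)]_t f t).
  by rewrite ge0_integral_pushforward// preimage_setT.
apply: eq_measure_integral => A mA _.
apply: power_measure_unique => // B mB.
rewrite /= /pushforward.
rewrite (_ : _ @^-1` _ = rect (fun i => B ((s^-1)%g i))).
  rewrite power_rect// (reindex_inj (@perm_inj _ s))/=.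
  by apply: eq_bigr => i _; rewrite permK.
apply/seteqP; split => t H i.
  by have := H ((s^-1)%g i); rewrite tnth_mktuple permKV.
by have := H (s i); rewrite permK tnth_mktuple.
Qed.

(** Slice at the head: a tie that avoids the head is the induction hypothesis, and a tie with the
    head asks another entry to lie in one fixed null level set. *)
Lemma power_ties m n (g : T -> R) (i j : 'I_n) : measurable_fun setT g ->
  (forall s, m (g @^-1` [set s]) = 0) -> i != j ->
  power_measure m n [set t | g (tnth t i) = g (tnth t j)] = 0.
Proof.
move=> mg g0; elim: n i j => [[]//|n IH] i j ij.
rewrite power_section integral0_eq// => x _.
have mgs s : measurable (g @^-1` [set s]).
  by rewrite -[X in measurable X]setTI; apply: mg.
have H0 (j' : 'I_n) : power_measure m n [set t | g x = g (tnth t j')] = 0.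
  pose A k : set T := if k == j' then g @^-1` [set g x] else setT.
  have mA k : measurable (A k) by rewrite /A; case: eqP.
  rewrite (_ : mkset _ = rect A).
    by rewrite power_rect// (bigD1 j')//= /A eqxx g0 mul0e.
  apply/seteqP; split => t /=.
    by move=> E k; rewrite /A; case: eqP => // ->.
  by move=> /(_ j'); rewrite /A eqxx => ->.
case: (unliftP ord0 i) ij => [i' ->|->]; case: (unliftP ord0 j) => [j' ->|->] //= ij.
- rewrite -(IH i' j'); last by apply: contraNneq ij => ->.
  by congr (power_measure m n _); apply/seteqP; split => t /=; rewrite !tnthS.
- rewrite -(H0 i'); congr (power_measure m n _).
  by apply/seteqP; split => t /=; rewrite !tnthS ?tnth0 => ->.
- rewrite -(H0 j'); congr (power_measure m n _).
  by apply/seteqP; split => t /=; rewrite !tnthS ?tnth0.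
Qed.

(** The factors [a] are replaced by [b] one at a time; each replacement costs [e] times the mass of
    the other factors, and [1 <= A] lets [A ^+ n] bound all of these. The comparison is one-sided so
    that it can be used in both directions. *)
Lemma power_close (a b : {sigma_finite_measure set T -> \bar R}) (B : set T)
    (A e : R) : measurable B -> (1 <= A)%R -> (0 <= e)%R ->
  a B <= A%:E -> b B <= A%:E ->
  (forall h : T -> \bar R, measurable_fun setT h ->
     (forall x, 0 <= h x <= (\1_B x)%:E) ->
     \int[a]_x h x <= \int[b]_x h x + e%:E) ->
  forall n (F : n.-tuple T -> \bar R), measurable_fun setT F ->
    (forall t, 0 <= F t <= (\1_(rect (fun=> B)) t)%:E) ->
  \int[power_measure a n]_t F t <=
  \int[power_measure b n]_t F t + (n%:R * e * A ^+ n)%:E.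
Proof.
move=> mB A1 e0 aB bB ab; have A0 : (0 <= A)%R by lra.
elim=> [F mF F1|n IH F mF F1].
  by rewrite !integral_power0// mul0r mul0r adde0.
have F0 t : 0 <= F t by have /andP[] := F1 t.
have mFx x : measurable_fun setT (fun t => F (cons_tuple x t)).
  by apply: measurableT_comp => //; exact: measurable_fun_consl.
rewrite !integral_powerS//.
set Ga := fun x => \int[power_measure a n]_t F (cons_tuple x t).
set Gb := fun x => \int[power_measure b n]_t F (cons_tuple x t).
have Ga0 x : 0 <= Ga x by apply: integral_ge0.
have Gb0 x : 0 <= Gb x by apply: integral_ge0.
have mGa : measurable_fun setT Ga by exact: measurable_integral_cons.
have mGb : measurable_fun setT Gb by exact: measurable_integral_cons.
have rectS x t : rect (fun=> B) (cons_tuple x t) <->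
    B x /\ rect (fun=> B) t.
  split=> [H|[Bx Bt] i].
    split=> [|i]; first by have := H ord0.
    by have := H (lift ord0 i); rewrite tnthS.
  by case: (unliftP ord0 i) => [j ->|->]; rewrite ?tnthS//; exact: Bt.
have FxB x t : B x ->
    0 <= F (cons_tuple x t) <= (\1_(rect (fun=> B)) t)%:E.
  move=> Bx; rewrite F0/=; have /andP[_ /le_trans] := F1 (cons_tuple x t).
  apply; rewrite lee_fin !indicE.
  have [tB|] := boolP (t \in rect (fun=> B)); first by case: (_ \in _); rewrite ?ler01 ?lexx.
  rewrite notin_setE => tB; rewrite memNset// => /rectS[]//.
have FxN x t : ~ B x -> F (cons_tuple x t) = 0.
  move=> Bx; apply/eqP; rewrite eq_le F0 andbT.
  have /andP[_ /le_trans] := F1 (cons_tuple x t).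
  by apply; rewrite indicE memNset// => /rectS[].
have An0 k : (0 <= A ^+ k)%R by exact: exprn_ge0.
have powB : power_measure b n (rect (fun=> B)) <= (A ^+ n)%:E.
  rewrite power_rect//; elim: n {IH F mF F1 F0 mFx Ga Gb Ga0 Gb0 mGa mGb rectS FxB FxN} =>
    [|n IH].
    by rewrite big_ord0 expr0.
  by rewrite big_ord_recl exprS EFinM; apply: lee_pmul => //; apply: prode_ge0.
have GaGb x : Ga x <= Gb x + (n%:R * e * A ^+ n * \1_B x)%:E.
  rewrite indicE; have [xB|] := boolP (x \in B).
    rewrite mulr1; apply: IH => // t; apply: FxB; exact: set_mem.
  rewrite notin_setE => xB; rewrite mulr0 adde0 /Ga integral0_eq// => t _.
  exact: FxN.
have GbA x : Gb x <= (A ^+ n * \1_B x)%:E.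
  rewrite indicE; have [xB|] := boolP (x \in B).
    rewrite mulr1; apply: le_trans powB.
    rewrite -integral_indicT; last exact: measurable_rect.
    apply: le_integralT => //.
      by apply/measurable_EFinP/measurable_indic; exact: measurable_rect.
    by move=> t; have /andP[] := FxB x t (set_mem xB).
  rewrite notin_setE => xB; rewrite mulr0 /Gb integral0_eq// => t _.
  exact: FxN.
have m1B (k : R) : measurable_fun setT (fun x => (k * \1_B x)%:E : \bar R).
  by apply/measurable_EFinP; apply: measurable_funM => //; exact: measurable_indic.
(* The tail entries are replaced at a fixed head; integrating this error over a head in [B] costs
   one more factor [A]. *)
have step1 : \int[a]_x Ga x <= \int[a]_x Gb x + (n%:R * e * A ^+ n.+1)%:E.
  apply: (@le_trans _ _ (\int[a]_x (Gb x + (n%:R * e * A ^+ n * \1_B x)%:E))).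
    by apply: le_integralT => //; apply: emeasurable_funD.
  rewrite ge0_integralD//; last first.
    by move=> x _; rewrite lee_fin; apply: mulr_ge0 => //; rewrite !mulr_ge0.
  apply: leeD => //.
  under eq_integral do rewrite EFinM.
  rewrite ge0_integralZl//; [|exact/measurable_EFinP/measurable_indic|by rewrite lee_fin
    !mulr_ge0].
  rewrite integral_indicT// exprSr mulrA [leRHS]EFinM.
  by apply: lee_wpmul2l => //; rewrite lee_fin !mulr_ge0.
have Ap : (0 < A ^+ n)%R by apply: exprn_gt0; lra.
have step2 : \int[a]_x Gb x <= \int[b]_x Gb x + (e * A ^+ n)%:E.
  have mh : measurable_fun setT (fun x => ((A ^+ n)^-1)%:E * Gb x).
    exact: measurable_funeM.
  have hB x : 0 <= ((A ^+ n)^-1)%:E * Gb x <= (\1_B x)%:E.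
    apply/andP; split; first by apply: mule_ge0 => //; rewrite lee_fin invr_ge0.
    apply: (@le_trans _ _ (((A ^+ n)^-1)%:E * (A ^+ n * \1_B x)%:E)).
      by apply: lee_wpmul2l => //; rewrite lee_fin invr_ge0.
    by rewrite -EFinM mulrA mulVf ?mul1r// gt_eqF.
  have := ab _ mh hB.
  rewrite !ge0_integralZl// ?lee_fin ?invr_ge0//.
  have Ia0 : 0 <= \int[a]_x Gb x by exact: integral_ge0.
  have Ib0 : 0 <= \int[b]_x Gb x by exact: integral_ge0.
  move: Ia0 Ib0; move: (\int[a]_x Gb x) (\int[b]_x Gb x) => u v u0 v0 H.
  have := @lee_wpmul2l R (A ^+ n)%:E _ _ _ H; rewrite lee_fin => /(_ (An0 n)).
  rewrite ge0_muleDr ?mule_ge0 ?lee_fin ?invr_ge0//.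
  by rewrite !muleA -!EFinM mulfV ?gt_eqF// !mul1e [(_ * e)%R]mulrC.
apply: (le_trans step1); apply: (@le_trans _ _ (\int[b]_x Gb x + (e * A ^+ n)%:E + (n%:R * e * A
  ^+ n.+1)%:E)).
  exact: leeD.
rewrite -addeA -EFinD leeD2l// lee_fin.
have : (A ^+ n <= A ^+ n.+1)%R by rewrite exprS ler_peMl.
have : (0 <= e * (A ^+ n.+1 - A ^+ n))%R -> (e * A ^+ n + n%:R * e * A ^+ n.+1 <=
  n.+1%:R * e * A ^+ n.+1)%R.
  by rewrite -natr1; nra.
by move=> H1 H2; apply: H1; apply: mulr_ge0 => //; lra.
Qed.

End power_measure_maps.

Section power_measure_image.
Context d d' (T : measurableType d) (T' : measurableType d') (R : realType).
Local Open Scope ereal_scope.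

(** The map may depend on the index because a translation of R^d moves each coordinate by its own
    amount. *)
Definition tuple_map n (phi : nat -> T' -> T) (t : n.-tuple T') : n.-tuple T :=
  [tuple phi i (tnth t i) | i < n].

Lemma measurable_tuple_map n (phi : nat -> T' -> T) :
  (forall i, measurable_fun setT (phi i)) ->
  measurable_fun setT (@tuple_map n phi).
Proof.
move=> mphi; apply/measurable_fun_tnthP => i.
rewrite (_ : _ \o _ = phi i \o (@tnth n T')^~ i).
  by apply: measurableT_comp => //; exact: measurable_tnth.
by apply/funext => t /=; rewrite tnth_mktuple.
Qed.

Lemma tuple_map_cons n (phi : nat -> T' -> T) x (t : n.-tuple T') :
  tuple_map phi (cons_tuple x t) =
  (cons_tuple (phi 0%N x) (tuple_map (fun i => phi i.+1) t)).
Proof.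
apply: eq_from_tnth => i; rewrite tnth_mktuple.
by case: (unliftP ord0 i) => [j ->|->]; rewrite ?tnthS ?tnth_mktuple ?tnth0.
Qed.

Lemma integral_power_image (m : {sigma_finite_measure set T -> \bar R})
    (m' : {sigma_finite_measure set T' -> \bar R}) (phi : nat -> T' -> T) (c : R) :
  (0 <= c)%R -> (forall i, measurable_fun setT (phi i)) ->
  (forall i (f : T -> \bar R), measurable_fun setT f -> (forall x, 0 <= f x) ->
     \int[m]_x f x = c%:E * \int[m']_x f (phi i x)) ->
  forall n (F : n.-tuple T -> \bar R), measurable_fun setT F ->
    (forall t, 0 <= F t) ->
  \int[power_measure m n]_t F t =
  (c ^+ n)%:E * \int[power_measure m' n]_t F (tuple_map phi t).
Proof.
move=> c0 mphi mE n; elim: n phi mphi mE => [|n IH] phi mphi mE F mF F0.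
  rewrite !integral_power0//; last first.
    by apply: measurableT_comp => //; exact: measurable_tuple_map.
  by rewrite expr0 mul1e; congr F; apply: eq_from_tnth => -[].
have mFx x : measurable_fun setT (fun t => F (cons_tuple x t)).
  by apply: measurableT_comp => //; exact: measurable_fun_consl.
rewrite !integral_powerS//; last first.
  by apply: measurableT_comp => //; exact: measurable_tuple_map.
transitivity (\int[m]_x ((c ^+ n)%:E *
    \int[power_measure m' n]_t F (cons_tuple x (tuple_map (fun i => phi i.+1) t)))).
  by apply: eq_integral => x _; apply: (IH (fun i => phi i.+1)) => // i; exact: (mE i.+1).
under [in RHS]eq_integral do under eq_integral do rewrite tuple_map_cons.
have mG : measurable_fun setT (fun x =>
    \int[power_measure m' n]_t F (cons_tuple x (tuple_map (fun i => phi i.+1) t))).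
  apply: (measurable_fun_fubini_tonelli_F (fun z => F (cons_tuple z.1 (tuple_map (fun i =>
    phi i.+1) z.2)))) => //.
  apply: measurableT_comp => //; apply: measurable_cons => //.
  by apply: measurableT_comp => //; apply: measurable_tuple_map => i /=.
have G0 x : 0 <= \int[power_measure m' n]_t F (cons_tuple x (tuple_map (fun i => phi i.+1) t)).
  exact: integral_ge0.
rewrite ge0_integralZl// ?lee_fin ?exprn_ge0//.
by rewrite (mE 0%N)// muleA -EFinM -exprSr.
Qed.

End power_measure_image.

(** * Lebesgue measure under similarities and isometries *)

Section lebesgueR_affine.
Context (R : realType).
Local Open Scope ereal_scope.

Let aff1 (r a : R) (x : measurableTypeR R) : measurableTypeR R := (r * x + a)%R.

Let measurable_aff1 r a : measurable_fun setT (aff1 r a).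
Proof.
apply: (@measurable_funD _ (measurableTypeR R) R setT (fun x => r * x)%R (fun=> a)) => //.
exact: mulrl_measurable.
Qed.

Lemma lebesgue_measure_affine (r a : R) A : (0 < r)%R -> measurable A ->
  lebesgue_measure A =
  r%:E * lebesgue_measure ((fun x => (r * x + a)%R) @^-1` A).
Proof.
move=> r0 mA.
pose mu := mscale (NngNum (ltW r0))
  (measure_function_pushforward__canonical__measure_function_Measure lebesgue_measure
    (measurable_aff1 r a)).
suff -> : lebesgue_measure A = mu A by [].
apply: lebesgue_measure_unique => // _ [[u v]] _ <-.
change (lebesgue_measure (`]u, v]%classic : set (measurableTypeR R)) =
  r%:E * lebesgue_measure ((fun x : R => (r * x + a)%R) @^-1` `]u, v]%classic)).
rewrite (_ : _ @^-1` _ = `]((u - a) / r)%R, ((v - a) / r)%R]%classic); last first.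
  apply/seteqP; split => x /=; rewrite !in_itv/= ltr_pdivrMr// ler_pdivlMr//.
    by move=> /andP[? ?]; apply/andP; split; lra.
  by move=> /andP[? ?]; apply/andP; split; lra.
rewrite !lebesgue_measure_itv/= !lte_fin ltr_pM2r ?invr_gt0// ltrD2r.
case: ifPn => _; last by rewrite mule0.
by rewrite -!EFinB -EFinM; congr EFin; field; rewrite gt_eqF.
Qed.

Let measurable_idR : measurable_fun setT (idfun : measurableTypeR R -> R).
Proof. by move=> _ A mA; rewrite setTI. Qed.

Lemma integral_lebesgueR (f : R -> \bar R) (D : set R) : measurable D ->
  measurable_fun D f -> (forall x, D x -> 0 <= f x) ->
  \int[lebesgueR]_(x in D) f x = \int[lebesgue_measure]_(x in D) f x.
Proof.
move=> mD mf f0.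
transitivity (\int[pushforward lebesgue_measure (idfun : measurableTypeR R -> R)]_(x in D) f x).
  by apply: eq_measure_integral.
rewrite ge0_integral_pushforward// => x /set_mem; exact: f0.
Qed.

Lemma integral_lebesgueR_affine (r a : R) (f : R -> \bar R) : (0 < r)%R ->
  measurable_fun setT f -> (forall x, 0 <= f x) ->
  \int[lebesgueR]_x f x = r%:E * \int[lebesgueR]_x f (r * x + a)%R.
Proof.
move=> r0 mf f0.
have maff : measurable_fun setT (fun x : R => r * x + a)%R.
  by apply: measurable_funD => //; exact: mulrl_measurable.
pose mu := mscale (NngNum (ltW r0))
  (measure_function_pushforward__canonical__measure_function_Measure (@lebesgueR R) maff).
transitivity (\int[mu]_x f x).
  by apply: eq_measure_integral => A mA _; exact: lebesgue_measure_affine.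
rewrite ge0_integral_mscale//; congr (_ * _).
by rewrite ge0_integral_pushforward// preimage_setT.
Qed.

End lebesgueR_affine.

(** * The Euclidean distance on tuples of reals *)

Section euclidean.
Context (R : realType) (d : nat).
Implicit Types (x y z v w : d.-tuple R).

Definition dot x y : R := \sum_(i < d) tnth x i * tnth y i.

Definition affine (r : R) v x : d.-tuple R :=
  tuple_map (fun i a => r * a + nth 0 v i) x.

Lemma tnth_affine r v x i : tnth (affine r v x) i = r * tnth x i + tnth v i.
Proof. by rewrite tnth_mktuple (tnth_nth 0 v). Qed.

Lemma measurable_affine r v : measurable_fun setT (affine r v).
Proof.
apply: measurable_tuple_map => i.
by apply: measurable_funD => //; exact: mulrl_measurable.
Qed.

Lemma integral_lebesgue_tuple m (f : m.-tuple R -> \bar R) D :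
  (\int[lebesgue_tuple m]_(x in D) f x =
   \int[power_measure (@lebesgueR R) m]_(x in D) f x)%E.
Proof. by apply: eq_measure_integral => A _ _; exact: (congr1 (@^~ A) (lebesgue_tupleE R m)). Qed.

Lemma integral_affine r v (f : d.-tuple R -> \bar R) : 0 < r ->
  measurable_fun setT f -> (forall x, (0 <= f x)%E) ->
  (\int[lebesgue_tuple d]_x f x =
   (r ^+ d)%:E * \int[lebesgue_tuple d]_x f (affine r v x))%E.
Proof.
move=> r0 mf f0; rewrite !integral_lebesgue_tuple.
apply: integral_power_image => //; first exact: ltW.
  by move=> i; apply: measurable_funD => //; exact: mulrl_measurable.
by move=> i g mg g0; exact: integral_lebesgueR_affine.
Qed.

Lemma dist_ge0 x y : 0 <= euclidean_dist x y. Proof. exact: sqrtr_ge0. Qed.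

Lemma sum_sqr_ge0 (a : 'I_d -> R) : 0 <= \sum_(i < d) a i ^+ 2.
Proof. by apply: sumr_ge0 => i _; exact: sqr_ge0. Qed.

Lemma dist_sqr x y :
  euclidean_dist x y ^+ 2 = \sum_(i < d) (tnth x i - tnth y i) ^+ 2.
Proof. by rewrite sqr_sqrtr// sum_sqr_ge0. Qed.

Lemma distC x y : euclidean_dist x y = euclidean_dist y x.
Proof.
by rewrite /euclidean_dist; congr Num.sqrt; apply: eq_bigr => i _; rewrite -sqrrN opprB.
Qed.

Lemma distxx x : euclidean_dist x x = 0.
Proof.
by rewrite /euclidean_dist big1 ?sqrtr0// => i _; rewrite subrr expr0n.
Qed.

(** With A, B, C the three sums, the nonnegative sum of the (B a_i - C b_i)^2 equals B (A B - C^2).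
    If B = 0, all [b i] vanish and so does C. *)
Lemma cauchy_schwarz (a b : 'I_d -> R) :
  (\sum_(i < d) a i * b i) ^+ 2 <=
  (\sum_(i < d) a i ^+ 2) * (\sum_(i < d) b i ^+ 2).
Proof.
set A := \sum_(i < d) a i ^+ 2; set B := \sum_(i < d) b i ^+ 2.
set C := \sum_(i < d) a i * b i.
have H : \sum_(i < d) (B * a i - C * b i) ^+ 2 = B * (A * B - C ^+ 2).
  transitivity (\sum_(i < d) (B ^+ 2 * a i ^+ 2 + (- (2 * B * C)) * (a i * b i)
                             + C ^+ 2 * b i ^+ 2)).
    by apply: eq_bigr => i _; ring.
  by rewrite !big_split/= -!mulr_sumr -/A -/B -/C; ring.
have B0 : 0 <= B by exact: sum_sqr_ge0.
have : 0 <= B * (A * B - C ^+ 2) by rewrite -H sum_sqr_ge0.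
move: B0; rewrite le_eqVlt => /predU1P[B0 _|B0]; last first.
  by rewrite pmulr_rge0// subr_ge0.
suff -> : C = 0 by rewrite -B0 mulr0 expr0n.
apply: big1 => i _; have : b i ^+ 2 = 0.
  apply: (@psumr_eq0P _ _ xpredT (fun i => b i ^+ 2)) => //.
  by move=> j _; exact: sqr_ge0.
by move/eqP; rewrite sqrf_eq0 => /eqP ->; rewrite mulr0.
Qed.

Lemma dist_triangle y x z :
  euclidean_dist x z <= euclidean_dist x y + euclidean_dist y z.
Proof.
rewrite -(@ler_pXn2r _ 2)// ?nnegrE ?dist_ge0 ?addr_ge0 ?dist_ge0//.
rewrite sqrrD !dist_sqr.
have -> : \sum_(i < d) (tnth x i - tnth z i) ^+ 2 =
    \sum_(i < d) (tnth x i - tnth y i) ^+ 2 +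
    (\sum_(i < d) (tnth x i - tnth y i) * (tnth y i - tnth z i)) *+ 2 +
    \sum_(i < d) (tnth y i - tnth z i) ^+ 2.
  by rewrite -sumrMnl -!big_split/=; apply: eq_bigr => i _; ring.
rewrite lerD2r lerD2l lerMn2r/=.
apply: le_trans (ler_norm _) _.
rewrite -(@ler_pXn2r _ 2)// ?nnegrE ?mulr_ge0 ?dist_ge0//.
by rewrite exprMn !dist_sqr real_normK ?num_real//; exact: cauchy_schwarz.
Qed.

Lemma dist_affine r v x y : 0 <= r ->
  euclidean_dist (affine r v x) (affine r v y) = r * euclidean_dist x y.
Proof.
move=> r0; rewrite -[in RHS](ger0_norm r0) -sqrtr_sqr -sqrtrM ?sqr_ge0//.
rewrite /euclidean_dist mulr_sumr; congr Num.sqrt; apply: eq_bigr => i _.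
by rewrite !tnth_affine; ring.
Qed.

Lemma measurable_dist dT (T : measurableType dT) (f g : T -> d.-tuple R) :
  measurable_fun setT f -> measurable_fun setT g ->
  measurable_fun setT (fun t => euclidean_dist (f t) (g t)).
Proof.
move=> mf mg; apply: (measurableT_comp (continuous_measurable_fun (@sqrt_continuous R))).
apply: measurable_sum => i; apply: measurable_funX; apply: measurable_funB.
  by apply: (measurableT_comp (measurable_tnth i)).
by apply: (measurableT_comp (measurable_tnth i)).
Qed.

Lemma measurable_eball x r : measurable (eball x r).
Proof.
rewrite (_ : eball x r = (fun y => euclidean_dist x y) @^-1` `]-oo, r[%classic).
  by rewrite -[X in measurable X]setTI; apply: measurable_dist.
by apply/seteqP; split => y /=; rewrite in_itv.
Qed.

Lemma eball0 x r : r <= 0 -> eball x r = set0.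
Proof.
move=> r0; apply/seteqP; split => // y /=; rewrite /eball/= => H.
by have := lt_le_trans H r0; rewrite ltNge dist_ge0.
Qed.

Lemma dist_coord x y i : `|tnth x i - tnth y i| <= euclidean_dist x y.
Proof.
rewrite -(@ler_pXn2r _ 2)// ?nnegrE ?dist_ge0// dist_sqr real_normK ?num_real//.
by rewrite (bigD1 i)//= lerDl; apply: sumr_ge0 => j _; exact: sqr_ge0.
Qed.

(** The factor [d] in place of its square root is crude but rational; the constants of
    [region_contains_ball] are built on it. *)
Lemma dist_le_coord x y (e : R) : (0 < d)%N -> (forall i, `|tnth x i - tnth y i| <= e) ->
  euclidean_dist x y <= d%:R * e.
Proof.
move=> d0 H; have e0 : 0 <= e by apply: le_trans (H (Ordinal d0)).
rewrite -(@ler_pXn2r _ 2)// ?nnegrE ?dist_ge0 ?mulr_ge0// dist_sqr.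
apply: (@le_trans _ _ (\sum_(i < d) e ^+ 2)).
  apply: ler_sum => i _; rewrite -[leLHS]real_normK ?num_real//.
  by rewrite ler_pXn2r// ?nnegrE.
rewrite sumr_const card_ord -[leLHS]mulr_natl exprMn ler_wpM2r ?sqr_ge0//.
by rewrite -natrX ler_nat expnS leq_pmulr// expn_gt0 d0.
Qed.

End euclidean.

(** * Volumes of balls, and invariance of Lebesgue measure under reflections *)

Section euclidean_measure.
Context (R : realType) (d : nat) (d_gt0 : (0 < d)%N).
Local Notation vec := (d.-tuple R).
Local Notation leb := (@lebesgue_tuple R d).
Implicit Types (x y z v w : vec).
Local Open Scope ereal_scope.

Lemma leb_rect (A : 'I_d -> set R) : (forall i, measurable (A i)) ->
  leb (rect A) = \prod_(i < d) lebesgueR (A i).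
Proof. by move=> mA; rewrite lebesgue_tupleE power_rect. Qed.

Lemma leb_ball_affine x r : (0 < r)%R -> leb (eball x r) = (r ^+ d)%:E * leb unit_ball.
Proof.
move=> r0; rewrite -integral_indicT; last exact: measurable_eball.
rewrite (@integral_affine _ _ r x)//; last first.
  by apply/measurable_EFinP/measurable_indic; exact: measurable_eball.
rewrite -[in RHS]integral_indicT; last exact: measurable_eball.
congr (_ * _); apply: eq_integral => y _; rewrite !indicE; congr (_%:R)%:E.
have affx : affine r x origin = x.
  by apply: eq_from_tnth => i; rewrite tnth_affine tnth_mktuple mulr0 add0r.
have D : euclidean_dist x (affine r x y) = (r * euclidean_dist origin y)%R.
  by rewrite -{1}affx dist_affine ?(ltW r0).
by congr nat_of_bool; apply/idP/idP; rewrite !inE /unit_ball /eball/= D gtr_pMr.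
Qed.

Lemma leb_unit_ball_lty : leb unit_ball < +oo.
Proof.
have mI (i : 'I_d) : measurable (`](-1)%R, 1%R[%classic : set R) by [].
apply: (@le_lt_trans _ _ (leb (rect (fun _ : 'I_d => `](-1)%R, 1%R[%classic : set R)))).
  apply: le_measure; rewrite ?inE; [exact: measurable_eball|exact: measurable_rect|].
  move=> y; rewrite /unit_ball /eball/= => H i.
  have := le_lt_trans (dist_coord origin y i) H.
  by rewrite tnth_mktuple sub0r normrN ltr_norml/= in_itv.
rewrite leb_rect// ltey_eq; apply/orP; left.
apply: prode_fin_num => i.
by rewrite /lebesgueR lebesgue_measure_itv/=; case: ifP.
Qed.

Lemma leb_unit_ball_gt0 : 0 < leb unit_ball.
Proof.
(* By [dist_le_coord] the cube of half-side 1/(2d) stays within distance 1/2 of the origin. *)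
pose e : R := (d%:R^-1 / 2)%R.
have e0 : (0 < e)%R by rewrite divr_gt0// invr_gt0 ltr0n.
have mI (i : 'I_d) : measurable (`](- e)%R, e%R[%classic : set R) by [].
apply: (@lt_le_trans _ _ (leb (rect (fun _ : 'I_d => `](- e)%R, e%R[%classic : set R))));
  last first.
  apply: le_measure; rewrite ?inE; [exact: measurable_rect|exact: measurable_eball|].
  move=> y /= H; rewrite /unit_ball /eball/=.
  have H' i : (`|tnth origin i - tnth y i| <= e)%R.
    by rewrite tnth_mktuple sub0r normrN; move: (H i); rewrite /= in_itv/= -ltr_norml => /ltW.
  apply: le_lt_trans (dist_le_coord d_gt0 H') _.
  by rewrite mulrA mulfV ?mul1r ?pnatr_eq0 -?lt0n// invf_lt1// ltr1n.
rewrite leb_rect//; apply: prode_gt0 => i.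
rewrite /lebesgueR lebesgue_measure_itv/= lte_fin gtrN// -EFinD lte_fin; lra.
Qed.

Definition ball_volume : R := fine (leb unit_ball).

Lemma ball_volume_gt0 : (0 < ball_volume)%R.
Proof. by rewrite fine_gt0// leb_unit_ball_gt0 leb_unit_ball_lty. Qed.

Lemma leb_unit_ball : leb unit_ball = ball_volume%:E.
Proof. by rewrite fineK// ge0_fin_numE// leb_unit_ball_lty. Qed.

Lemma leb_ball x r : (0 <= r)%R -> leb (eball x r) = (ball_volume * r ^+ d)%:E.
Proof.
rewrite le_eqVlt => /predU1P[<-|r0]; last by rewrite leb_ball_affine// leb_unit_ball mulrC EFinM.
by rewrite eball0// measure0 expr0n gtn_eqF// mulr0.
Qed.

(** For every [e > 0] the sphere lies in the shell between the balls of radii [s] and [s + e], whose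
    volume tends to 0 with [e] by continuity of powers. *)
Lemma leb_sphere x s : leb ((euclidean_dist x) @^-1` [set s]) = 0.
Proof.
have mS : measurable ((euclidean_dist x) @^-1` [set s]).
  by rewrite -[X in measurable X]setTI; apply: measurable_dist.
have [s0|s0] := ltP s 0%R.
  rewrite (_ : _ @^-1` _ = set0) ?measure0//; apply/seteqP; split => // y /= H.
  by have := dist_ge0 x y; rewrite H leNgt s0.
have H e : (0 < e)%R -> leb ((euclidean_dist x) @^-1` [set s]) <=
    (ball_volume * ((s + e) ^+ d - s ^+ d))%:E.
  move=> e0; rewrite mulrBr EFinB -!(leb_ball x) ?addr_ge0 ?(ltW e0)//.
  rewrite leeBrDr; last by rewrite leb_ball.
  rewrite -measureU//=; last first.
  - by apply/seteqP; split => // y [/= Hy]; rewrite /eball/= Hy ltxx.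
  - exact: measurable_eball.
  apply: le_measure; rewrite ?inE.
  - by apply: measurableU => //; exact: measurable_eball.
  - exact: measurable_eball.
  by move=> y [|]/= Hy; rewrite /eball/=; move: Hy; rewrite /eball/= => Hy; lra.
apply/eqP; rewrite eq_le measure_ge0 andbT; apply/lee_addgt0Pr => e e0.
rewrite add0e.
have /cvgrPdist_lt/(_ (e / ball_volume)%R) : (fun h : R => (s + h) ^+ d)%R @ (0:R)%R^'+ -->
  ((s + 0) ^+ d)%R.
  apply: cvg_at_right_filter; apply: (@continuous_comp _ _ _ (fun h : R =>
    s + h)%R (fun h : R => h ^+ d)%R).
    by apply: cvgD; [exact: cvg_cst|exact: cvg_id].
  exact: exprn_continuous.
have kp := ball_volume_gt0.
rewrite divr_gt0// => /(_ erefl) Hn.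
have : (\forall h \near (0:R)%R^'+, leb ((euclidean_dist x) @^-1` [set s]) <= e%:E).
  near=> h.
  have h0 : (0 < h)%R by near: h; exact: nbhs_right_gt.
  apply: (le_trans (H h h0)); rewrite lee_fin.
  have : (`|(s + 0) ^+ d - (s + h) ^+ d| < e / ball_volume)%R by near: h.
  rewrite addr0 distrC => /(le_lt_trans (ler_norm _)).
  by rewrite ltr_pdivlMr// mulrC => /ltW.
by move=> /filter_ex[].
Unshelve. all: by end_near. Qed.

(** Written as a similarity of ratio one, so that translation invariance is a case of
    [integral_affine]. *)
Definition vadd x y : vec := affine 1%R y x.

Lemma integral_translate v (f : vec -> \bar R) :
  measurable_fun setT f -> (forall x, 0 <= f x) ->
  \int[leb]_x f (vadd x v) = \int[leb]_x f x.
Proof.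
by move=> mf f0; rewrite [RHS](@integral_affine _ _ 1%R v)// expr1n mul1e.
Qed.

Lemma measurable_vadd dT (T : measurableType dT) (f g : T -> vec) :
  measurable_fun setT f -> measurable_fun setT g ->
  measurable_fun setT (fun t => vadd (f t) (g t)).
Proof.
move=> mf mg; apply/measurable_fun_tnthP => i.
rewrite (_ : _ \o _ = (fun t => tnth (f t) i + tnth (g t) i)%R).
  apply: measurable_funD; first by apply: (measurableT_comp (measurable_tnth i)).
  by apply: (measurableT_comp (measurable_tnth i)).
by apply/funext => t /=; rewrite tnth_affine mul1r.
Qed.

Definition vopp x : vec := affine (-1)%R origin x.

Lemma tnth_vopp x i : tnth (vopp x) i = (- tnth x i)%R.
Proof. by rewrite tnth_affine tnth_mktuple mulN1r addr0. Qed.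

Lemma tnth_vadd x y i : tnth (vadd x y) i = (tnth x i + tnth y i)%R.
Proof. by rewrite tnth_affine mul1r. Qed.

(* Uniqueness of Haar measure: integrate [g (S x) * h y] in two ways, using
   translation invariance in [y] and then in [x]. *)
Lemma haar_exchange (S S' : vec -> vec) (g h : vec -> \bar R) :
  measurable_fun setT S -> (forall x y, S (vadd x (S' y)) = vadd (S x) y) ->
  measurable_fun setT g -> (forall x, 0 <= g x) ->
  measurable_fun setT h -> (forall x, 0 <= h x) ->
  (\int[leb]_x g (S x)) * (\int[leb]_x h x) =
  (\int[leb]_x h (vopp (S x))) * (\int[leb]_x g x).
Proof.
move=> mS SS mg g0 mh h0.
have mopp : measurable_fun setT vopp by exact: measurable_affine.
have cmp dT (T : measurableType dT) (f : T -> vec) (k : vec -> \bar R) :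
    measurable_fun setT k -> measurable_fun setT f -> measurable_fun setT (fun t => k (f t)).
  by move=> mk mf; apply: measurableT_comp.
have i0 (k : vec -> \bar R) : (forall x, 0 <= k x) -> 0 <= \int[leb]_x k x.
  by move=> k0; exact: integral_ge0.
have mSf dT (T : measurableType dT) (f : T -> vec) : measurable_fun setT f ->
    measurable_fun setT (fun t => S (f t)).
  by move=> mf; apply: measurableT_comp.
have moppf dT (T : measurableType dT) (f : T -> vec) : measurable_fun setT f ->
    measurable_fun setT (fun t => vopp (f t)).
  by move=> mf; apply: measurableT_comp.
transitivity (\int[leb]_x \int[leb]_y (g (S x) * h (vadd y (vopp (S x))))).
  rewrite -ge0_integralZr//; last 2 first.
  - exact: cmp.
  - exact: i0.
  apply: eq_integral => x _; rewrite ge0_integralZl//; last first.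
    by apply: cmp => //; exact: measurable_affine.
  by rewrite integral_translate.
rewrite (fubini_tonelli (fun p => g (S p.1) * h (vadd p.2 (vopp (S p.1)))))/=; last 2 first.
- apply: emeasurable_funM; apply: cmp => //; first exact: mSf.
  by apply: measurable_vadd => //; apply: moppf; exact: mSf.
- by move=> p; exact: mule_ge0.
transitivity (\int[leb]_y \int[leb]_x (g (vadd (S x) y) * h (vopp (S x)))).
  apply: eq_integral => y _.
  rewrite -[LHS](@integral_translate (S' y)); last 2 first.
  - apply: emeasurable_funM; first exact: cmp.
    apply: (cmp _ _ (fun x => vadd y (vopp (S x))) h) => //.
    by apply: measurable_vadd => //; apply: moppf.
  - by move=> x; exact: mule_ge0.
  apply: eq_integral => x _; rewrite SS; congr (_ * h _).
  apply: eq_from_tnth => i; rewrite !tnth_vadd !tnth_vopp tnth_vadd; lra.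
rewrite -(fubini_tonelli (fun p => g (vadd (S p.1) p.2) * h (vopp (S p.1))))/=; last 2 first.
- apply: emeasurable_funM; apply: cmp => //; last by apply: moppf; exact: mSf.
  by apply: measurable_vadd => //; exact: mSf.
- by move=> p; exact: mule_ge0.
rewrite -ge0_integralZr//; last 2 first.
- by apply: cmp => //; exact: moppf.
- exact: i0.
apply: eq_integral => x _.
rewrite muleC -[in RHS](integral_translate (S x))// -ge0_integralZr//.
  apply: eq_integral => y _; congr (g _ * _).
  by apply: eq_from_tnth => i; rewrite !tnth_vadd addrC.
by apply: cmp => //; apply: measurable_vadd.
Qed.

(** The Householder reflection in the hyperplane orthogonal to [w]. For [w = 0] the inverse of 0 is
    0 and the map is the identity, so no hypothesis on [w] is needed. *)
Definition reflection w x : vec :=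
  [tuple (tnth x i - 2 * dot x w / dot w w * tnth w i)%R | i < d].

Lemma reflection_dist w x y :
  euclidean_dist (reflection w x) (reflection w y) = euclidean_dist x y.
Proof.
rewrite /euclidean_dist; congr Num.sqrt.
set c := (fun z => 2 * dot z w / dot w w)%R.
transitivity (\sum_(i < d) ((tnth x i - tnth y i) ^+ 2
   - 2 * (c x - c y) * (tnth x i * tnth w i - tnth y i * tnth w i)
   + (c x - c y) ^+ 2 * (tnth w i * tnth w i)))%R.
  by apply: eq_bigr => i _; rewrite !tnth_mktuple -/(c x) -/(c y); ring.
rewrite big_split/= sumrB -!mulr_sumr sumrB -/(dot x w) -/(dot y w) -/(dot w w).
rewrite /c; have [->|w0] := eqVneq (dot w w) 0%R; first by rewrite invr0; ring.
by field.
Qed.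

Lemma reflectionK w : involutive (reflection w).
Proof.
move=> x; apply: eq_from_tnth => i; rewrite !tnth_mktuple.
have -> : (dot (reflection w x) w = dot x w - 2 * dot x w / dot w w * dot w w)%R.
  set c := (2 * dot x w / dot w w)%R.
  transitivity (\sum_(j < d) (tnth x j * tnth w j - c * (tnth w j * tnth w j)))%R.
    by apply: eq_bigr => j _; rewrite tnth_mktuple -/c; ring.
  by rewrite sumrB -mulr_sumr.
have [->|w0] := eqVneq (dot w w) 0%R; first by rewrite invr0; ring.
by field.
Qed.

Lemma reflection_vadd w x y :
  reflection w (vadd x y) = vadd (reflection w x) (reflection w y).
Proof.
apply: eq_from_tnth => i; rewrite !(tnth_vadd, tnth_mktuple).
have -> : (dot (vadd x y) w = dot x w + dot y w)%R.
  by rewrite /dot -big_split; apply: eq_bigr => j _; rewrite tnth_vadd/=; ring.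
by ring.
Qed.

Lemma reflection_origin w : reflection w origin = origin.
Proof.
apply: eq_from_tnth => i; rewrite !tnth_mktuple.
have -> : (dot origin w = 0)%R by apply: big1 => j _; rewrite tnth_mktuple mul0r.
by rewrite mulr0 mul0r mul0r subr0.
Qed.

Lemma measurable_reflection w : measurable_fun setT (reflection w).
Proof.
apply/measurable_fun_tnthP => i.
rewrite (_ : _ \o _ = (fun x => tnth x i - 2 * dot x w / dot w w * tnth w i)%R); last first.
  by apply/funext => x /=; rewrite tnth_mktuple.
apply: measurable_funB; first exact: measurable_tnth.
apply: measurable_funM => //; apply: measurable_funM => //; apply: measurable_funM => //.
apply: measurable_sum => j; apply: measurable_funM => //; exact: measurable_tnth.
Qed.

(** In [haar_exchange] take for [g] the indicator of the unit ball, which the reflection preserves: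
    both sides then carry the volume of the ball, positive and finite, which cancels. The sign in
    [S] undoes the [vopp] of that lemma. *)
Lemma integral_reflection w (f : vec -> \bar R) :
  measurable_fun setT f -> (forall x, 0 <= f x) ->
  \int[leb]_x f (reflection w x) = \int[leb]_x f x.
Proof.
move=> mf f0; pose S x := vopp (reflection w x).
have mS : measurable_fun setT S.
  by apply: measurableT_comp; [exact: measurable_affine|exact: measurable_reflection].
have oppA x y : vopp (vadd x y) = vadd (vopp x) (vopp y).
  by apply: eq_from_tnth => i; rewrite !(tnth_vopp, tnth_vadd) opprD.
have oppK x : vopp (vopp x) = x.
  by apply: eq_from_tnth => i; rewrite !tnth_vopp opprK.
have SS x y : S (vadd x (reflection w (vopp y))) = vadd (S x) y.
  by rewrite /S reflection_vadd oppA reflectionK oppK.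
have mB : measurable (@unit_ball R d) by exact: measurable_eball.
have mg : measurable_fun setT (fun x => (\1_(@unit_ball R d) x)%:E : \bar R).
  exact/measurable_EFinP/measurable_indic.
have g0 x : 0 <= (\1_(@unit_ball R d) x)%:E :> \bar R by rewrite lee_fin.
have := haar_exchange mS SS mg g0 mf f0.
have -> : \int[leb]_x (\1_(@unit_ball R d) (S x))%:E = leb unit_ball.
  rewrite -integral_indicT//; apply: eq_integral => x _; rewrite !indicE.
  congr (_%:R)%:E; congr nat_of_bool; rewrite /unit_ball /eball.
  suff distS : euclidean_dist origin (S x) = euclidean_dist origin x.
    by apply/idP/idP; rewrite !inE/= distS.
  transitivity (euclidean_dist origin (reflection w x)).
    rewrite /euclidean_dist; congr Num.sqrt; apply: eq_bigr => i _.
    by rewrite tnth_vopp tnth_mktuple !sub0r !sqrrN.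
  by rewrite -{1}(reflection_origin w) reflection_dist.
have -> : \int[leb]_x (\1_(@unit_ball R d) x)%:E = ball_volume%:E.
  by rewrite integral_indicT//; exact: leb_unit_ball.
have -> : leb unit_ball = ball_volume%:E by exact: leb_unit_ball.
move=> E.
have {E} E : ball_volume%:E * \int[leb]_x f x = ball_volume%:E * \int[leb]_x f (reflection w x).
  by rewrite E muleC; congr (_ * _); apply: eq_integral => x _; rewrite /S oppK.
have := congr1 (fun u : \bar R => (ball_volume^-1)%:E * u) E.
by rewrite !muleA -!EFinM mulVf ?gt_eqF ?ball_volume_gt0// !mul1e => ->.
Qed.

(** A reflection takes [e1] to the direction of [y], and a dilation follows. Only distances and
    Lebesgue measure matter, so orientation need not be kept; in dimension one no rotation would
    do. *)
Lemma similarity y : (0 < euclidean_dist origin y)%R ->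
  exists S : vec -> vec, [/\ measurable_fun setT S, S e1 = y, S origin = origin,
    (forall a b, euclidean_dist (S a) (S b) = euclidean_dist origin y * euclidean_dist a b)%R &
    forall f : vec -> \bar R, measurable_fun setT f -> (forall x, 0 <= f x) ->
      \int[leb]_x f x = (euclidean_dist origin y ^+ d)%:E * \int[leb]_x f (S x)].
Proof.
set r := euclidean_dist origin y => r0.
(* [th] is the direction of [y]; the mirror with normal [e1 - th] exchanges the two unit vectors. *)
pose th := affine r^-1 origin y; pose w := vadd e1 (vopp th).
have dote1 x : dot e1 x = tnth x (Ordinal d_gt0).
  rewrite /dot (bigD1 (Ordinal d_gt0))//= big1 ?addr0; last first.
    move=> i i0; rewrite tnth_mktuple (_ : (i == 0%N :> nat) = false) ?mul0r//.
    by apply: contraNF i0 => /eqP i0; apply/eqP/val_inj.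
  by rewrite tnth_mktuple/= mul1r.
have e1e1 : dot e1 (@e1 R d) = 1%R by rewrite dote1 tnth_mktuple.
have thth : dot th th = 1%R.
  have : (r ^+ 2 = dot y y)%R.
    rewrite dist_sqr; apply: eq_bigr => i _.
    by rewrite tnth_mktuple sub0r sqrrN expr2.
  move=> r2; have -> : (dot th th = r^-1 ^+ 2 * dot y y)%R.
    rewrite /dot mulr_sumr; apply: eq_bigr => i _.
    by rewrite tnth_affine tnth_mktuple; ring.
  by rewrite -r2 exprVn mulVf// expf_eq0/= gt_eqF.
have e1w : (dot e1 w = 1 - dot e1 th)%R.
  by rewrite -[X in (X - _)%R]e1e1 !dote1 tnth_vadd tnth_vopp.
(* As both vectors are unit vectors, the coefficient of [w] in the reflection of [e1] is exactly
   1. *)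
have ww : (dot w w = 2 * dot e1 w)%R.
  rewrite e1w; transitivity (dot e1 (@e1 R d) - 2 * dot e1 th + dot th th)%R.
    rewrite /dot mulr_sumr -sumrB -big_split/=; apply: eq_bigr => i _.
    by rewrite tnth_vadd tnth_vopp; ring.
  by rewrite e1e1 thth; ring.
have refl : reflection w e1 = th.
  apply: eq_from_tnth => i; rewrite tnth_mktuple -ww.
  (* A vanishing normal means that [e1] is already [th], and the reflection is then the identity. *)
  have [w0|w0] := eqVneq (dot w w) 0%R; last first.
    by rewrite mulfV// mul1r tnth_vadd tnth_vopp; lra.
  rewrite w0 mul0r mul0r subr0.
  have : (tnth w i ^+ 2 = 0)%R.
    have W : forall j : 'I_d, true -> (0 <= tnth w j * tnth w j)%R.
      by move=> j _; rewrite -expr2 sqr_ge0.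
    by rewrite expr2; exact: (psumr_eq0P W w0).
  move/eqP; rewrite sqrf_eq0 tnth_vadd tnth_vopp subr_eq0 => /eqP; exact.
exists (fun x => affine r origin (reflection w x)); split.
- by apply: measurableT_comp; [exact: measurable_affine|exact: measurable_reflection].
- apply: eq_from_tnth => i; rewrite refl !tnth_affine tnth_mktuple.
  by rewrite !addr0 mulrA mulfV ?mul1r// gt_eqF.
- rewrite reflection_origin; apply: eq_from_tnth => i.
  by rewrite tnth_affine tnth_mktuple mulr0 addr0.
- by move=> a b; rewrite dist_affine ?(ltW r0)// reflection_dist.
- move=> f mf f0; rewrite (@integral_affine _ _ r origin)//; congr (_ * _).
  rewrite (@integral_reflection w (fun x => f (affine r origin x)))//.
  by apply: measurableT_comp => //; exact: measurable_affine.
Qed.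

End euclidean_measure.

(** * Polar coordinates *)

Section gamma_integral.
Context (R : realType).

(** Minus the upper incomplete gamma integral: the primitive of [x ^+ k * expR (- a * x)] that
    vanishes at infinity, by repeated integration by parts. *)
Fixpoint gamma_primitive (a : R) (k : nat) (x : R) : R :=
  if k is j.+1 then
    a^-1 * (k%:R * gamma_primitive a j x - x ^+ k * expR (- a * x))
  else - (a^-1 * expR (- a * x)).

Lemma is_derive_gamma_primitive (a x : R) k : 0 < a ->
  is_derive x 1 (gamma_primitive a k) (x ^+ k * expR (- a * x)).
Proof.
move=> a0; elim: k => [|k IH] /=.
  by apply: is_derive_eq; rewrite /GRing.scale/= expr0; field; rewrite gt_eqF.
have D1 : is_derive x 1 (fun y : R => expR (- a * y)) (- a * expR (- a * x)).
  by apply: is_derive_eq; rewrite /GRing.scale/= mulr1 mulrC.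
have D2 : is_derive x 1 (fun y : R => y ^+ k.+1) (k.+1%:R * x ^+ k).
  rewrite (_ : (fun y : R => y ^+ k.+1) = (id : R -> R) ^+ k.+1); last first.
    by apply/funext => y; rewrite exprfctE.
  by apply: (is_derive_eq (is_deriveX k.+1 (is_derive_id x 1))); rewrite /GRing.scale/= mulr1.
have D3 := is_deriveZ a^-1 (is_deriveB (is_deriveZ k.+1%:R IH) (is_deriveM D2 D1)).
apply: (is_derive_eq D3); rewrite /GRing.scale/= exprS; field; by rewrite gt_eqF.
Qed.

(** The exponential of [a * x] exceeds its own Taylor term of order [k.+1], one order above the
    numerator. *)
Lemma exprn_expRN_cvg0 (a : R) k : 0 < a ->
  x ^+ k * expR (- a * x) @[x --> +oo] --> (0 : R).
Proof.
move=> a0; apply/cvgrPdist_lt => e e0; near=> x.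
have x0 : 0 < x by near: x; exact: nbhs_pinfty_gt.
rewrite sub0r normrN ger0_norm ?mulr_ge0 ?expR_ge0 ?exprn_ge0 ?(ltW x0)//.
have ax0 : 0 < a * x by rewrite mulr_gt0.
have H : (a * x) ^+ k.+1 / k.+1`!%:R <= expR (a * x).
  by apply: le_trans (expR_ge1Dxn k (ltW ax0)); rewrite lerDr.
have f0 : 0 < k.+1`!%:R :> R by rewrite ltr0n fact_gt0.
have : x > k.+1`!%:R / a ^+ k.+1 / e by near: x; apply: nbhs_pinfty_gt; rewrite num_real.
rewrite ltr_pdivrMr// => xe.
rewrite mulNr expRN ltr_pdivrMr ?expR_gt0//.
apply: (@lt_le_trans _ _ (e * ((a * x) ^+ k.+1 / k.+1`!%:R))); last by rewrite ler_pM2l.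
rewrite mulrA ltr_pdivlMr// exprMn [x ^+ k.+1]exprS.
move: xe; rewrite ltr_pdivrMr ?exprn_gt0// => xe.
rewrite -(ltr_pM2l (exprn_gt0 k x0)) in xe.
by apply: lt_le_trans xe _; rewrite le_eqVlt; apply/orP; left; apply/eqP; ring.
Unshelve. all: by end_near. Qed.

Lemma gamma_primitive_cvg0 (a : R) k : 0 < a ->
  gamma_primitive a k x @[x --> +oo] --> (0 : R).
Proof.
move=> a0; elim: k => [|k IH] /=.
  rewrite -[X in _ --> X]oppr0 -(mulr0 a^-1); apply: cvgN; apply: cvgMr.
  have := @exprn_expRN_cvg0 a 0 a0.
  by rewrite (_ : (fun x => x ^+ 0 * expR (- a * x)) = (fun x => expR (- a * x)))//;
    apply/funext => x; rewrite expr0 mul1r.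
rewrite -[X in _ --> X](mulr0 a^-1); apply: cvgMr.
rewrite -(subr0 (0:R)) -{1}(mulr0 k.+1%:R); apply: cvgB; first exact: cvgMr.
exact: exprn_expRN_cvg0.
Qed.

Lemma gamma_primitive0 (a : R) k : 0 < a ->
  gamma_primitive a k 0 = - (k`!%:R / a ^+ k.+1).
Proof.
move=> a0; elim: k => [|k IH] /=.
  by rewrite mulr0 expR0 mulr1 fact0 expr1 mul1r.
rewrite IH expr0n mul0r subr0 factS natrM [a ^+ k.+2]exprS.
by field; rewrite ?expf_neq0 ?gt_eqF.
Qed.

Lemma gamma_integral (a : R) k : 0 < a ->
  (\int[lebesgueR]_(x in `[0%R, +oo[) (x ^+ k * expR (- a * x))%:E =
   (k`!%:R / a ^+ k.+1)%:E)%E.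
Proof.
move=> a0.
have cf : continuous (fun x : R => x ^+ k * expR (- a * x)).
  move=> x; apply: cvgM; first exact: exprn_continuous.
  apply: continuous_comp; last exact: continuous_expR.
  by apply: cvgM => //; exact: cvg_cst.
have f0 (x : R) : 0 <= x -> 0 <= x ^+ k * expR (- a * x).
  by move=> x0; rewrite mulr_ge0 ?expR_ge0 ?exprn_ge0.
rewrite integral_lebesgueR//; last 2 first.
- by apply/measurable_EFinP/measurable_funTS; exact: continuous_measurable_fun.
- by move=> x /=; rewrite in_itv/= andbT lee_fin => /f0.
rewrite (@ge0_continuous_FTC2y _ _ (gamma_primitive a k) _ 0)//.
- by rewrite gamma_primitive0// EFinN oppeK add0e.
- exact: continuous_subspaceT.
- exact: gamma_primitive_cvg0.
- by move=> x x0; have := is_derive_gamma_primitive x k a0; case.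
- apply: cvg_at_right_filter; apply: differentiable_continuous.
  by apply/derivable1_diffP; have := is_derive_gamma_primitive 0 k a0; case.
- by move=> x x0; rewrite derive1E; have := is_derive_gamma_primitive x k a0; case.
Qed.

(** Used from right to left in [region_decay], to turn an exponential of a maximum into an integral
    of indicators. *)
Lemma exp_tail_integral (u : R) : 0 <= u ->
  (\int[lebesgueR]_(x in `[u, +oo[) (expR (- x))%:E = (expR (- u))%:E)%E.
Proof.
move=> u0.
have cf : continuous (fun x : R => expR (- x)).
  move=> x; apply: continuous_comp; last exact: continuous_expR.
  by apply: cvgN; exact: cvg_id.
have dF (x : R) : is_derive x 1 (fun x => - expR (- x)) (expR (- x)).
  by apply: is_derive_eq; rewrite /GRing.scale/=; ring.
have mf : measurable_fun `[u, +oo[ (fun x : R => (expR (- x))%:E).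
  by apply/measurable_EFinP/measurable_funTS; exact: continuous_measurable_fun.
rewrite (integral_lebesgueR _ mf)//.
rewrite (@ge0_continuous_FTC2y _ _ (fun x => - expR (- x)) _ 0)//.
- by rewrite EFinN oppeK add0e.
- exact: continuous_subspaceT.
- by rewrite -oppr0; apply: cvgN; exact: cvgr_expR.
- by apply: cvg_at_right_filter; apply: cvgN; exact: cf.
- by move=> x x0; rewrite derive1E; case: (dF x).
Qed.

Lemma root_exists (d : nat) (v : R) : (0 < d)%N -> 0 <= v ->
  exists2 r : R, 0 <= r & r ^+ d = v.
Proof.
move=> d0 v0; exists (v `^ d%:R^-1); first exact: powR_ge0.
by rewrite -powR_mulrn ?powR_ge0// -powRrM mulVf ?powRr1// pnatr_eq0 -lt0n.
Qed.

End gamma_integral.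

Section polar.
Context (R : realType) (d : nat) (d_gt0 : (0 < d)%N).
Local Notation vec := (d.-tuple R).
Local Notation leb := (@lebesgue_tuple R d).
Local Notation kappa := (ball_volume R d).
Local Open Scope ereal_scope.

(** The volume of the ball through [y]. In this coordinate Lebesgue measure on R^d becomes Lebesgue
    measure on the half-line, with no Jacobian left. *)
Definition radial (y : vec) : R := (kappa * euclidean_dist origin y ^+ d)%R.

Lemma measurable_radial : measurable_fun setT radial.
Proof.
by apply: measurable_funM => //; apply: measurable_funX; apply: measurable_dist.
Qed.

Lemma radial_ge0 y : (0 <= radial y)%R.
Proof. by rewrite mulr_ge0 ?exprn_ge0 ?dist_ge0 ?(ltW (ball_volume_gt0 _ d_gt0)). Qed.

Lemma leb_radial_lt (s : R) : (0 <= s)%R -> leb [set y | (radial y < s)%R] = s%:E.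
Proof.
move=> s0; have k0 := @ball_volume_gt0 R d d_gt0.
have [r r0 rE] : exists2 r : R, (0 <= r)%R & (r ^+ d = s / kappa)%R.
  by apply: root_exists => //; rewrite divr_ge0 ?(ltW k0).
rewrite (_ : mkset _ = eball origin r).
  by rewrite leb_ball// rE mulrCA mulfV ?mulr1// gt_eqF.
apply/seteqP; split => y; rewrite /eball/= /radial mulrC -ltr_pdivlMr// -rE.
  by rewrite ltr_pXn2r ?nnegrE ?dist_ge0.
by rewrite ltr_pXn2r ?nnegrE ?dist_ge0.
Qed.

Lemma integral_radial (g : R -> \bar R) : measurable_fun setT g ->
  (forall s, 0 <= g s) ->
  \int[leb]_y g (radial y) = \int[lebesgueR]_(s in `[0%R, +oo[) g s.
Proof.
move=> mg g0; have mr := measurable_radial.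
have m0 : measurable (`[0%R, +oo[%classic : set R) by [].
transitivity (\int[pushforward leb radial]_(s in `[0%R, +oo[) g s).
  rewrite ge0_integral_pushforward//; last exact: measurable_funTS.
  rewrite (_ : _ @^-1` _ = setT)//; apply/seteqP; split => // y _ /=.
  by rewrite in_itv/= andbT radial_ge0.
apply: eq_measure_integral => A mA AD.
rewrite -[in RHS](setIidl AD) -[RHS]/(mrestr (@lebesgueR R) m0 A).
have covG : \bigcup_k `]-oo, (k%:R : R)[%classic = setT :> set R.
  rewrite -subTset => x _; exists (Num.bound `|x|) => //=; rewrite in_itv/=.
  by apply: le_lt_trans (ler_norm _) _; exact: archi_boundP.
have key (s : R) : pushforward leb radial `]-oo, s[%classic =
    mrestr (@lebesgueR R) m0 `]-oo, s[%classic.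
  rewrite /pushforward /mrestr.
  have [s0|s0] := leP 0%R s.
    transitivity (s%:E); first by rewrite -[RHS]leb_radial_lt//; congr (leb _); apply/seteqP;
      split => y /=; rewrite in_itv.
    rewrite (_ : _ `&` _ = `[0%R, s[%classic).
      rewrite /lebesgueR lebesgue_measure_itv/= lte_fin.
      case: ifPn => [_|]; first by rewrite oppr0 adde0.
      by rewrite -leNgt => s0'; congr EFin; apply/eqP; rewrite eq_le s0 s0'.
    apply/seteqP; split => x /=; rewrite !in_itv/= ?andbT; first by move=> [-> ->].
    by move=> /andP[-> ->].
  rewrite (_ : _ @^-1` _ = set0); last first.
    apply/seteqP; split => // y /=; rewrite in_itv/= => H.
    by have := lt_trans H s0; rewrite ltNge radial_ge0.
  rewrite (_ : _ `&` _ = set0) ?measure0//.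
  apply/seteqP; split => // y /= []; rewrite !in_itv/= andbT => H1 H2.
  by have := lt_trans H1 s0; rewrite ltNge H2.
apply: (measure_unique (@RGenInftyO.G R) (fun k => `]-oo, (k%:R : R)[%classic)) => //.
- exact: RGenInftyO.measurableE.
- move=> _ _ [x ->] [y ->]; exists (Num.min x y).
  apply/seteqP; split => z /=; rewrite !in_itv/= lt_min; first by move=> [-> ->].
  by move=> /andP[-> ->].
- by move=> k; exists k%:R.
- by move=> _ [x ->]; exact: key.
- move=> k; change (leb (radial @^-1` `]-oo, (k%:R : R)[%classic) < +oo).
  rewrite (_ : radial @^-1` _ = [set y | (radial y < k%:R)%R]); last first.
    by apply/seteqP; split => y /=; rewrite in_itv.
  by rewrite leb_radial_lt// ltry.
Qed.

End polar.

(** * Polar coordinates for tuples of points *)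

Section polar_power.
Context (R : realType) (d : nat) (d_gt0 : (0 < d)%N).
Local Notation vec := (d.-tuple R).
Local Notation leb := (@lebesgue_tuple R d).
Local Notation kappa := (ball_volume R d).
Local Notation norm := (euclidean_dist origin).
Local Open Scope ereal_scope.

(** The part of [similarity] that does not mention a direction; homogeneity of [V] in [polar] is
    required for these maps. *)
Definition is_similarity (r : R) (S : vec -> vec) : Prop :=
  [/\ measurable_fun setT S, S origin = origin,
    (forall a b, euclidean_dist (S a) (S b) = r * euclidean_dist a b)%R &
    forall f : vec -> \bar R, measurable_fun setT f -> (forall x, 0 <= f x) ->
      \int[leb]_x f x = (r ^+ d)%:E * \int[leb]_x f (S x)].

Definition dominates k (p : k.+1.-tuple vec) : bool :=
  [forall i : 'I_k, norm (tnth p (lift ord0 i)) < norm (thead p)]%R.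

Definition in_unit_balls k (u : k.-tuple vec) : bool :=
  [forall i : 'I_k, norm (tnth u i) < 1]%R.

Lemma measurable_forall dT (T : measurableType dT) (I : finType) (f : I -> T -> bool) :
  (forall i, measurable_fun setT (f i)) ->
  measurable_fun setT (fun t => [forall i, f i t]).
Proof.
move=> mf; apply: (measurable_fun_bool true); rewrite setTI.
rewrite (_ : _ @^-1` _ = \bigcap_(i in [set: I]) (f i @^-1` [set true])).
  by apply: fin_bigcap_measurable => // i _; rewrite -[X in measurable X]setTI; exact: mf.
apply/seteqP; split => t /=; first by move/forallP => H i _; exact: H.
by move=> H; apply/forallP => i; exact: H.
Qed.

Lemma measurable_natr_bool dT (T : measurableType dT) (b : T -> bool) :
  measurable_fun setT b -> measurable_fun setT (fun t => (b t)%:R : R).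
Proof.
move=> mb; rewrite (_ : (fun t => _) = \1_(b @^-1` [set true])).
  by apply: measurable_indic; rewrite -[X in measurable X]setTI; exact: mb.
by apply/funext => t; rewrite indicE; congr (nat_of_bool _)%:R; apply/idP/idP; rewrite inE.
Qed.

Lemma measurable_dominates k : measurable_fun setT (@dominates k).
Proof.
apply: measurable_forall => i; apply: measurable_fun_ltr.
  by apply: measurable_dist => //; exact: measurable_tnth.
by apply: measurable_dist => //; exact: measurable_tnth.
Qed.

Lemma measurable_in_unit_balls k : measurable_fun setT (@in_unit_balls k).
Proof.
apply: measurable_forall => i; apply: measurable_fun_ltr => //.
by apply: measurable_dist => //; exact: measurable_tnth.
Qed.

Lemma integral_power_similarity r S n (F : n.-tuple vec -> \bar R) :
  is_similarity r S -> (0 <= r)%R -> measurable_fun setT F -> (forall t, 0 <= F t) ->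
  \int[power_measure leb n]_t F t =
  ((r ^+ d) ^+ n)%:E * \int[power_measure leb n]_t F (tuple_map (fun=> S) t).
Proof.
move=> [mS _ _ SE] r0 mF F0.
by apply: integral_power_image => //; exact: exprn_ge0.
Qed.

(** For a fixed head [y], substitute in the other points a similarity taking [e1] to [y]: the
    domination becomes membership of unit balls and [V] picks up the factor [norm y ^+ d], that is
    [radial y / kappa]. Only the radial coordinate is left of [y], and its integral is a gamma
    integral of order [k], one power from each substituted point. *)
Lemma polar k (V : k.+1.-tuple vec -> R) (c : R) : (0 < k)%N -> (0 < c)%R ->
  measurable_fun setT V ->
  (forall r S p, (0 < r)%R -> is_similarity r S ->
     V (tuple_map (fun=> S) p) = r ^+ d * V p)%R ->
  (forall u, 0 < V (cons_tuple e1 u))%R ->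
  \int[power_measure leb k.+1]_p ((dominates p)%:R * expR (- (c * V p)))%:E =
  (k`!%:R * kappa / c ^+ k.+1)%:E *
  \int[power_measure leb k]_u
    ((in_unit_balls u)%:R / V (cons_tuple e1 u) ^+ k.+1)%:E.
Proof.
move=> k0 c0 mV VS Vpos; have kp := @ball_volume_gt0 R d d_gt0.
have mVe : measurable_fun setT (fun u => V (cons_tuple e1 u)).
  by apply: measurableT_comp => //; exact: measurable_fun_consl.
have mF : measurable_fun setT (fun p : k.+1.-tuple vec =>
    ((dominates p)%:R * expR (- (c * V p)))%:E).
  apply/measurable_EFinP; apply: measurable_funM.
    by apply: measurable_natr_bool; exact: measurable_dominates.
  by apply: measurableT_comp => //; apply: measurable_funN; apply: measurable_funM.
rewrite integral_powerS//.
pose H (t : R) (u : k.-tuple vec) : R :=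
  (t ^+ k * expR (- (c * V (cons_tuple e1 u) / kappa) * t))%R.
pose G (t : R) (u : k.-tuple vec) : R := ((in_unit_balls u)%:R / kappa ^+ k * H t u)%R.
have mH : measurable_fun setT (fun tu => H tu.1 tu.2).
  apply: measurable_funM; first exact: measurable_funX.
  apply: measurableT_comp => //; apply: measurable_funM => //.
  apply: measurable_funN; apply: measurable_funM => //; apply: measurable_funM => //.
  exact: (measurableT_comp mVe).
have mG : measurable_fun setT (fun tu => G tu.1 tu.2).
  apply: measurable_funM => //; apply: measurable_funM => //.
  apply: measurable_natr_bool; apply: (measurableT_comp (@measurable_in_unit_balls k)) => //.
have G0 t u : (0 <= t)%R -> (0 <= G t u)%R.
  move=> t0; rewrite !mulr_ge0 ?invr_ge0 ?exprn_ge0 ?expR_ge0 ?(ltW kp)//.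
(* The absolute value makes the integrand nonnegative on the whole line, as Tonelli and
   [integral_radial] require; radii are nonnegative anyway. *)
pose Phi (t : R) : \bar R := \int[power_measure leb k]_u (G `|t| u)%:E.
have mPhi : measurable_fun setT Phi.
  apply: (measurable_fun_fubini_tonelli_F (fun tu : R * _ => (G `|tu.1| tu.2)%:E)).
    apply/measurable_EFinP; apply: (measurableT_comp mG (g :=
      fun tu : R * k.-tuple vec => (`|tu.1|%R, tu.2))).
    by apply: measurable_fun_pair => //; apply: measurableT_comp.
  by move=> z; rewrite lee_fin G0.
transitivity (\int[leb]_y Phi (radial y)).
  apply: eq_integral => y _.
  (* At the origin there is no similarity, but both sides vanish since [0 < k]: no norm is below 0,
     and the factor [t ^+ k] is 0. *)
  have [y0|] := ltP 0%R (norm y); last first.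
    move=> y0; have ny0 : norm y = 0%R by apply/eqP; rewrite eq_le y0 dist_ge0.
    rewrite /Phi !integral0_eq//.
      move=> u _; rewrite /radial ny0 expr0n gtn_eqF// mulr0 normr0.
      by rewrite /G /H expr0n gtn_eqF// mul0r mulr0.
    move=> u _; rewrite (_ : dominates _ = false) ?mul0r//.
    apply/negbTE/forallP => /(_ (Ordinal k0)); rewrite theadE ny0 ltNge.
    by rewrite dist_ge0.
  have [S [mS Se1 So SD SI]] := similarity d_gt0 y0.
  have simS : is_similarity (norm y) S by split.
  rewrite (integral_power_similarity simS); [|exact: ltW| |]; last 2 first.
  - apply: (measurableT_comp mF (g := fun t : k.-tuple vec => cons_tuple y t)).
    exact: measurable_fun_consl.
  - by move=> u; rewrite lee_fin mulr_ge0 ?expR_ge0.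
  rewrite /Phi -ge0_integralZl; [|exact: measurableT| | |]; last 3 first.
  - apply: (measurableT_comp mF (g := fun u => cons_tuple y (tuple_map (fun=> S) u))).
    apply: measurable_cons => //; exact: measurable_tuple_map.
  - by move=> u _; rewrite lee_fin mulr_ge0 ?expR_ge0.
  - by rewrite lee_fin !exprn_ge0 ?dist_ge0.
  apply: eq_integral => u _; rewrite -EFinM; congr EFin.
  have -> : cons_tuple y (tuple_map (fun=> S) u) = tuple_map (fun=> S) (cons_tuple e1 u).
    by rewrite tuple_map_cons Se1.
  rewrite (VS _ _ _ y0 simS) ger0_norm; last exact: radial_ge0.
  have -> : dominates (tuple_map (fun=> S) (cons_tuple e1 u)) = in_unit_balls u.
    apply: eq_forallb => i; rewrite tuple_map_cons theadE tnthS tnth_mktuple Se1.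
    by rewrite -{1}So SD gtr_pMr.
  rewrite /G /H /radial exprMn.
  have -> : (- (c * V (cons_tuple e1 u) / kappa) * (kappa * norm y ^+ d) =
             - (c * (norm y ^+ d * V (cons_tuple e1 u))))%R by field; rewrite gt_eqF.
  by field; rewrite expf_neq0// gt_eqF.
rewrite integral_radial//; last by move=> s; apply: integral_ge0 => u _; rewrite lee_fin G0.
pose D := `[0%R, +oo[%classic : set R.
rewrite -integral_indicM//.
transitivity (\int[lebesgueR]_t \int[power_measure leb k]_u ((\1_D t * G t u)%:E)).
  apply: eq_integral => t _; rewrite indicE; have [|] := boolP (t \in D).
    rewrite inE /D/= in_itv/= andbT => t0; rewrite mul1e /Phi ger0_norm//.
    by apply: eq_integral => u _; rewrite mul1r.
  by move=> _; rewrite mul0e integral0_eq// => u _; rewrite mul0r.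
rewrite (fubini_tonelli (fun tu : R * _ => (\1_D tu.1 * G tu.1 tu.2)%:E)); [rewrite /=| |];
  last 2 first.
- apply/measurable_EFinP; apply: measurable_funM => //.
  have mD : measurable_fun setT (\1_D : R -> R) by apply: measurable_indic; exact: measurable_itv.
  exact: (measurableT_comp mD).
- move=> [t u]/=; rewrite lee_fin indicE; have [|_] := boolP (t \in D); last by rewrite mul0r.
  by rewrite inE /D/= in_itv/= andbT => t0; rewrite mul1r G0.
rewrite -ge0_integralZl; [|exact: measurableT| | |]; last 3 first.
- apply/measurable_EFinP; apply: measurable_funM.
    by apply: measurable_natr_bool; exact: measurable_in_unit_balls.
  (* The inverse of a positive function is written as an exponential to make its measurability
     visible. *)
  rewrite (_ : (fun u => _) = (fun u => expR (- ln (V (cons_tuple e1 u) ^+ k.+1)))%R).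
    apply: measurableT_comp => //; apply: measurable_funN.
    by apply: (measurableT_comp (@measurable_ln R)); exact: measurable_funX.
  by apply/funext => u; rewrite -lnV ?posrE ?exprn_gt0// lnK// posrE invr_gt0 exprn_gt0.
- by move=> u _; rewrite lee_fin divr_ge0 ?exprn_ge0 ?(ltW (Vpos u)).
- by rewrite lee_fin divr_ge0 ?mulr_ge0 ?exprn_ge0 ?(ltW kp) ?(ltW c0).
apply: eq_integral => u _.
have a0 : (0 < c * V (cons_tuple e1 u) / kappa)%R by rewrite divr_gt0 ?mulr_gt0.
transitivity (((in_unit_balls u)%:R / kappa ^+ k)%:E * \int[lebesgueR]_(t in D) (H t u)%:E).
  rewrite -ge0_integralZl; [|exact: measurable_itv| | |]; last 3 first.
  - apply/measurable_EFinP; apply: measurable_funTS.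
    by apply: (measurableT_comp mH (g := fun t => (t, u))).
  - move=> t; rewrite /D/= in_itv/= andbT => t0.
    by rewrite lee_fin mulr_ge0 ?exprn_ge0 ?expR_ge0.
  - by rewrite lee_fin divr_ge0 ?exprn_ge0 ?(ltW kp).
  by rewrite -integral_indicM; [apply: eq_integral => t _; rewrite -!EFinM; congr EFin;
    rewrite /G; ring|exact: measurable_itv].
rewrite gamma_integral// -!EFinM; congr EFin.
have Vu := Vpos u.
rewrite !exprMn exprVn.
have ck : (c ^+ k.+1 != 0)%R by rewrite expf_neq0 ?gt_eqF.
have vk : (V (cons_tuple e1 u) ^+ k.+1 != 0)%R by rewrite expf_neq0 ?gt_eqF.
have kk : (kappa ^+ k != 0)%R by rewrite expf_neq0 ?gt_eqF.
have kk' : (kappa != 0)%R by rewrite gt_eqF.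
rewrite [(kappa ^+ k.+1)%R]exprS.
move: (c ^+ k.+1)%R ck (V _ ^+ k.+1)%R vk (kappa ^+ k)%R kk => x x0 y y0 z z0.
by field; apply/and4P; split.
Qed.

End polar_power.

(** * The moment method on the half-line *)

Section exponential_taylor.
Context (R : realType).
Implicit Type u : R.

(** The Taylor remainder of exp (- u) at order [k], with its alternating sign removed. *)
Fixpoint exp_rest (k : nat) (u : R) : R :=
  if k is j.+1 then u ^+ j / j`!%:R - exp_rest j u else expR (- u).

Lemma exp_restE k u : expR (- u) =
  \sum_(j < k) (-1) ^+ j * (u ^+ j / j`!%:R) + (-1) ^+ k * exp_rest k u.
Proof.
elim: k => [|k IH]; first by rewrite big_ord0 expr0 mul1r add0r.
by rewrite big_ord_recr/= IH exprS; ring.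
Qed.

Lemma is_derive_exp_rest k (u : R) : is_derive u 1 (exp_rest k.+1) (exp_rest k u).
Proof.
elim: k => [|k IH].
  rewrite (_ : exp_rest 1 = (fun v => 1 - expR (- v))); last first.
    by apply/funext => v /=; rewrite expr0 fact0 divr1.
  by apply: is_derive_eq; rewrite /GRing.scale/=; ring.
have D2 : is_derive u 1 (fun v : R => v ^+ k.+1) (k.+1%:R * u ^+ k).
  rewrite (_ : (fun v : R => v ^+ k.+1) = (id : R -> R) ^+ k.+1); last first.
    by apply/funext => v; rewrite exprfctE.
  by apply: (is_derive_eq (is_deriveX k.+1 (is_derive_id u 1))); rewrite /GRing.scale/= mulr1.
have D3 := is_deriveB (is_deriveZ (k.+1`!%:R)^-1 D2) IH.
rewrite (_ : exp_rest k.+2 = (k.+1`!%:R)^-1 \*: (fun v : R => v ^+ k.+1) - exp_rest k.+1);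
  last first.
  by apply/funext => v; rewrite /= [v ^+ k.+1 / _]mulrC.
apply: (is_derive_eq D3) => /=; congr (_ - _).
rewrite /GRing.scale/= factS natrM; field.
by rewrite pnatr_eq0 -lt0n fact_gt0 /=; have : (0 : R) <= k%:R by []; lra.
Qed.

Lemma exp_rest0 k : 0 <= exp_rest k 0.
Proof.
have : exp_rest k 0 = (k == 0%N)%:R.
  elim: k => [|k IH] /=; first by rewrite oppr0 expR0.
  by rewrite IH expr0n; case: k {IH} => [|k]/=; rewrite ?fact0 ?divr1 ?subrr// mul0r subr0.
by move=> ->.
Qed.

(** Each remainder is the derivative of the next and is nonnegative at 0, so nonnegativity climbs by
    monotonicity. *)
Lemma exp_rest_ge0 k u : 0 <= u -> 0 <= exp_rest k u.
Proof.
elim: k u => [|k IH] u u0; first exact: expR_ge0.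
have D v := is_derive_exp_rest k v.
apply: le_trans (exp_rest0 k.+1) _.
apply: (@ger0_derive1_ndecry _ (exp_rest k.+1) 0) => //.
- by move=> v; rewrite in_itv/= andbT => /ltW v0; rewrite derive1E (_ : 'D_1 _ v = exp_rest k v)
  ?IH//; case: (D v).
- apply: continuous_subspaceT => v; apply: differentiable_continuous.
  by apply/derivable1_diffP; case: (D v).
Qed.

Lemma exp_rest_le k u : 0 <= u -> exp_rest k u <= u ^+ k / k`!%:R.
Proof. by move=> /(exp_rest_ge0 k.+1) /=; rewrite subr_ge0. Qed.

Lemma exp_taylor k u : 0 <= u ->
  `|expR (- u) - \sum_(j < k) (-1) ^+ j * (u ^+ j / j`!%:R)| <= u ^+ k / k`!%:R.
Proof.
move=> u0; rewrite (exp_restE k) addrC addKr normrM normrX normrN1 expr1n mul1r.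
by rewrite ger0_norm ?exp_rest_ge0// exp_rest_le.
Qed.

End exponential_taylor.

(** * Bernstein polynomials *)

Section bernstein.
Context (R : realType).

Definition bernstein_weight (n i : nat) (x : R) : R := x ^+ i * (1 - x) ^+ (n - i) * 'C(n, i)%:R.

Lemma bernstein_weight_ge0 n i x : 0 <= x <= 1 -> 0 <= bernstein_weight n i x.
Proof.
move=> /andP[x0 x1]; apply: mulr_ge0 => //; apply: mulr_ge0; rewrite exprn_ge0//.
by rewrite subr_ge0.
Qed.

Lemma bernstein_sum n x : \sum_(i < n.+1) bernstein_weight n i x = 1.
Proof.
transitivity (((1 - x) + x) ^+ n); last by rewrite subrK expr1n.
by rewrite exprDn; apply: eq_bigr => i _; rewrite /bernstein_weight mulr_natr [x ^+ i * _]mulrC.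
Qed.

(** This and the next lemma are factorial moments of the binomial law, each reduced to the one
    before by i C(n, i) = n C(n-1, i-1). *)
Lemma bernstein_first n x :
  \sum_(i < n.+1) i%:R * bernstein_weight n i x = n%:R * x.
Proof.
case: n => [|n]; first by rewrite big_ord1 !mul0r.
rewrite big_ord_recl mul0r add0r.
transitivity (n.+1%:R * x * \sum_(i < n.+1) bernstein_weight n i x); last first.
  by rewrite bernstein_sum mulr1.
rewrite mulr_sumr.
apply: eq_bigr => i _; rewrite /bernstein_weight lift0 subSS exprS.
have := congr1 (fun z : nat => z%:R : R) (mul_bin_diag n.+1 i); rewrite /= !natrM => H.
transitivity (x * x ^+ i * (1 - x) ^+ (n - i) * (i.+1%:R * 'C(n.+1, i.+1)%:R)); first by ring.
by rewrite -H; ring.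
Qed.

Lemma bernstein_second n x :
  \sum_(i < n.+1) i%:R * (i%:R - 1) * bernstein_weight n i x =
  n%:R * (n%:R - 1) * x ^+ 2.
Proof.
case: n => [|n]; first by rewrite big_ord1 !mul0r.
rewrite big_ord_recl !mul0r add0r.
transitivity (n.+1%:R * x * \sum_(i < n.+1) i%:R * bernstein_weight n i x); last first.
  by rewrite bernstein_first -natr1; ring.
rewrite mulr_sumr.
apply: eq_bigr => i _; rewrite /bernstein_weight lift0 subSS exprS.
have := congr1 (fun z : nat => z%:R : R) (mul_bin_diag n.+1 i); rewrite /= !natrM => H.
transitivity ((i.+1%:R - 1) * (x * x ^+ i * (1 - x) ^+ (n - i)) * (i.+1%:R * 'C(n.+1,
  i.+1)%:R)); first by ring.
by rewrite -H -[i.+1%:R]natr1; ring.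
Qed.

Lemma bernstein_variance n x : (0 < n)%N ->
  \sum_(i < n.+1) (x - i%:R / n%:R) ^+ 2 * bernstein_weight n i x =
  x * (1 - x) / n%:R.
Proof.
move=> n0; have nn : n%:R != 0 :> R by rewrite pnatr_eq0 -lt0n.
transitivity (x ^+ 2 * (\sum_(i < n.+1) bernstein_weight n i x)
  - 2 * x / n%:R * (\sum_(i < n.+1) i%:R * bernstein_weight n i x)
  + n%:R ^- 2 * (\sum_(i < n.+1) i%:R * (i%:R - 1) * bernstein_weight n i x
     + \sum_(i < n.+1) i%:R * bernstein_weight n i x)).
  rewrite -big_split/= !mulr_sumr -sumrB -big_split/=; apply: eq_bigr => i _.
  by field.
by rewrite bernstein_sum bernstein_first bernstein_second; field.
Qed.

(* [|x - i/n| <= e + (x - i/n)^2 / e], and the variance is at most [1 / (4n)]. *)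
Lemma bernstein_lipschitz (g : R -> R) (K e : R) n x : (0 < n)%N -> 0 < e -> 0 <= K ->
  0 <= x <= 1 -> (forall i : 'I_n.+1, `|g x - g (i%:R / n%:R)| <= K * `|x - i%:R / n%:R|) ->
  `|g x - \sum_(i < n.+1) g (i%:R / n%:R) * bernstein_weight n i x| <=
  K * (e + e^-1 / n%:R).
Proof.
move=> n0 e0 K0 x01 gK; have n0' : (0 < n%:R :> R) by rewrite ltr0n.
have w0 i := bernstein_weight_ge0 n i x01.
have {1}-> : g x = \sum_(i < n.+1) g x * bernstein_weight n i x.
  by rewrite -mulr_sumr bernstein_sum mulr1.
rewrite -sumrB.
apply: (le_trans (ler_norm_sum _ _ _)).
apply: (@le_trans _ _ (\sum_(i < n.+1) K * (e * bernstein_weight n i x +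
    e^-1 * ((x - i%:R / n%:R) ^+ 2 * bernstein_weight n i x)))).
  apply: ler_sum => i _; rewrite -mulrBl normrM (ger0_norm (w0 i)).
  rewrite [leRHS](_ : _ = K * (e + e^-1 * (x - i%:R / n%:R) ^+ 2) * bernstein_weight n i x);
    last by ring.
  apply: ler_wpM2r => //; apply: (le_trans (gK i)); apply: ler_wpM2l => //.
  rewrite -(real_normK (num_real (x - _))); move: (`|_|) (normr_ge0 (x - i%:R / n%:R)) => z z0.
  have [ze|ez] := leP z e.
    by apply: (le_trans ze); rewrite lerDl mulr_ge0 ?invr_ge0 ?sqr_ge0 ?(ltW e0).
  apply: (@le_trans _ _ (e^-1 * z ^+ 2)); last by rewrite lerDr ltW.
  by rewrite ler_pdivlMl// expr2 ler_wpM2r// ltW.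
rewrite -mulr_sumr big_split/= -!mulr_sumr bernstein_sum bernstein_variance// mulr1.
apply: ler_wpM2l => //; rewrite lerD2l; apply: ler_wpM2l; first by rewrite invr_ge0 ltW.
rewrite ler_pdivrMr// mulVf ?gt_eqF//; nra.
Qed.

End bernstein.

(** * Means of laws on the half-line *)

Section half_line_mean.
Context (R : realType).
Implicit Types (P : probability R R) (g : R -> R).

Definition half_line : set R := `[0%R, +oo[%classic.

Lemma measurable_half_line : measurable half_line. Proof. exact: measurable_itv. Qed.

Lemma half_lineP y : half_line y <-> 0 <= y.
Proof. by rewrite /half_line/= in_itv/= andbT. Qed.

(** The restriction of the domain lets integrands be compared for [0 <= y] only, although the laws
    live on the whole line. *)
Definition mean P g : R := \int[P]_(y in half_line) g y.

Definition int P g := P.-integrable half_line (EFin \o g).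

Definition all_moments P : Prop :=
  P half_line = 1%E /\ forall k, int P (fun y => y ^+ k).

Lemma int_le_pow P g k (C : R) : all_moments P -> measurable_fun setT g ->
  (forall y, 0 <= y -> `|g y| <= C * y ^+ k) -> int P g.
Proof.
move=> [_ Pk] mg gC; apply: (@le_integrable _ _ _ _ _ measurable_half_line _ (fun y =>
  (C * y ^+ k)%:E)).
- by apply/measurable_EFinP; exact: measurable_funTS.
- move=> y /half_lineP y0; rewrite !abse_EFin lee_fin.
  by apply: (le_trans (gC y y0)); exact: ler_norm.
- rewrite (_ : (fun y => _) = (fun y => C%:E * (y ^+ k)%:E)%E); last exact/funext.
  by apply: integrableZl; [exact: measurable_half_line|exact: Pk].
Qed.

Lemma int_bounded P g (C : R) : measurable_fun setT g ->
  (forall y, 0 <= y -> `|g y| <= C) -> int P g.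
Proof.
move=> mg gC; apply: (@le_integrable _ _ _ _ _ measurable_half_line _ (EFin \o cst C)).
- by apply/measurable_EFinP; exact: measurable_funTS.
- move=> y /half_lineP y0; rewrite !abse_EFin lee_fin.
  by apply: (le_trans (gC y y0)); exact: ler_norm.
- by apply: finite_measure_integrable_cst; exact: measurable_half_line.
Qed.

Lemma intZ P g (c : R) : int P g -> int P (fun y => c * g y).
Proof.
move=> ig; rewrite /int (_ : _ \o _ = (fun y => c%:E * (g y)%:E)%E); last exact/funext.
by apply: integrableZl => //; exact: measurable_half_line.
Qed.

Lemma intD P g h : int P g -> int P h -> int P (fun y => g y + h y).
Proof.
move=> ig ih; rewrite /int (_ : _ \o _ = (EFin \o g) \+ (EFin \o h))%E; last exact/funext.
by apply: integrableD => //; exact: measurable_half_line.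
Qed.

Lemma intB P g h : int P g -> int P h -> int P (fun y => g y - h y).
Proof.
move=> ig ih; rewrite /int (_ : _ \o _ = (EFin \o g) \- (EFin \o h))%E; last exact/funext.
by apply: integrableB => //; exact: measurable_half_line.
Qed.

Lemma int0 P : int P (fun=> 0).
Proof. exact: integrable0. Qed.

Lemma int_sum P n (g : nat -> R -> R) : (forall i, int P (g i)) ->
  int P (fun y => \sum_(i < n) g i y).
Proof.
move=> ig; elim: n => [|n IH].
  by rewrite (_ : (fun y => _) = (fun=> 0)); [exact: int0|apply/funext => y; rewrite big_ord0].
rewrite (_ : (fun y => _) = (fun y => \sum_(i < n) g i y + g n y)); first exact: intD.
by apply/funext => y; rewrite big_ord_recr.
Qed.

Lemma meanZ P g (c : R) : int P g -> mean P (fun y => c * g y) = c * mean P g.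
Proof. by move=> ig; apply: RintegralZl => //; exact: measurable_half_line. Qed.

Lemma meanD P g h : int P g -> int P h ->
  mean P (fun y => g y + h y) = mean P g + mean P h.
Proof. by move=> ig ih; apply: RintegralD => //; exact: measurable_half_line. Qed.

Lemma meanB P g h : int P g -> int P h ->
  mean P (fun y => g y - h y) = mean P g - mean P h.
Proof. by move=> ig ih; apply: RintegralB => //; exact: measurable_half_line. Qed.

Lemma eq_mean P g h : (forall y, 0 <= y -> g y = h y) -> mean P g = mean P h.
Proof. by move=> gh; apply: eq_Rintegral => y /set_mem/half_lineP; exact: gh. Qed.

Lemma le_mean P g h : int P g -> int P h ->
  (forall y, 0 <= y -> g y <= h y) -> mean P g <= mean P h.
Proof.
move=> ig ih gh; apply: le_Rintegral => //; first exact: measurable_half_line.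
by move=> y /half_lineP; exact: gh.
Qed.

Lemma mean_cst P (c : R) : P half_line = 1%E -> mean P (fun=> c) = c.
Proof.
move=> P1; rewrite /mean Rintegral_cst; last exact: measurable_half_line.
by transitivity (c * fine 1%E); [congr (c * fine _); exact: P1|exact: mulr1].
Qed.

Lemma mean0 P : mean P (fun=> 0) = 0.
Proof. by rewrite /mean /Rintegral integral0_eq. Qed.

Lemma mean_sum P n (g : nat -> R -> R) : (forall i, int P (g i)) ->
  mean P (fun y => \sum_(i < n) g i y) = \sum_(i < n) mean P (g i).
Proof.
move=> ig; elim: n => [|n IH].
  rewrite big_ord0 (@eq_mean _ _ (fun=> 0)); last by move=> y _; rewrite big_ord0.
  exact: mean0.
rewrite big_ord_recr/= -IH -meanD//; last exact: int_sum.
by apply: eq_mean => y _; rewrite big_ord_recr.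
Qed.

Lemma mean_dist P g h b : int P g -> int P h -> int P b ->
  (forall y, 0 <= y -> `|g y - h y| <= b y) -> `|mean P g - mean P h| <= mean P b.
Proof.
move=> ig ih ib gh; rewrite -meanB// ler_norml; apply/andP; split.
  rewrite -[X in X <= _]mulN1r -meanZ//; apply: le_mean => //; first exact: intZ.
    exact: intB.
  by move=> y y0; rewrite mulN1r; have := gh y y0; rewrite ler_norml => /andP[].
apply: le_mean => //; first exact: intB.
by move=> y y0; have := gh y y0; rewrite ler_norml => /andP[].
Qed.

(** Such a sequence is Cauchy. The approximating sequence may change with [e], and nothing is asked
    of the limits. *)
Lemma cvg_approx (u : R^nat) :
  (forall e : R, 0 < e -> exists2 v : R^nat, cvgn v & \forall n \near \oo, `|u n - v n| <= e) ->
  cvgn u.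
Proof.
move=> H; apply: cauchy_cvg; apply: cauchy_exP => e e0.
have e2 : 0 < e / 2 by rewrite divr_gt0.
have [v cv uv] := H (e / 2) e2.
exists (limn v); rewrite /ball/= /nbhs/=.
near=> n; rewrite /ball/=.
have H1 : `|limn v - v n| < e / 2 by near: n; exact: cvgr_dist_lt.
have H2 : `|u n - v n| <= e / 2 by near: n.
have : `|limn v - u n| <= `|limn v - v n| + `|u n - v n|.
  by rewrite [`|u n - v n|]distrC; exact: ler_distD.
lra.
Unshelve. all: by end_near. Qed.

Lemma is_cvg_sumR n (u : nat -> R^nat) : (forall i, cvgn (u i)) ->
  cvgn (fun k => \sum_(i < n) u i k).
Proof.
move=> cu; elim: n => [|n IH].
  rewrite (_ : (fun k => _) = (fun=> 0)); first exact: is_cvg_cst.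
  by apply/funext => k; rewrite big_ord0.
rewrite (_ : (fun k => _) = (fun k => \sum_(i < n) u i k) + u n); first exact: is_cvgD.
by apply/funext => k; rewrite big_ord_recr.
Qed.

Lemma is_cvgZR (a : R) (u : R^nat) : cvgn u -> cvgn (fun k => a * u k).
Proof. by move=> cu; apply: is_cvgM => //; exact: is_cvg_cst. Qed.

Lemma expRM_pow (h y : R) i : expR (- (h * y)) ^+ i = expR (- (i%:R * h * y)).
Proof. by rewrite -expRM_natl; congr expR; ring. Qed.

End half_line_mean.

(** * From convergent moments to convergent means of ramps *)

Section laplace_convergence.
Context (R : realType) (mu : nat -> probability R R) (m : nat -> R) (rho : R).
Hypothesis amu : forall n, all_moments (mu n).
Hypothesis mom : forall k, mean (mu n) (fun y => y ^+ k) @[n --> \oo] --> m k.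
Hypothesis rho_gt0 : 0 < rho.
Hypothesis m_le : forall k, m k <= k.+1`!%:R * rho ^+ k.+1.

(** Half of the step at which the bounds stop decaying: the moments contribute [rho] and
    [fact_ratio_le] a factor 2 per order, so the remainders below decay like [2 ^- k]. *)
Let h : R := (4 * rho)^-1.

Let h_gt0 : 0 < h. Proof. by rewrite invr_gt0 mulr_gt0. Qed.

Let mexp (s : R) j : measurable_fun setT (fun y : R => y ^+ j * expR (- (s * y))).
Proof.
apply: measurable_funM; first exact: measurable_funX.
by apply: measurableT_comp => //; apply: measurable_funN; exact: measurable_funM.
Qed.

Let iexp n (s : R) j : 0 <= s -> int (mu n) (fun y => y ^+ j * expR (- (s * y))).
Proof.
move=> s0; apply: (@int_le_pow _ _ _ j 1) => // y y0.
rewrite mul1r ger0_norm ?mulr_ge0 ?exprn_ge0 ?expR_ge0//.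
by rewrite ler_piMr ?exprn_ge0// expR_le1 oppr_le0 mulr_ge0.
Qed.

Lemma fact_ratio_le j k : ((j + k)`! <= 2 ^ (j + k) * (j`! * k`!))%N.
Proof.
have H : ('C(j + k, j) <= 2 ^ (j + k))%N.
  rewrite -[2%N]/(1 + 1)%N expnDn (bigD1 (inord j))//=.
  by rewrite inordK ?ltnS ?leq_addr// !exp1n !muln1 leq_addr.
by rewrite -(bin_fact (leq_addr k j)) addKn leq_mul2r H orbT.
Qed.

(** With [h * rho = 1/4] and the factor 2 per order from [fact_ratio_le], the quantity is at most
    [C / 2 ^+ k]. *)
Lemma laplace_remainder j (e : R) : 0 < e ->
  exists k, h ^+ k / k`!%:R * m (j + k)%N < e.
Proof.
move=> e0; pose C : R := (j.+1)`!%:R * rho ^+ j.+1 * 2 ^+ j.+1.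
have C0 : 0 < C by rewrite !mulr_gt0 ?exprn_gt0// ltr0n fact_gt0.
pose k := Num.bound (C / e).
have Ck : C / e < 2 ^+ k by apply: upper_nthrootP.
exists k; apply: (@le_lt_trans _ _ (C / 2 ^+ k)); last first.
  by rewrite ltr_pdivrMr ?exprn_gt0// mulrC -ltr_pdivrMr.
have kf : 0 < k`!%:R :> R by rewrite ltr0n fact_gt0.
apply: (@le_trans _ _ (h ^+ k / k`!%:R * ((j + k).+1`!%:R * rho ^+ (j + k).+1))).
  by apply: ler_wpM2l => //; rewrite divr_ge0 ?exprn_ge0 ?(ltW h_gt0) ?(ltW kf).
have F : (j + k).+1`!%:R <= 2 ^+ (j.+1 + k) * ((j.+1)`!%:R * k`!%:R) :> R.
  by rewrite -!natrX -!natrM ler_nat -addSn fact_ratio_le.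
apply: (@le_trans _ _ (h ^+ k / k`!%:R * (2 ^+ (j.+1 + k) * ((j.+1)`!%:R * k`!%:R)
  * rho ^+ (j + k).+1))).
  apply: ler_wpM2l; first by rewrite divr_ge0 ?exprn_ge0 ?(ltW h_gt0) ?(ltW kf).
  by apply: ler_wpM2r => //; rewrite exprn_ge0 ?(ltW rho_gt0).
rewrite le_eqVlt; apply/orP; left; apply/eqP.
have -> : h ^+ k = (2 ^+ k * 2 ^+ k * rho ^+ k)^-1.
  by rewrite /h exprVn -!exprMn; congr ((_ ^+ _)^-1); ring.
rewrite /C -addSn !exprD; field.
by apply/and3P; split; rewrite ?expf_neq0// gt_eqF.
Qed.

(** Expand exp (- h y) only: since exp (- s y) <= 1, the remainder is a plain moment whatever [s]
    is, so the step does not shrink as [s] grows. All powers [j] are carried along because the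
    expansion at [s] involves derivatives of every order. *)
Lemma laplace_step (s : R) : 0 <= s ->
  (forall j, cvgn (fun n => mean (mu n) (fun y => y ^+ j * expR (- (s * y))))) ->
  forall j, cvgn (fun n => mean (mu n) (fun y => y ^+ j * expR (- ((s + h) * y)))).
Proof.
move=> s0 cs j; apply: cvg_approx => e e0.
have [k ke] := laplace_remainder j e0.
pose c i : R := (-1) ^+ i * (h ^+ i / i`!%:R).
pose v n := \sum_(i < k) c i * mean (mu n) (fun y => y ^+ (j + i) * expR (- (s * y))).
have C0 : 0 <= h ^+ k / k`!%:R by rewrite divr_ge0 ?exprn_ge0 ?(ltW h_gt0).
exists v.
  apply: (is_cvg_sumR (u := fun i n => c i * mean (mu n) (fun y => y ^+ (j + i)
    * expR (- (s * y))))) => i.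
  exact: is_cvgZR.
have near_mom : \forall n \near \oo, h ^+ k / k`!%:R * mean (mu n) (fun y => y ^+ (j + k)) < e.
  apply: (@cvgr_lt _ _ _ _ _ (h ^+ k / k`!%:R * m (j + k)%N)) => //.
  by apply: cvgM; [exact: cvg_cst|exact: mom].
near=> n.
have vE : v n = mean (mu n) (fun y => \sum_(i < k) c i * (y ^+ (j + i) * expR (- (s * y)))).
  rewrite (@mean_sum _ (mu n) k (fun i y => c i * (y ^+ (j + i) * expR (- (s * y))))).
    by apply: eq_bigr => i _; rewrite meanZ//; exact: iexp.
  by move=> i; apply: intZ; exact: iexp.
rewrite vE; apply: (@le_trans _ _ (mean (mu n) (fun y => h ^+ k / k`!%:R * y ^+ (j + k))));
  last first.
  rewrite meanZ; last by have [_] := amu n.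
  by apply: ltW; near: n.
apply: mean_dist.
- by apply: iexp; rewrite addr_ge0// ltW.
- apply: (@int_sum _ (mu n) k (fun i y => c i * (y ^+ (j + i) * expR (- (s * y))))) => i;
  apply: intZ; exact: iexp.
- by apply: intZ; have [_] := amu n.
move=> y y0.
have -> : y ^+ j * expR (- ((s + h) * y)) - \sum_(i < k) c i * (y ^+ (j + i) * expR (- (s * y))) =
    y ^+ j * expR (- (s * y)) * (expR (- (h * y)) - \sum_(i < k) (-1) ^+ i * ((h * y)
      ^+ i / i`!%:R)).
  rewrite mulrBr mulr_sumr -mulrA -expRD -opprD -mulrDl; congr (_ - _).
  by apply: eq_bigr => i _; rewrite /c exprMn exprD; ring.
have hy : 0 <= h * y by rewrite mulr_ge0 ?(ltW h_gt0).
rewrite normrM ger0_norm ?mulr_ge0 ?exprn_ge0 ?expR_ge0//.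
apply: (@le_trans _ _ (y ^+ j * ((h * y) ^+ k / k`!%:R))); last first.
  by rewrite exprMn exprD le_eqVlt; apply/orP; left; apply/eqP; ring.
apply: ler_pM => //; last exact: exp_taylor.
- by rewrite mulr_ge0 ?exprn_ge0 ?expR_ge0.
- by rewrite ler_piMr ?exprn_ge0// expR_le1 oppr_le0 mulr_ge0.
Unshelve. all: by end_near. Qed.

Lemma laplace_cvg i j :
  cvgn (fun n => mean (mu n) (fun y => y ^+ j * expR (- (i%:R * h * y)))).
Proof.
elim: i j => [|i IH] j.
  apply: (cvgP (m j)); rewrite (_ : (fun n => _) = (fun n => mean (mu n) (fun y => y ^+ j)));
    first exact: mom.
  by apply/funext => n; apply: eq_mean => y _; rewrite !mul0r oppr0 expR0 mulr1.
rewrite (_ : (fun n => _) = (fun n => mean (mu n) (fun y => y ^+ j * expR (- ((i%:R * h + h)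
  * y))))).
  by apply: laplace_step => //; rewrite mulr_ge0// ltW.
by apply/funext => n; apply: eq_mean => y _; rewrite -natr1 mulrDl mul1r.
Qed.

Let X (y : R) : R := expR (- (h * y)).

Let X01 y : 0 <= y -> 0 <= X y <= 1.
Proof. by move=> y0; rewrite expR_ge0 expR_le1 oppr_le0 mulr_ge0 ?(ltW h_gt0). Qed.

Let mX : measurable_fun setT X.
Proof. by apply: measurableT_comp => //; apply: measurable_funN; exact: measurable_funM. Qed.

Let iX n i l : int (mu n) (fun y => X y ^+ i * (1 - X y) ^+ l).
Proof.
apply: (@int_bounded _ _ _ 1).
  by apply: measurable_funM; apply: measurable_funX => //; exact: measurable_funB.
move=> y /X01/andP[x0 x1]; have y0 : 0 <= 1 - X y by rewrite subr_ge0.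
rewrite ger0_norm ?mulr_ge0 ?exprn_ge0// mulr_ile1 ?exprn_ge0 ?exprn_ile1//.
by rewrite lerBlDr lerDl.
Qed.

(** A factor [1 - X] splits an integrand into two with a lower [l]; at [l = 0] the power [X ^+ i] is
    the Laplace kernel at [i%:R * h]. *)
Lemma laplace_bernstein_cvg i l :
  cvgn (fun n => mean (mu n) (fun y => X y ^+ i * (1 - X y) ^+ l)).
Proof.
elim: l i => [|l IH] i.
  rewrite (_ : (fun n => _) = (fun n => mean (mu n) (fun y => y ^+ 0 * expR (- (i%:R * h * y))))).
    exact: laplace_cvg.
  apply/funext => n; apply: eq_mean => y _.
  by rewrite !expr0 mul1r mulr1 /X expRM_pow.
rewrite (_ : (fun n => _) = (fun n => mean (mu n) (fun y => X y ^+ i * (1 - X y) ^+ l)) -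
    (fun n => mean (mu n) (fun y => X y ^+ i.+1 * (1 - X y) ^+ l))); first exact: is_cvgB.
apply/funext => n; rewrite [RHS]/= -[RHS]meanB//; apply: eq_mean => y _.
by rewrite !exprS; ring.
Qed.

Definition clamp (z : R) : R := Num.min 1 (Num.max 0 z).

Lemma clamp_ge0 z : 0 <= clamp z.
Proof. by rewrite /clamp le_min ler01 le_max lexx. Qed.

Lemma clamp_le1 z : clamp z <= 1.
Proof. by rewrite /clamp ge_min lexx. Qed.

Lemma clamp_lip z z' : `|clamp z - clamp z'| <= `|z - z'|.
Proof.
wlog zz : z z' / z' <= z => [H|].
  by have [/H|/ltW/H] := leP z' z; rewrite // distrC [leRHS]distrC.
rewrite [leRHS]ger0_norm ?subr_ge0// /clamp.
rewrite /Num.min /Num.max; repeat case: ifPn; rewrite -?leNgt => *;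
  rewrite ger0_norm; lra.
Qed.

Lemma maxr_lip (x x' a : R) : `|Num.max x a - Num.max x' a| <= `|x - x'|.
Proof.
wlog xx : x x' / x' <= x => [H|].
  by have [/H|/ltW/H] := leP x' x; rewrite // distrC [leRHS]distrC.
rewrite [leRHS]ger0_norm ?subr_ge0//.
rewrite /Num.max; repeat case: ifPn; rewrite -?leNgt => *;
  rewrite ger0_norm; lra.
Qed.

(** The average over s in [t, t + e] of the indicator of y <= s. Its mean is thus an average of the
    distribution function, and it can be split as averages over subintervals. *)
Definition ramp (t e y : R) : R := clamp ((t + e - y) / e).

Lemma measurable_clamp : measurable_fun setT clamp.
Proof. by apply: measurable_minr => //; exact: measurable_maxr. Qed.

Lemma measurable_ramp t e : measurable_fun setT (ramp t e).
Proof.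
apply: (measurableT_comp measurable_clamp); apply: measurable_funM => //.
exact: measurable_funB.
Qed.

Lemma int_ramp (P : probability R R) t e : int P (ramp t e).
Proof.
apply: (@int_bounded _ _ _ 1); first exact: measurable_ramp.
by move=> y _; rewrite ger0_norm ?clamp_ge0 ?clamp_le1.
Qed.

Lemma ln_lip (a x x' : R) : 0 < a -> a <= x -> a <= x' ->
  `|ln x - ln x'| <= `|x - x'| / a.
Proof.
move=> a0; wlog xx : x x' / x' <= x => [H ax ax'|].
  by have [/H|/ltW/H] := leP x' x; rewrite // distrC [`|x - _|]distrC; exact.
move=> ax ax'; have x0 : 0 < x by lra. have x'0 : 0 < x' by lra.
rewrite !ger0_norm ?subr_ge0 ?ler_ln ?posrE//.
rewrite -ln_div ?posrE//.
have -> : x / x' = 1 + (x - x') / x' by field; rewrite gt_eqF.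
apply: (@le_trans _ _ ((x - x') / x')).
  apply: le_ln1Dx; apply: (@lt_le_trans _ _ 0); first by rewrite oppr_lt0.
  by rewrite divr_ge0 ?subr_ge0// ltW.
by apply: ler_wpM2l; rewrite ?subr_ge0// lef_pV2 ?posrE.
Qed.

Lemma ramp_cvg (t e : R) : 0 < e -> cvgn (fun n => mean (mu n) (ramp t e)).
Proof.
(* Seen as a function of [X y], the ramp involves a logarithm, which is not Lipschitz at 0. But the
   ramp vanishes once [X y] is below [x0], so the argument may be cut off there. *)
move=> e0; pose x0 := expR (- (h * (t + e))).
have x0p : 0 < x0 by exact: expR_gt0.
pose g x := clamp ((t + e + ln (Num.max x x0) / h) / e).
have gX y : g (X y) = ramp t e y.
  rewrite /g /ramp; have [yt|ty] := leP y (t + e).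
    rewrite max_l; last by rewrite ler_expR lerN2 ler_pM2l.
    by rewrite expRK; congr (clamp (_ / _)); field; rewrite gt_eqF.
  rewrite max_r; last by rewrite ler_expR lerN2 ler_pM2l// ltW.
  rewrite expRK (_ : _ + _ = 0); last by field; rewrite gt_eqF.
  have z0 : (t + e - y) / e <= 0 by rewrite pmulr_lle0 ?invr_gt0// subr_le0 ltW.
  by rewrite mul0r /clamp max_l// max_l.
(* The product of the Lipschitz constants: [x0^-1] for the logarithm above [x0] and [(h * e)^-1] for
   the affine map; the clamp and the cut-off contribute 1. *)
pose K := (x0 * h * e)^-1.
have K0 : 0 < K by rewrite invr_gt0 !mulr_gt0.
have gK x x' : `|g x - g x'| <= K * `|x - x'|.
  apply: (le_trans (clamp_lip _ _)).
  have -> : (t + e + ln (Num.max x x0) / h) / e - (t + e + ln (Num.max x' x0) / h) / e =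
    (h * e)^-1 * (ln (Num.max x x0) - ln (Num.max x' x0)) by field; rewrite !gt_eqF.
  rewrite normrM ger0_norm ?invr_ge0 ?mulr_ge0 ?(ltW h_gt0) ?(ltW e0)//.
  have -> : K = (h * e)^-1 * x0^-1 by rewrite /K; field; rewrite !gt_eqF.
  rewrite -mulrA ler_wpM2l ?invr_ge0 ?mulr_ge0 ?(ltW h_gt0) ?(ltW e0)//.
  apply: (le_trans (ln_lip x0p _ _)); rewrite ?le_max ?lexx ?orbT//.
  rewrite mulrC ler_wpM2l ?invr_ge0 ?(ltW x0p)//.
  exact: maxr_lip.
apply: cvg_approx => eps eps0.
pose eta := eps / (2 * K).
have eta0 : 0 < eta by rewrite divr_gt0 ?mulr_gt0.
(* The error of [bernstein_lipschitz] is [K * eta + K / (eta * N)]; [eta] makes the first term equal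
   to [eps / 2], and [N] bounds the second by the same. *)
pose N := (Num.bound (2 * K / (eta * eps))).+1.
have NK : 2 * K / (eta * eps) < N%:R.
  have B0 : 0 <= 2 * K / (eta * eps).
    by apply: ltW; apply: divr_gt0; apply: mulr_gt0.
  by have := archi_boundP B0; rewrite /N -natr1; lra.
pose w (i : nat) (y : R) := g (i%:R / N%:R) * bernstein_weight N i (X y).
have wE i y : w i y = g (i%:R / N%:R) * 'C(N, i)%:R * (X y ^+ i * (1 - X y) ^+ (N - i)).
  by rewrite /w /bernstein_weight; ring.
have iw n i : int (mu n) (w i).
  rewrite (_ : w i = (fun y => g (i%:R / N%:R) * 'C(N, i)%:R * (X y ^+ i * (1 - X y)
    ^+ (N - i)))); last exact/funext.
  exact: intZ.
exists (fun n => \sum_(i < N.+1) mean (mu n) (w i)).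
  apply: (is_cvg_sumR (u := fun i n => mean (mu n) (w i))) => i.
  rewrite (_ : (fun n => _) = (fun n => g (i%:R / N%:R) * 'C(N, i)%:R * mean (mu n) (fun y =>
    X y ^+ i * (1 - X y) ^+ (N - i)))).
    by apply: is_cvgZR; exact: laplace_bernstein_cvg.
  by apply/funext => n; rewrite -meanZ//; apply: eq_mean => y _.
near=> n; rewrite -mean_sum// -[leRHS](mean_cst eps (amu n).1).
apply: mean_dist.
- exact: int_ramp.
- exact: int_sum.
- by apply: (@int_bounded _ _ _ eps) => // y _; rewrite ger0_norm// ltW.
move=> y y0; rewrite -gX.
apply: (le_trans (bernstein_lipschitz (K := K) _ eta0 _ (X01 y0) _)) => //; first exact: ltW.
rewrite mulrDr.
have -> : K * eta = eps / 2 by rewrite /eta; field; rewrite gt_eqF.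
have N0 : 0 < N%:R :> R by rewrite ltr0n.
have : K * (eta^-1 / N%:R) <= eps / 2.
  rewrite mulrA ler_pdivrMr// -ler_pdivrMl ?divr_gt0//.
  by apply: le_trans (ltW NK); rewrite le_eqVlt; apply/orP; left; apply/eqP; field;
    rewrite !gt_eqF.
lra.
Unshelve. all: by end_near. Qed.

End laplace_convergence.

(** * Distribution functions and ramps *)

Section distribution_function.
Context (R : realType).

Lemma exists_distribution (F : R -> R) : {homo F : x y / x <= y} ->
  (forall x, F @ x^'+ --> F x) -> F x @[x --> -oo] --> (0 : R) ->
  F x @[x --> +oo] --> (1 : R) ->
  exists D : probability R R, forall t, D `]-oo, t]%classic = (F t)%:E.
Proof.
move=> nd rc Fm Fp.
pose F' : cumulativeBounded (0 : R) (1 : R) := HB.pack F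
  (isCumulative.Build R _ R F nd rc) (isCumulativeBounded.Build R 0 1 F Fm Fp).
(* The Stieltjes measure lives on another measurable structure of the line; its image under the
   identity lives on the one used in the theorem. *)
pose P : probability (measurableTypeR R) R := lebesgue_stieltjes_measure F'.
have mid : measurable_fun setT (idfun : measurableTypeR R -> R).
  by move=> _ A mA; rewrite setTI.
pose X : {RV P >-> R} := HB.pack (idfun : measurableTypeR R -> R)
  (isMeasurableFun.Build _ _ _ _ (idfun : measurableTypeR R -> R) mid).
by exists (distribution P X) => t; exact: (cdf_lebesgue_stieltjes_id F' t).
Qed.

Lemma distribution_unique (D D' : probability R R) :
  (forall t, D `]-oo, t]%classic = D' `]-oo, t]%classic) ->
  forall A, measurable A -> D A = D' A.
Proof.
move=> H A mA.
have ocE (P : probability R R) (a b : R) : a <= b ->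
    P `]a, b]%classic = (P `]-oo, b]%classic - P `]-oo, a]%classic)%E.
  move=> ab; rewrite -[X in (_ - P X)%E](@setIidr _ `]-oo, b]%classic); last exact: subset_itvl.
  rewrite -measureD//; last by apply: (le_lt_trans (probability_le1 _ _)) => //; rewrite ltry.
  by congr (P _); rewrite -[RHS]setCK setCD setCitvl setUC -[LHS]setCK setCitv.
apply: (measure_unique (@ocitv R) (fun k => `](- k%:R : R), (k%:R : R)]%classic)) => //.
- exact: ocitvI.
- by move=> k; exact: is_ocitv.
- rewrite -subTset => x _; exists (Num.bound `|x|) => //=; rewrite in_itv/=.
  by have := archi_boundP (normr_ge0 x); rewrite ltr_norml => /andP[h1 h2]; rewrite h1 ltW.
- move=> _ [[a b] _ <-] /=; have [ab|ba] := leP a b.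
    by transitivity (D `]-oo, b]%classic - D `]-oo, a]%classic)%E; [exact: ocE|rewrite !H -ocE].
  by rewrite set_itv_ge ?measure0// bnd_simp -leNgt ltW.
- by move=> k; apply: (le_lt_trans (probability_le1 _ _)) => //; rewrite ltry.
Qed.

End distribution_function.

Section ramps.
Context (R : realType).
Implicit Types (P D : probability R R) (t e y : R).

Lemma ramp1 t e y : 0 < e -> y <= t -> ramp t e y = 1.
Proof.
move=> e0 yt; rewrite /ramp /clamp min_l// le_max; apply/orP; right.
by rewrite ler_pdivlMr// mul1r; lra.
Qed.

Lemma ramp0 t e y : 0 < e -> t + e <= y -> ramp t e y = 0.
Proof.
move=> e0 yt; rewrite /ramp /clamp max_l ?min_r//.
by rewrite pmulr_lle0 ?invr_gt0// subr_le0.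
Qed.

Lemma ramp_ge0 t e y : 0 <= ramp t e y. Proof. exact: clamp_ge0. Qed.

Lemma ramp_le1 t e y : ramp t e y <= 1. Proof. exact: clamp_le1. Qed.

Lemma clamp_homo : {homo @clamp R : x y / x <= y}.
Proof.
by move=> x y xy; rewrite /clamp le_min ge_min lexx /= ge_min; apply/orP; right;
  rewrite ge_max !le_max lexx xy orbT.
Qed.

Lemma ramp_homo t t' e y : 0 < e -> t <= t' -> ramp t e y <= ramp t' e y.
Proof. by move=> e0 tt; apply: clamp_homo; rewrite ler_pM2r ?invr_gt0//; lra. Qed.

Lemma ramp_sep t t' e e' y : 0 < e -> 0 < e' -> t + e <= t' -> ramp t e y <= ramp t' e' y.
Proof.
move=> e0 e'0 tt; have [yt|ty] := leP y t'; first by rewrite [leRHS]ramp1// ramp_le1.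
by rewrite ramp0 ?ramp_ge0//; lra.
Qed.

Lemma ramp_shift t e s y : 0 < e -> 0 <= s -> ramp (t + s) e y <= ramp t e y + s / e.
Proof.
move=> e0 s0; have := clamp_lip ((t + s + e - y) / e) ((t + e - y) / e).
rewrite -mulrBl (_ : t + s + e - y - (t + e - y) = s); last by ring.
rewrite [X in _ <= X -> _]ger0_norm; last by rewrite divr_ge0// ltW.
by rewrite /ramp => /(le_trans (ler_norm _)); lra.
Qed.

(* Summing unit ramps: [sum_(i < n) clamp (i + 1 - s)] is [n - s] cut off to [[0, n]]. *)
Lemma sum_clamp n (s : R) :
  \sum_(i < n) clamp (i.+1%:R - s) = Num.min n%:R (Num.max 0 (n%:R - s)).
Proof.
elim: n => [|n IH].
  by rewrite big_ord0 min_l// le_max lexx.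
rewrite big_ord_recr/= IH /clamp -natr1.
have n0 : 0 <= n%:R :> R by [].
rewrite /Num.min /Num.max; repeat case: ifPn; rewrite -?leNgt => *; lra.
Qed.

(** An average over an interval is the mean of the averages over its [n.+1] equal pieces. *)
Lemma ramp_split t e n y : 0 < e ->
  ramp t e y = n.+1%:R^-1 * \sum_(i < n.+1) ramp (t + i%:R * (e / n.+1%:R)) (e / n.+1%:R) y.
Proof.
move=> e0; have N0 : 0 < n.+1%:R :> R by rewrite ltr0n.
pose s := (y - t) / e * n.+1%:R.
transitivity (n.+1%:R^-1 * \sum_(i < n.+1) clamp (i.+1%:R - s)); last first.
  congr (_ * _); apply: eq_bigr => i _; rewrite /ramp; congr clamp.
  by rewrite /s -[i.+1%:R]natr1; field; rewrite !gt_eqF.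
rewrite sum_clamp /ramp /clamp minr_pMr ?invr_ge0 ?(ltW N0)// maxr_pMr ?invr_ge0 ?(ltW N0)//.
rewrite mulVf ?gt_eqF// mulr0; congr (Num.min _ (Num.max _ _)).
by rewrite /s; field; rewrite !gt_eqF.
Qed.

Definition cdf_of D t : R := fine (D `]-oo, t]%classic).

Lemma mean_indic D t : D (@half_line R) = 1%E -> mean D (\1_`]-oo, t]%classic) = cdf_of D t.
Proof.
move=> D1; rewrite /mean /Rintegral /cdf_of integral_indic//; last exact: measurable_half_line.
congr fine.
have D0 : D (~` (@half_line R)) = 0%E.
  by rewrite probability_setC ?D1 ?subee//; exact: measurable_half_line.
rewrite -[in RHS](setUIDK (`]-oo, t]%classic) (@half_line R)) measureU//; last 3 first.
- by apply: measurableI => //; exact: measurable_half_line.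
- by apply: measurableD => //; exact: measurable_half_line.
- by apply/seteqP; split => // x /= [[_ h] [_ nh]].
rewrite [X in (_ + X)%E](_ : _ = 0%E) ?adde0//.
apply/eqP; rewrite eq_le measure_ge0 andbT -D0; apply: le_measure; rewrite ?inE.
- by apply: measurableD => //; exact: measurable_half_line.
- by apply: measurableC; exact: measurable_half_line.
- by move=> x [].
Qed.

Lemma int_indic D t : int D (\1_`]-oo, t]%classic).
Proof.
apply: (@int_bounded _ _ _ 1); first exact: measurable_indic.
by move=> y _; rewrite ger0_norm// indicE lern1 leq_b1.
Qed.

Lemma indic_le_ramp t e y : 0 < e -> \1_`]-oo, t]%classic y <= ramp t e y.
Proof.
move=> e0; rewrite indicE; have [|_] := boolP (y \in _); last exact: ramp_ge0.
by rewrite inE/= in_itv/= => yt; rewrite ramp1.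
Qed.

Lemma ramp_le_indic t e y : 0 < e -> ramp t e y <= \1_`]-oo, t + e]%classic y.
Proof.
move=> e0; rewrite indicE; have [_|] := boolP (y \in _); first exact: ramp_le1.
by rewrite notin_setE/= in_itv/= => /negP; rewrite -ltNge => yt; rewrite ramp0// ltW.
Qed.

Lemma mean_ramp_cdf D t e : D (@half_line R) = 1%E -> 0 < e ->
  cdf_of D t <= mean D (ramp t e) <= cdf_of D (t + e).
Proof.
move=> aD e0; rewrite -!mean_indic//; apply/andP; split; apply: le_mean => //;
  try exact: int_indic; try exact: int_ramp.
- by move=> y _; exact: indic_le_ramp.
- by move=> y _; exact: ramp_le_indic.
Qed.

(* Squeezing both sides between Riemann sums of the distribution function. *)
Lemma mean_ramp_unique D (L : R -> R -> R) : D (@half_line R) = 1%E ->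
  (forall t e, 0 < e -> cdf_of D t <= L t e <= cdf_of D (t + e)) ->
  (forall t e n, 0 < e ->
    L t e = n.+1%:R^-1 * \sum_(i < n.+1) L (t + i%:R * (e / n.+1%:R)) (e / n.+1%:R)) ->
  forall t e, 0 < e -> mean D (ramp t e) = L t e.
Proof.
move=> aD LF Lsplit t e e0.
have Dsplit n : mean D (ramp t e) =
    n.+1%:R^-1 * \sum_(i < n.+1) mean D (ramp (t + i%:R * (e / n.+1%:R)) (e / n.+1%:R)).
  rewrite -(@mean_sum _ D n.+1 (fun i => ramp (t + i%:R * (e / n.+1%:R)) (e / n.+1%:R)));
    last first.
    by move=> i; exact: int_ramp.
  rewrite -meanZ; last first.
    by apply: (@int_sum _ D n.+1 (fun i => ramp (t + i%:R * (e / n.+1%:R)) (e / n.+1%:R))) => i;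
      exact: int_ramp.
  by apply: eq_mean => y _; exact: ramp_split.
apply/eqP; rewrite -subr_eq0 -normr_eq0; apply/eqP.
apply/eqP; rewrite eq_le normr_ge0 andbT; apply/ler_addgt0Pr => eps eps0; rewrite add0r.
pose n := Num.bound eps^-1.
have nP : eps^-1 < n.+1%:R.
  have E0 : 0 <= eps^-1 by rewrite invr_ge0 ltW.
  by have := archi_boundP E0; rewrite -/n -natr1; lra.
have N0 : 0 < n.+1%:R :> R by rewrite ltr0n.
pose d := e / n.+1%:R; have d0 : 0 < d by rewrite divr_gt0.
pose G i := cdf_of D (t + i%:R * d).
have GS (i : 'I_n.+1) : t + i%:R * d + d = t + i.+1%:R * d by rewrite -[i.+1%:R]natr1; ring.
have Gtel : \sum_(i < n.+1) (G i.+1 - G i) <= 1.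
  rewrite -(big_mkord xpredT (fun i => G i.+1 - G i)) telescope_sumr//.
  have G1 i : G i <= 1.
    by rewrite /G /cdf_of -[1]/(fine 1%E); apply: fine_le; rewrite ?fin_num_measure//;
      exact: probability_le1.
  have G0 i : 0 <= G i by rewrite /G /cdf_of fine_ge0.
  by have := G1 n.+1; have := G0 0%N; lra.
rewrite (Dsplit n) (Lsplit t e n)// -mulrBr -sumrB normrM ger0_norm ?invr_ge0 ?(ltW N0)//.
rewrite ler_pdivrMl//; apply: (@le_trans _ _ 1); last first.
  by rewrite -ler_pdivrMr// mul1r ltW.
apply: le_trans Gtel; apply: (le_trans (ler_norm_sum _ _ _)); apply: ler_sum => i _.
have /andP[a1 a2] := LF (t + i%:R * d) d d0.
have /andP[b1 b2] := mean_ramp_cdf (t + i%:R * d) aD d0.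
move: a1 a2 b1 b2; rewrite GS -/(G i) -/(G i.+1) -/d => a1 a2 b1 b2.
by rewrite ler_norml; apply/andP; split; lra.
Qed.

End ramps.

(** * From ramps to bounded continuous functions *)

Section weak_convergence.
Context (R : realType).
Implicit Types (P D : probability R R) (h : R -> R).

(** Compactness is used in its near-covering form over small [delta], which replaces the extraction
    of a finite subcover. Only [x] is confined to the segment. *)
Lemma heine_itv h (a b w : R) : continuous h -> 0 < w ->
  exists2 delta : R, 0 < delta & forall x y, a <= x <= b -> `|x - y| <= delta ->
    `|h x - h y| <= w.
Proof.
move=> ch w0; have := compact_near_coveringP (`[a, b]%classic : set R).
move=> /iffLR /(_ (@segment_compact R a b)).
move=> /(_ R ((0 : R)^'+) (fun delta x => forall y, `|x - y| <= delta -> `|h x - h y| <= w)) H.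
have {}H : \forall delta \near (0 : R)^'+, `[a, b]%classic `<=` [set x | forall y, `|x - y| <=
  delta -> `|h x - h y| <= w].
  apply: H => x _.
  have w2 : 0 < w / 2 by rewrite divr_gt0.
  have /cvgrPdist_lt/(_ _ w2)/nbhs_ballP[eta /= eta0 etaP] := ch x.
  have eta2 : 0 < eta / 2 by rewrite divr_gt0.
  exists (ball x (eta / 2), [set d | d < eta / 2]) => /=.
    split; first exact: nbhsx_ballx.
    exact: nbhs_right_lt.
  move=> [x' d] /= [bx dlt] y xy.
  have h1 : `|h x - h x'| < w / 2.
    by apply: etaP; apply: le_ball bx; lra.
  have h2 : `|h x - h y| < w / 2.
    apply: etaP; rewrite /ball/=.
    apply: (@le_lt_trans _ _ (`|x - x'| + `|x' - y|)); first exact: ler_distD.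
    by move: bx; rewrite /ball/= => bx; lra.
  have := ler_distD (h x) (h x') (h y); rewrite [`|h x' - h x|]distrC; lra.
have [d [d0 Hd]] : exists d : R, 0 < d /\ `[a, b]%classic `<=` [set x | forall y, `|x - y| <=
  d -> `|h x - h y| <= w].
  apply: (@filter_ex _ ((0 : R)^'+)); near=> d; split; first by near: d; exact: nbhs_right_gt.
  by near: d.
by exists d => // x y xab; apply: Hd; rewrite /= in_itv.
Unshelve. all: by end_near. Qed.

(** The differences of consecutive ramps are hat functions, the one at node [i%:R * e] vanishing at
    distance [e] or more. On the half-line the leftmost ramp is 0, so the hats add up to
    [ramp (N%:R * e) e]: the missing mass costs at most [B], and under each hat [h] varies by at
    most [w]. *)
Lemma mean_interpolate P h (B w e : R) N : P (@half_line R) = 1%E ->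
  continuous h -> (forall y, `|h y| <= B) -> 0 < e -> 0 <= w ->
  (forall x y, 0 <= x <= N.+1%:R * e -> `|x - y| <= e -> `|h x - h y| <= w) ->
  `|mean P h - \sum_(i < N.+1) h (i%:R * e) *
      (mean P (ramp (i%:R * e) e) - mean P (ramp ((i%:R - 1) * e) e))| <=
  B * (1 - mean P (ramp (N%:R * e) e)) + w.
Proof.
move=> P1 ch hB e0 w0 hw.
have mh : measurable_fun setT h by exact: continuous_measurable_fun.
have ih : int P h by apply: (@int_bounded _ _ _ B).
pose r (i : nat) := ramp ((i%:R - 1) * e) e.
have rS (i : nat) : r i.+1 = ramp (i%:R * e) e by rewrite /r -natr1 addrK.
pose g i y := r i.+1 y - r i y.
have ig i : int P (g i) by apply: intB; exact: int_ramp.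
have igh i : int P (fun y => h (i%:R * e) * g i y) by exact: intZ.
have B0 : 0 <= B by apply: le_trans (hB 0).
have g0 i y : 0 <= g i y.
  by rewrite subr_ge0; apply: ramp_homo => //; rewrite ler_pM2r// lerD2r ler_nat.
have gsum n y : 0 <= y -> \sum_(i < n) g i y = r n y.
  move=> y0; rewrite -(big_mkord xpredT (g^~ y)) telescope_sumr//.
  by rewrite /r [X in _ - X]ramp0 ?subr0//; lra.
have -> : \sum_(i < N.+1) h (i%:R * e) *
      (mean P (ramp (i%:R * e) e) - mean P (ramp ((i%:R - 1) * e) e)) =
    mean P (fun y => \sum_(i < N.+1) h (i%:R * e) * g i y).
  rewrite (@mean_sum _ P N.+1 (fun i y => h (i%:R * e) * g i y))//.
  apply: eq_bigr => i _; rewrite meanZ// /g meanB; [|exact: int_ramp..].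
  by rewrite rS.
have -> : B * (1 - mean P (ramp (N%:R * e) e)) + w =
    mean P (fun y => B * (1 - ramp (N%:R * e) e y) + w).
  rewrite meanD; last 2 first.
  - by apply: intZ; apply: intB; [apply: (@int_bounded _ _ _ 1) => // y _;
    rewrite normr1//|exact: int_ramp].
  - by apply: (@int_bounded _ _ _ w) => // y _; rewrite ger0_norm.
  rewrite meanZ; last by apply: intB; [apply: (@int_bounded _ _ _ 1) => // y _;
    rewrite normr1|exact: int_ramp].
  rewrite meanB; [|apply: (@int_bounded _ _ _ 1) => // y _; rewrite normr1//|exact: int_ramp].
  by rewrite !mean_cst.
apply: mean_dist => //.
- exact: (@int_sum _ P N.+1 (fun i y => h (i%:R * e) * g i y)).
- apply: intD; last by apply: (@int_bounded _ _ _ w) => // y _; rewrite ger0_norm.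
  by apply: intZ; apply: intB; [apply: (@int_bounded _ _ _ 1) => // y _;
    rewrite normr1|exact: int_ramp].
move=> y y0.
have -> : h y - \sum_(i < N.+1) h (i%:R * e) * g i y =
    h y * (1 - ramp (N%:R * e) e y) + \sum_(i < N.+1) (h y - h (i%:R * e)) * g i y.
  rewrite [X in _ = _ + X](eq_bigr (fun i : 'I_N.+1 => h y * g i y - h (i%:R * e) * g i y));
    last first.
    by move=> i _; rewrite mulrBl.
  by rewrite sumrB -mulr_sumr gsum// rS; ring.
apply: (le_trans (ler_normD _ _)); apply: lerD.
  rewrite normrM [X in _ * X]ger0_norm ?subr_ge0 ?ramp_le1//.
  by apply: ler_wpM2r; rewrite ?subr_ge0 ?ramp_le1.
apply: (le_trans (ler_norm_sum _ _ _)).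
apply: (@le_trans _ _ (\sum_(i < N.+1) w * g i y)); last first.
  by rewrite -mulr_sumr gsum// ler_piMr// ramp_le1.
apply: ler_sum => i _; rewrite normrM (ger0_norm (g0 i y)).
have [yl|yl] := leP y ((i%:R - 1) * e).
  by rewrite /g rS {1 2}/r !ramp1 ?subrr ?mulr0//; nra.
have [yr|yr] := leP (i%:R * e + e) y.
  by rewrite /g rS {1 2}/r !ramp0 ?subrr ?mulr0//; nra.
apply: ler_wpM2r => //; apply: hw.
  rewrite y0/=; have : i%:R <= N%:R :> R by rewrite ler_nat -ltnS.
  by rewrite -natr1; nra.
by rewrite ler_norml; apply/andP; split; nra.
Qed.

Lemma cdf_tail D : forall eps : R, 0 < eps -> exists M : nat, 1 - eps < cdf_of D M.+1%:R.
Proof.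
move=> eps eps0.
have cvgD : D `]-oo, n%:R]%classic @[n --> \oo] --> D (\bigcup_n `]-oo, (n%:R : R)]%classic).
  apply: nondecreasing_cvg_mu => //; first exact: bigcup_measurable.
  by move=> m n mn; apply/subsetPset/subset_itvl; rewrite bnd_simp ler_nat.
have UT : \bigcup_n `]-oo, (n%:R : R)]%classic = setT.
  rewrite -subTset => x _; exists (Num.bound `|x|) => //=; rewrite in_itv/=.
  by apply: le_trans (ler_norm _) _; apply: ltW; exact: archi_boundP.
rewrite UT probability_setT in cvgD.
have /fine_cvgP[_ /cvgrPdist_lt/(_ _ eps0)] := cvgD.
move=> [M _ HM]; exists M; have := HM M.+1 (leqnSn M); rewrite /= /cdf_of.
by rewrite ltr_norml => /andP[]; lra.
Qed.

Lemma ramp_weak_convergence (mu : nat -> probability R R) D h (B : R) :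
  (forall n, mu n (@half_line R) = 1%E) -> D (@half_line R) = 1%E ->
  (forall t e, 0 < e -> mean (mu n) (ramp t e) @[n --> \oo] --> mean D (ramp t e)) ->
  continuous h -> (forall y, `|h y| <= B) ->
  mean (mu n) h @[n --> \oo] --> mean D h.
Proof.
move=> mu1 D1 cr ch hB; have B0 : 0 <= B by apply: le_trans (hB 0).
apply/cvgrPdist_le => eps eps0.
(* Five errors: a tail and an oscillation for each of the two laws, and the difference of the two
   interpolating sums. *)
pose w := eps / 5; have w0 : 0 < w by rewrite divr_gt0.
pose tau := w / (B + 1); have tau0 : 0 < tau by rewrite divr_gt0//; lra.
have Btau : B * tau <= w.
  by rewrite /tau mulrA ler_pdivrMr ?ltr_wpDl//; nra.
have [M MD] := cdf_tail D tau0.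
have [delta delta0 hd] := heine_itv 0 (M.+1%:R + 1) ch w0.
pose q := (Num.bound delta^-1).+1.
have q0 : 0 < q%:R :> R by rewrite ltr0n.
have qd : q%:R^-1 <= delta.
  rewrite -[leRHS]invrK lef_pV2 ?posrE ?invr_gt0//.
  have E0 : 0 <= delta^-1 by rewrite invr_ge0 ltW.
  by have := archi_boundP E0; rewrite /q -natr1; lra.
have q1 : q%:R^-1 <= 1 :> R by rewrite invf_le1// ler1n.
pose e : R := q%:R^-1; have e0 : 0 < e by rewrite invr_gt0.
(* The mesh is the inverse of an integer, so the last node falls exactly on [M.+1], where the tail
   of [D] is small. *)
pose N := (M.+1 * q)%N.
have Ne : N%:R * e = M.+1%:R :> R by rewrite /N natrM /e mulfK// gt_eqF.
have hw x y : 0 <= x <= N.+1%:R * e -> `|x - y| <= e -> `|h x - h y| <= w.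
  move=> /andP[x0 xN] xy; apply: hd; last exact: le_trans xy qd.
  by rewrite x0/=; apply: (le_trans xN); rewrite -natr1 mulrDl Ne mul1r lerD2l.
pose S P := \sum_(i < N.+1) h (i%:R * e) *
      (mean P (ramp (i%:R * e) e) - mean P (ramp ((i%:R - 1) * e) e)).
have IP P : P (@half_line R) = 1%E ->
    `|mean P h - S P| <= B * (1 - mean P (ramp (N%:R * e) e)) + w.
  by move=> P1; apply: mean_interpolate => //; exact: ltW.
have SD : S (mu n) @[n --> \oo] --> S D.
  rewrite /S; elim: N.+1 => [|k IH].
    by under eq_cvg do rewrite big_ord0; rewrite big_ord0; exact: cvg_cst.
  under eq_cvg do rewrite big_ord_recr/=.
  rewrite big_ord_recr/=; apply: cvgD => //.
  by apply: cvgM; [exact: cvg_cst|apply: cvgB; exact: cr].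
have DN : 1 - mean D (ramp (N%:R * e) e) < tau.
  by have /andP[+ _] := mean_ramp_cdf (N%:R * e) D1 e0; rewrite Ne; lra.
have rN := cr (N%:R * e) e e0.
near=> n.
have s1 : `|S D - S (mu n)| < w by near: n; exact: cvgr_dist_lt.
have s2 : 1 - mean (mu n) (ramp (N%:R * e) e) < tau.
  have : 1 - tau < mean (mu n) (ramp (N%:R * e) e) by near: n; apply: cvgr_gt; [exact: rN|lra].
  lra.
have b1 : B * (1 - mean D (ramp (N%:R * e) e)) <= w.
  by apply: (le_trans _ Btau); apply: ler_wpM2l => //; exact: ltW.
have b2 : B * (1 - mean (mu n) (ramp (N%:R * e) e)) <= w.
  by apply: (le_trans _ Btau); apply: ler_wpM2l => //; exact: ltW.
have i1 := IP _ D1; have i2 := IP _ (mu1 n).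
have t1 := ler_distD (S D) (mean D h) (mean (mu n) h).
have t2 := ler_distD (S (mu n)) (S D) (mean (mu n) h).
rewrite [`|S (mu n) - mean (mu n) h|]distrC in t2.
by rewrite /w in b1 b2 s1 i1 i2; lra.
Unshelve. all: by end_near. Qed.

End weak_convergence.

(** * Existence and uniqueness of the limit law *)

Section moment_method.
Context (R : realType).
Implicit Types (mu : nat -> probability R R) (D : probability R R).

Lemma cvg_le_cvg (u v : R^nat) (a b : R) : u @ \oo --> a -> v @ \oo --> b ->
  (forall n, u n <= v n) -> a <= b.
Proof. by move=> ua vb uv; apply: (ler_cvg_to ua vb); exact: nearW. Qed.

Lemma cvg_sumR n (u : nat -> R^nat) (l : nat -> R) : (forall i, u i @ \oo --> l i) ->
  \sum_(i < n) u i k @[k --> \oo] --> \sum_(i < n) l i.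
Proof.
move=> ul; elim: n => [|n IH].
  by under eq_cvg do rewrite big_ord0; rewrite big_ord0; exact: cvg_cst.
under eq_cvg do rewrite big_ord_recr/=.
by rewrite big_ord_recr/=; apply: cvgD; [exact: IH|exact: ul].
Qed.

Section limit_distribution.
Variables (mu : nat -> probability R R) (m : nat -> R) (rho : R).
Hypothesis amu : forall n, all_moments (mu n).
Hypothesis mom : forall k, mean (mu n) (fun y => y ^+ k) @[n --> \oo] --> m k.
Hypothesis rho_gt0 : 0 < rho.
Hypothesis m_le : forall k, m k <= k.+1`!%:R * rho ^+ k.+1.

Let L t e : R := limn (fun n => mean (mu n) (ramp t e)).

Let cL t e : 0 < e -> mean (mu n) (ramp t e) @[n --> \oo] --> L t e.
Proof. by move=> e0; exact: (ramp_cvg amu mom rho_gt0 m_le). Qed.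

Let mu1 n : mu n (@half_line R) = 1%E. Proof. by have [] := amu n. Qed.

Let L_ge (a : R) t e : 0 < e -> (forall n, a <= mean (mu n) (ramp t e)) -> a <= L t e.
Proof.
by move=> e0 H; exact: (cvg_le_cvg (cvg_cst a) (@cL t e e0) H). Qed.

Let L_le (a : R) t e : 0 < e -> (forall n, mean (mu n) (ramp t e) <= a) -> L t e <= a.
Proof.
by move=> e0 H; exact: (cvg_le_cvg (@cL t e e0) (cvg_cst a) H). Qed.

Let L_ge0 t e : 0 < e -> 0 <= L t e.
Proof.
move=> e0; apply: L_ge => // n; rewrite -(mean0 (mu n)).
by apply: le_mean => [||y _]; [exact: int0|exact: int_ramp|exact: ramp_ge0].
Qed.

Let int1 D : int D (fun=> 1).
Proof. by apply: (@int_bounded _ _ _ 1) => // y _; rewrite normr1. Qed.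

Let L_le1 t e : 0 < e -> L t e <= 1.
Proof.
move=> e0; apply: L_le => // n; rewrite -[leRHS](mean_cst 1 (mu1 n)).
by apply: le_mean => [||y _]; [exact: int_ramp|exact: int1|exact: ramp_le1].
Qed.

Let L_le_L t e t' e' : 0 < e -> 0 < e' ->
  (forall y, ramp t e y <= ramp t' e' y) -> L t e <= L t' e'.
Proof.
move=> e0 e'0 H; apply: (cvg_le_cvg (@cL t e e0) (@cL t' e' e'0)) => n.
by apply: le_mean => [||y _]; [exact: int_ramp|exact: int_ramp|exact: H].
Unshelve. all: by end_near. Qed.

Let L_shift t e s : 0 < e -> 0 <= s -> L (t + s) e <= L t e + s / e.
Proof.
move=> e0 s0; have H : mean (mu n) (ramp t e) + s / e @[n --> \oo] --> L t e + s / e.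
  by apply: cvgD; [exact: cL|exact: cvg_cst].
apply: (cvg_le_cvg (@cL (t + s) e e0) H) => n.
have ics : int (mu n) (fun=> s / e).
  by apply: (@int_bounded _ _ _ (s / e)) => // y _; rewrite ger0_norm// divr_ge0// ltW.
rewrite -(mean_cst (s / e) (mu1 n)) -meanD//; last exact: int_ramp.
apply: le_mean; [exact: int_ramp|by apply: intD => //; exact: int_ramp|].
by move=> y _; exact: ramp_shift.
Unshelve. all: by end_near. Qed.

Let L_split t e n : 0 < e ->
  L t e = n.+1%:R^-1 * \sum_(i < n.+1) L (t + i%:R * (e / n.+1%:R)) (e / n.+1%:R).
Proof.
move=> e0; have e'0 : 0 < e / n.+1%:R by rewrite divr_gt0.
apply: (@cvg_lim _ (@Rhausdorff R)).
have -> : (fun k => mean (mu k) (ramp t e)) = (fun k => n.+1%:R^-1 * \sum_(i < n.+1)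
    mean (mu k) (ramp (t + i%:R * (e / n.+1%:R)) (e / n.+1%:R))).
  apply/funext => k.
  rewrite -(@mean_sum _ (mu k) n.+1 (fun i => ramp (t + i%:R * (e / n.+1%:R)) (e / n.+1%:R)));
    last first.
    by move=> i; exact: int_ramp.
  rewrite -meanZ; last first.
    by apply: (@int_sum _ (mu k) n.+1 (fun i => ramp (t + i%:R * (e / n.+1%:R)) (e / n.+1%:R)))
      => i; exact: int_ramp.
  by apply: eq_mean => y _; exact: ramp_split.
apply: cvgM; first exact: cvg_cst.
apply: (@cvg_sumR n.+1 (fun i k => mean (mu k) (ramp (t + i%:R * (e / n.+1%:R)) (e / n.+1%:R)))
  (fun i => L (t + i%:R * (e / n.+1%:R)) (e / n.+1%:R))) => i.
exact: cL.
Qed.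

(** The distribution functions of [mu n] need not converge at an atom of the limit. The infimum over
    ramps to the right of [t] selects the right-continuous version. *)
Let F t : R := inf [set L t e | e in [set e | 0 < e]].

Let Fset t : [set L t e | e in [set e | 0 < e]] !=set0.
Proof. by exists (L t 1); exists 1 => //=. Qed.

Let F_le t e : 0 < e -> F t <= L t e.
Proof.
move=> e0; apply: ge_inf; last by exists e.
by exists 0 => _ [e' e'0 <-]; exact: L_ge0.
Qed.

Let F_ge (a : R) t : (forall e, 0 < e -> a <= L t e) -> a <= F t.
Proof. by move=> H; apply: lb_le_inf => // _ [e e0 <-]; exact: H. Qed.

Let F_homo : {homo F : x y / x <= y}.
Proof.
move=> s t st; apply: F_ge => e e0; apply: (le_trans (F_le s e0)).
by apply: L_le_L => // y; exact: ramp_homo.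
Qed.

Let L_le_F t e : 0 < e -> L t e <= F (t + e).
Proof. by move=> e0; apply: F_ge => e' e'0; apply: L_le_L => // y; exact: ramp_sep. Qed.

Let F_ge0 t : 0 <= F t. Proof. by apply: F_ge => e; exact: L_ge0. Qed.

Let F_right t : F x @[x --> t^'+] --> F t.
Proof.
apply/cvgrPdist_le => eps eps0.
have eps2 : 0 < eps / 2 by rewrite divr_gt0.
have hinf : has_inf [set L t e | e in [set e | 0 < e]].
  by split => //; exists 0 => _ [e' e'0 <-]; exact: L_ge0.
have [_ [e /= e0 <-] Le] := inf_adherent eps2 hinf.
(* A ramp of width [e] has slope [1 / e], so shifting it by less than this changes its mean by at
   most [eps / 2]. *)
have ee : 0 < eps / 2 * e by rewrite mulr_gt0.
near=> x.
have tx : t < x by near: x; exact: nbhs_right_gt.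
have xt : x < t + eps / 2 * e by near: x; apply: nbhs_right_lt; rewrite ltrDl.
have h1 := F_homo (ltW tx).
have xt0 : 0 <= x - t by rewrite subr_ge0 ltW.
have h2 := L_shift t e0 xt0; rewrite subrKC in h2.
have h3 := F_le x e0.
have h4 : (x - t) / e <= eps / 2 by rewrite ler_pdivrMr// lerBlDl ltW.
move: h1 h2 h3 h4 (ltW Le); rewrite distrC -/(F t).
move: (F x) (F t) (L x e) (L t e) ((x - t) / e) => a b c f g h1 h2 h3 h4 h5.
by rewrite ger0_norm ?subr_ge0//; lra.
Unshelve. all: by end_near. Qed.

Let F_neg t : t < 0 -> F t = 0.
Proof.
move=> t0; apply/eqP; rewrite eq_le F_ge0 andbT.
have e0 : 0 < - t by rewrite oppr_gt0.
apply: (le_trans (F_le t e0)); apply: L_le => // n; rewrite (@eq_mean _ _ _ (fun=> 0)) ?mean0//.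
by move=> y y0; rewrite ramp0// subrr.
Qed.

(** Markov's inequality for the first moment, passed to the limit; it prevents mass from escaping to
    infinity. *)
Let F_markov t : 0 < t -> 1 - m 1 / t <= F t.
Proof.
move=> t0; apply: F_ge => e e0.
have H : 1 - mean (mu n) (fun y => y ^+ 1) / t @[n --> \oo] --> 1 - m 1 / t.
  by apply: cvgB; [exact: cvg_cst|apply: cvgM; [exact: mom|exact: cvg_cst]].
apply: (cvg_le_cvg H (@cL t e e0)) => n.
have i1 : int (mu n) (fun y => y ^+ 1) by have [_] := amu n.
rewrite mulrC -meanZ// -[X in X - _](mean_cst 1 (mu1 n)) -meanB//; last exact: intZ.
apply: le_mean; [apply: intB => //; exact: intZ|exact: int_ramp|].
move=> y y0; have [yt|ty] := leP y t.
  by rewrite ramp1// lerBlDr lerDl mulr_ge0 ?invr_ge0 ?(ltW t0)// expr1.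
apply: (@le_trans _ _ 0); last exact: ramp_ge0.
by rewrite subr_le0 expr1 mulrC ler_pdivlMr// mul1r ltW.
Unshelve. all: by end_near. Qed.

Let F_le1 t : F t <= 1. Proof. by apply: (le_trans (F_le t ltr01)); exact: L_le1. Qed.

Let F_ninfty : F x @[x --> -oo] --> (0 : R).
Proof.
apply/cvgrPdist_le => eps eps0; near=> x.
by rewrite F_neg ?subr0 ?normr0 ?ltW//; near: x; exact: nbhs_ninfty_lt.
Unshelve. all: by end_near. Qed.

Let F_pinfty : F x @[x --> +oo] --> (1 : R).
Proof.
apply/cvgrPdist_le => eps eps0; near=> x.
have x0 : 0 < x by near: x; exact: nbhs_pinfty_gt.
have xm : m 1 / eps <= x by near: x; apply: nbhs_pinfty_ge; rewrite num_real.
rewrite ger0_norm ?subr_ge0 ?F_le1// lerBlDr -lerBlDl; apply: le_trans (F_markov x0).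
by rewrite lerD2l lerN2 ler_pdivrMr// mulrC -ler_pdivrMr.
Unshelve. all: by end_near. Qed.

(** Let [F] be the distribution function. The limits [L] lie between its values at the ends of the
    ramp and split over subintervals as means do, so [mean_ramp_unique] identifies them with the
    means under [D]. *)
Lemma limit_distribution_ramp : exists D,
  [/\ D (@half_line R) = 1%E &
   forall t e, 0 < e -> mean (mu n) (ramp t e) @[n --> \oo] --> mean D (ramp t e)].
Proof.
have [D DF] := exists_distribution F_homo F_right F_ninfty F_pinfty.
have D1 : D (@half_line R) = 1%E.
  transitivity (D (~` (~` @half_line R))); first by rewrite setCK.
  rewrite probability_setC; last by apply: measurableC; exact: measurable_half_line.
  suff -> : D (~` @half_line R) = 0%E by rewrite sube0.
  apply/negligibleP; first by apply: measurableC; exact: measurable_half_line.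
  (* [F] vanishes at negative points but perhaps not at 0, so the open half-line is exhausted by
     closed ones. *)
  apply: (@negligibleS _ _ _ _ (\bigcup_n `]-oo, (- n.+1%:R^-1 : R)]%classic)); last first.
    apply: negligible_bigcup => n; apply/negligibleP => //.
    by transitivity ((F (- n.+1%:R^-1))%:E); [exact: DF|rewrite F_neg// oppr_lt0 invr_gt0 ltr0n].
  move=> y /half_lineP/negP; rewrite -ltNge => y0.
  have E0 : 0 <= (- y)^-1 by rewrite invr_ge0 oppr_ge0 ltW.
  exists (Num.bound (- y)^-1) => //=; rewrite in_itv/= lerNr.
  rewrite -[leRHS]invrK lef_pV2 ?posrE ?invr_gt0 ?oppr_gt0//.
  by have := archi_boundP E0; rewrite -natr1; lra.
exists D; split => // t e e0; rewrite (@mean_ramp_unique _ D L)//; first exact: cL.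
by move=> t' e' e'0; rewrite /cdf_of !DF/= F_le//= L_le_F.
Qed.

(** Truncate the power at level [M]: the error is at most [y ^+ k.+1 / M], which the next moment
    controls uniformly in [n]. Letting [M] grow, monotone convergence gives the moment of [D]. *)
Lemma limit_distribution : exists D,
  [/\ D (@half_line R) = 1%E,
   forall k, int D (fun y => y ^+ k) /\ mean D (fun y => y ^+ k) = m k &
   forall t e, 0 < e -> mean (mu n) (ramp t e) @[n --> \oo] --> mean D (ramp t e)].
Proof.
have [D [D1 Dr]] := limit_distribution_ramp; exists D; split=> // k.
(* The absolute value keeps [h] nonnegative and bounded on the whole line, where weak convergence is
   tested. *)
pose h (M : nat) (y : R) : R := Num.min `|y| M%:R ^+ k.
have h_ge0 M y : 0 <= h M y by rewrite exprn_ge0// le_min normr_ge0/=.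
have h_le M y : h M y <= M%:R ^+ k.
  by apply: lerXn2r; rewrite ?nnegrE ?le_min ?normr_ge0//= ge_min lexx orbT.
have ch M : continuous (h M).
  move=> y; apply: (@continuous_comp _ _ _ (fun y : R => Num.min `|y| M%:R) (fun y => y ^+ k)).
    by apply: continuous_min; [exact: norm_continuous|exact: cst_continuous].
  exact: exprn_continuous.
have mh M : measurable_fun setT (h M) by exact: continuous_measurable_fun.
have hB M y : `|h M y| <= M%:R ^+ k by rewrite ger0_norm.
have ih P M : int P (h M) by apply: (@int_bounded _ _ _ (M%:R ^+ k)).
have cvh M : mean (mu n) (h M) @[n --> \oo] --> mean D (h M).
  exact: (ramp_weak_convergence (B := M%:R ^+ k)).
have dist M : `|m k - mean D (h M.+1)| <= M.+1%:R^-1 * m k.+1.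
  have c1 : `|mean (mu n) (fun y => y ^+ k) - mean (mu n) (h M.+1)| @[n --> \oo] -->
      `|m k - mean D (h M.+1)|.
    by apply: cvg_norm; apply: cvgB; [exact: mom|exact: cvh].
  have c2 : M.+1%:R^-1 * mean (mu n) (fun y => y ^+ k.+1) @[n --> \oo] --> M.+1%:R^-1 * m k.+1.
    by apply: cvgM; [exact: cvg_cst|exact: mom].
  apply: (cvg_le_cvg c1 c2) => n; have [_ ik] := amu n.
  rewrite -meanZ//; apply: mean_dist => //; first exact: intZ.
  move=> y y0; rewrite /h (ger0_norm y0); have [yM|My] := leP y M.+1%:R.
    by rewrite subrr normr0 mulr_ge0 ?exprn_ge0.
  have yk : M.+1%:R ^+ k <= y ^+ k by rewrite lerXn2r ?nnegrE// ltW.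
  rewrite ger0_norm ?subr_ge0// ler_pdivlMl// exprS.
  apply: (@le_trans _ _ (M.+1%:R * y ^+ k)).
    by rewrite ler_pM2l// lerBlDr lerDl exprn_ge0.
  by apply: ler_wpM2r; [exact: exprn_ge0|exact: ltW].
have cm : mean D (h M) @[M --> \oo] --> m k.
  rewrite -cvg_shiftS; apply/cvgrPdist_le => eps eps0; near=> M.
  apply: (le_trans (dist M)); rewrite ler_pdivrMl//.
  rewrite -ler_pdivrMr// -natr1; apply: ltW; apply: (@lt_trans _ _ M%:R); last by rewrite ltrDl.
  by near: M; exact: nbhs_infty_gtr.
have cI : (\int[D]_(y in @half_line R) (h M y)%:E)%E @[M --> \oo] -->
    (\int[D]_(y in @half_line R) (y ^+ k)%:E)%E.
  have -> : (\int[D]_(y in @half_line R) (y ^+ k)%:E)%E =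
      (\int[D]_(y in @half_line R) limn (fun M => (h M y)%:E))%E.
    apply: eq_integral => y /set_mem/half_lineP y0; apply/esym/cvg_lim => //.
    apply: cvg_near_cst; near=> M; rewrite /h ger0_norm// min_l//.
    by near: M; exact: nbhs_infty_ger.
  apply: (@cvg_monotone_convergence _ _ _ D _ (@measurable_half_line R) (fun M y => (h M y)%:E)).
  - by move=> M; apply/measurable_EFinP; exact: measurable_funTS.
  - by move=> M y _; rewrite lee_fin.
  - move=> y _ M N MN; rewrite lee_fin lerXn2r ?nnegrE ?le_min ?normr_ge0//=.
    by rewrite ge_min lexx/= ge_min ler_nat MN orbT.
have hI M : (\int[D]_(y in @half_line R) (h M y)%:E)%E = (mean D (h M))%:E.
  rewrite /mean /Rintegral fineK//; apply: integrable_fin_num; first exact: measurable_half_line.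
  exact: ih.
have IE : (\int[D]_(y in @half_line R) (y ^+ k)%:E)%E = (m k)%:E.
  apply: (@cvg_unique _ (@ereal_hausdorff R) _ _ _ _ cI).
  rewrite /mkset (funext hI); apply: cvg_EFin; last exact: cm.
  by near=> M.
split; last by rewrite /mean /Rintegral IE.
apply/integrableP; split.
  by apply/measurable_EFinP; apply: measurable_funTS; exact: exprn_measurable.
rewrite (_ : integral _ _ _ = (m k)%:E) ?ltry// -IE;
  apply: eq_integral => y /set_mem/half_lineP y0.
by rewrite /= ger0_norm// exprn_ge0.
Unshelve. all: by end_near. Qed.

End limit_distribution.

Section uniqueness.
Variables (m : nat -> R) (rho : R).
Hypothesis rho_gt0 : 0 < rho.
Hypothesis m_le : forall k, m k <= k.+1`!%:R * rho ^+ k.+1.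

(* Interleaving the two laws gives a sequence to which [ramp_cvg] applies. *)
Lemma ramp_determinate D D' : all_moments D -> all_moments D' ->
  (forall k, mean D (fun y => y ^+ k) = m k) ->
  (forall k, mean D' (fun y => y ^+ k) = m k) ->
  forall t e, 0 < e -> mean D (ramp t e) = mean D' (ramp t e).
Proof.
move=> aD aD' mD mD' t e e0; pose mu n := if odd n then D' else D.
have amu n : all_moments (mu n) by rewrite /mu; case: ifP.
have mmu k : mean (mu n) (fun y => y ^+ k) @[n --> \oo] --> m k.
  rewrite (_ : (fun n => _) = (fun=> m k)); first exact: cvg_cst.
  by apply/funext => n; rewrite /mu; case: ifP.
have /cvg_ex[l /= cl] := @ramp_cvg _ _ _ _ amu mmu rho_gt0 m_le t e e0.
apply/eqP; rewrite -subr_eq0 -normr_eq0 eq_le normr_ge0 andbT.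
apply/ler_addgt0Pr => eps eps0; rewrite add0r.
have eps2 : 0 < eps / 2 by rewrite divr_gt0.
have /cvgrPdist_lt/(_ _ eps2)[N _ HN] := cl.
have h1 := HN N.*2; have h2 := HN N.*2.+1.
have /h1 : (N <= N.*2)%N by rewrite -addnn leq_addr.
have /h2 : (N <= N.*2.+1)%N by rewrite -addnn ltnW// ltnS leq_addr.
rewrite /mu /= odd_double/= => d1 d2.
have := ler_distD l (mean D (ramp t e)) (mean D' (ramp t e)).
by rewrite [`|_ - l|]distrC; lra.
Qed.

(** Equal ramp means bound each distribution function at [t] by the other at [t + e]; right
    continuity removes [e], and the roles are symmetric. *)
Lemma moments_determinate D D' : all_moments D -> all_moments D' ->
  (forall k, mean D (fun y => y ^+ k) = m k) ->
  (forall k, mean D' (fun y => y ^+ k) = m k) ->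
  forall A, measurable A -> D' A = D A.
Proof.
move=> aD aD' mD mD'; apply: distribution_unique => t.
have r := ramp_determinate aD aD' mD mD'.
have [D1 _] := aD; have [D'1 _] := aD'.
have fE (P : probability R R) : P `]-oo, t]%classic = (cdf_of P t)%:E.
  by rewrite /cdf_of fineK// fin_num_measure.
have rc (P P' : probability R R) : P (@half_line R) = 1%E -> P' (@half_line R) = 1%E ->
    (forall e, 0 < e -> mean P (ramp t e) = mean P' (ramp t e)) -> cdf_of P t <= cdf_of P' t.
  move=> P1 P'1 H.
  have c : cdf_of P' (t + n.+1%:R^-1) @[n --> \oo] --> cdf_of P' t.
    rewrite /cdf_of; apply: fine_cvg; rewrite fineK ?fin_num_measure//.
    have -> : `]-oo, t]%classic = \bigcap_n `]-oo, t + (n.+1%:R^-1 : R)]%classic.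
      apply/seteqP; split=> y /=.
        by rewrite in_itv/= => yt n _ /=; rewrite in_itv/=; apply: (le_trans yt); rewrite lerDl.
      move=> H1; rewrite in_itv/=; apply/ler_addgt0Pr => eps eps0.
      have E0 : 0 <= eps^-1 by rewrite invr_ge0 ltW.
      have := H1 (Num.bound eps^-1) I; rewrite /= in_itv/= => /le_trans; apply.
      rewrite lerD2l -[leRHS]invrK lef_pV2 ?posrE ?invr_gt0//.
      by have := archi_boundP E0; rewrite -natr1; lra.
    apply: (nonincreasing_cvg_mu (mu := P')) => //.
    - by rewrite -ge0_fin_numE ?fin_num_measure.
    - exact: bigcap_measurable.
    - move=> i j ij; apply/subsetPset/subset_itvl; rewrite bnd_simp lerD2l.
      by rewrite lef_pV2 ?posrE// ler_nat ltnS.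
  apply: (cvgr_to_ge c); near=> n.
  have e0 : 0 < n.+1%:R^-1 :> R by rewrite invr_gt0.
  have /andP[a1 _] := mean_ramp_cdf t P1 e0; have /andP[_ a2] := mean_ramp_cdf t P'1 e0.
  by rewrite H// in a1; exact: le_trans a2.
by rewrite !fE; congr EFin; apply/eqP; rewrite eq_le !rc// => e e0; rewrite r.
Unshelve. all: by end_near. Qed.

(** The sequence has some limit law with the moments [m], which need not be [D] a priori;
    [ramp_determinate] shows that its ramp means are those of [D]. *)
Lemma moments_weak_convergence mu D h (B : R) :
  (forall n, all_moments (mu n)) ->
  (forall k, mean (mu n) (fun y => y ^+ k) @[n --> \oo] --> m k) ->
  all_moments D -> (forall k, mean D (fun y => y ^+ k) = m k) ->
  continuous h -> (forall y, `|h y| <= B) ->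
  mean (mu n) h @[n --> \oo] --> mean D h.
Proof.
move=> amu mmu aD mD ch hB.
have [D' [D'1 D'm D'r]] := limit_distribution amu mmu rho_gt0 m_le.
have aD' : all_moments D' by split=> // k; have [] := D'm k.
have mD' k : mean D' (fun y => y ^+ k) = m k by have [] := D'm k.
apply: (ramp_weak_convergence (B := B)) => //.
- by move=> n; have [] := amu n.
- by have [] := aD.
- by move=> t e e0; rewrite (ramp_determinate aD aD')//; exact: D'r.
Qed.

End uniqueness.
End moment_method.

(** * The moments of the cell as an integral over the power measure *)

Section weighted_measure.
Context d (T : measurableType d) (R : realType).
Variables (m : {sigma_finite_measure set T -> \bar R}) (g : {mfun T >-> R}).
Local Open Scope ereal_scope.

(** The absolute value makes this a measure for every measurable [g], so its instances need no sign
    hypothesis. *)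
Definition weighted (A : set T) : \bar R := \int[m]_(x in A) (`|g x|%R)%:E.

Let mg : measurable_fun setT (fun x => (`|g x|%R)%:E).
Proof. by apply/measurable_EFinP; apply: measurableT_comp. Qed.

Let weighted0 : weighted set0 = 0. Proof. exact: integral_set0. Qed.

Let weighted_ge0 A : 0 <= weighted A.
Proof. by apply: integral_ge0 => x _; rewrite lee_fin. Qed.

Let weighted_sigma_additive : semi_sigma_additive weighted.
Proof.
move=> F mF tF mUF; rewrite /weighted ge0_integral_bigcup//; last first.
  by apply: measurable_funTS.
apply: is_cvg_nneseries => n _ _; exact: weighted_ge0.
Qed.

HB.instance Definition _ := isMeasure.Build _ _ _ weighted
  weighted0 weighted_ge0 weighted_sigma_additive.

Let sigma_finite_weighted : sigma_finite setT weighted.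
Proof.
have /sigma_finiteP[F [FT ndF Foo]] := sigma_finiteT m.
(* A set of finite [m]-measure may have infinite weight, so the exhaustion is also cut where the
   density is large. *)
pose G (k : nat) := [set x | (`|g x| <= k%:R)%R].
have mG k : measurable (G k).
  rewrite (_ : G k = setT `&` [set x | (`|g x|%R)%:E <= (k%:R)%:E]).
    by apply: measurable_lee.
  by rewrite setTI; apply/seteqP; split => x; rewrite /G/= lee_fin.
exists (fun k => F k `&` G k) => [|k].
  apply/esym; rewrite -subTset => x _.
  have [i _ Fi] : (\bigcup_k F k) x by rewrite -FT.
  pose j := Num.bound `|g x|; exists (maxn i j) => //; split.
    by move: Fi; exact/subsetPset/ndF/leq_maxl.
  apply: (@le_trans _ _ j%:R); first by apply: ltW; exact: archi_boundP.
  by rewrite ler_nat leq_maxr.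
have [mF Fk] := Foo k; split; first exact: measurableI.
apply: (@le_lt_trans _ _ (\int[m]_(x in F k `&` G k) (k%:R%:E))).
  apply: ge0_le_integral => //; [exact: measurableI|by apply: measurable_funTS|].
  by move=> x [].
rewrite integral_cst; last exact: measurableI.
apply: lte_mul_pinfty => //; apply: (le_lt_trans _ Fk); apply: le_measure => //.
- by rewrite inE; exact: measurableI.
- by rewrite inE.
Qed.

HB.instance Definition _ := Measure_isSigmaFinite.Build _ _ _
  weighted sigma_finite_weighted.

(* Layer-cake formula on both sides and Tonelli. *)
Lemma integral_weighted (f : T -> \bar R) : measurable_fun setT f ->
  (forall x, 0 <= f x) ->
  \int[weighted]_x f x = \int[m]_x ((`|g x|%R)%:E * f x).
Proof.
move=> mf f0.
pose S := [set p : T * R | 0%:E <= p.2%:E] `&` [set p : T * R | p.2%:E < f p.1].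
have mS : measurable S.
  apply: measurableI.
    rewrite -[X in measurable X]setTI; apply: measurable_lee => //.
    by apply/measurable_EFinP; exact: measurable_snd.
  rewrite -[X in measurable X]setTI; apply: measurable_lte => //.
    by apply/measurable_EFinP; exact: measurable_snd.
  by apply: measurableT_comp => //; exact: measurable_fst.
have mSx x : measurable [set s | S (x, s)].
  rewrite -[X in measurable X]setTI.
  by apply: (measurable_pair1 x) => //; exact: measurableT.
have layer x : f x = \int[lebesgueR]_s (\1_S (x, s))%:E.
  transitivity (lebesgueR [set s | S (x, s)]); last first.
    by rewrite -integral_indicT//; apply: eq_integral => s _; rewrite !indicE !mem_setE.
  rewrite (_ : [set s | S (x, s)] = [set s : R | 0%:E <= s%:E /\ s%:E < f x])//.
  have := f0 x; case: (f x) => [r| |]//; rewrite ?lee_fin => r0.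
    rewrite (_ : mkset _ = `[0%R, r[%classic).
      rewrite /lebesgueR lebesgue_measure_itv/= lte_fin.
      case: ifPn => [_|]; first by rewrite oppr0 adde0.
      by rewrite -leNgt => s0'; congr EFin; apply/eqP; rewrite eq_le r0 s0'.
    apply/seteqP; split => s /=; rewrite !in_itv/= lee_fin lte_fin; first by move=> [-> ->].
    by move=> /andP[-> ->].
  rewrite (_ : mkset _ = `[0%R, +oo[%classic).
    by rewrite /lebesgueR lebesgue_measure_itv/= ltry.
  apply/seteqP; split => s /=; rewrite !in_itv/= lee_fin ltry andbT; first by move=> [->].
  by move=> ->.
have mI : measurable_fun setT (EFin \o (\1_S : T * R -> R)).
  by apply/measurable_EFinP; exact: measurable_indic.
rewrite (eq_integral _ _ (fun x _ => layer x)).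
have mI0 p : 0 <= (EFin \o (\1_S : T * R -> R)) p by rewrite lee_fin.
rewrite (fubini_tonelli (fun p : T * R => (\1_S p)%:E) mI mI0).
transitivity (\int[lebesgueR]_s \int[m]_x ((\1_S (x, s))%:E * (`|g x|%R)%:E)).
  apply: eq_integral => s _.
  have mSs : measurable [set x | S (x, s)].
    rewrite -[X in measurable X]setTI.
    by apply: (measurable_pair2 s) => //; exact: measurableT.
  transitivity (weighted [set x | S (x, s)]).
    by rewrite -integral_indicT//; apply: eq_integral => x _; rewrite /= !indicE !mem_setE.
  by rewrite /weighted -integral_indicM//; apply: eq_integral => x _; rewrite !indicE !mem_setE.
have mIg : measurable_fun setT (fun p : T * R => (\1_S p)%:E * (`|g p.1|%R)%:E).
  by apply: emeasurable_funM => //; apply: (measurableT_comp mg); exact: measurable_fst.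
have mIg0 (p : T * R) : 0 <= (\1_S p)%:E * (`|g p.1|%R)%:E by rewrite mule_ge0// lee_fin.
rewrite -(fubini_tonelli (fun p : T * R => (\1_S p)%:E * (`|g p.1|%R)%:E) mIg mIg0).
apply: eq_integral => x _; rewrite layer /=.
under eq_integral do rewrite muleC.
rewrite ge0_integralZl//.
apply/measurable_EFinP.
have -> : (fun s : R => \1_S (x, s) : R) = \1_[set s | S (x, s)].
  by apply/funext => s; rewrite !indicE; congr (nat_of_bool _)%:R; apply/idP/idP; rewrite !inE.
exact: measurable_indic.
Qed.

End weighted_measure.

Section iid_sample.
Context dO (O : measurableType dO) (R : realType) (P : probability O R).
Context d (T : measurableType d) (m : {sigma_finite_measure set T -> \bar R}).
Variables (n : nat) (X : 'I_n -> {RV P >-> T}).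
Local Open Scope ereal_scope.

Definition sample (w : O) : n.-tuple T := [tuple X i w | i < n].

Lemma measurable_sample : measurable_fun setT sample.
Proof.
apply/measurable_fun_tnthP => i.
by rewrite (_ : _ \o _ = X i)//; apply/funext => w /=; rewrite tnth_mktuple.
Qed.

(** Independence is exactly the product formula on rectangles, which determines the law. [m0] is a
    bare set function because the laws in the theorem are given in that form. *)
Lemma sample_law (m0 : set T -> \bar R) : (forall A, measurable A -> m0 A = m A) ->
  iid P m0 (fun i w => X i w) ->
  forall A, measurable A -> P (sample @^-1` A) = power_measure m n A.
Proof.
move=> m0m [XL XI] A mA; have ms := measurable_sample.
apply: (power_measure_unique (nu := pushforward P sample)) => // B mB.
have := XI [set: 'I_n]%SET B mB; rewrite /pushforward /= => XB.
transitivity (\prod_(i in [set: 'I_n]%SET) P (X i @^-1` B i)).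
  rewrite -XB; congr (P _); apply/seteqP; split => w.
    by move=> H i _; have := H i; rewrite tnth_mktuple.
  by move=> H i; rewrite tnth_mktuple; apply: H; rewrite /= finset.in_setT.
rewrite big_mkcond; apply: eq_bigr => i _; rewrite finset.in_setT -m0m//; exact: XL.
Qed.

Lemma integral_sample (m0 : set T -> \bar R) (F : n.-tuple T -> \bar R) :
  (forall A, measurable A -> m0 A = m A) -> iid P m0 (fun i w => X i w) ->
  measurable_fun setT F -> (forall t, 0 <= F t) ->
  \int[P]_w F (sample w) = \int[power_measure m n]_t F t.
Proof.
move=> m0m XX mF F0; have ms := measurable_sample.
transitivity (\int[pushforward P sample]_t F t).
  by rewrite ge0_integral_pushforward// preimage_setT.
by apply: eq_measure_integral => A mA _; exact: (sample_law m0m).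
Qed.

End iid_sample.

Section measurable_pick.
Context d (T : measurableType d) (R : realType) (I : finType).

(** Split according to the truth values of all [p i t]: there are finitely many patterns, and on
    each the picked index is constant. *)
Lemma measurable_pick (p : I -> T -> bool) (f : I -> T -> R) (c : R) :
  (forall i, measurable_fun setT (p i)) -> (forall i, measurable_fun setT (f i)) ->
  measurable_fun setT (fun t => if [pick i | p i t] is Some i then f i t else c).
Proof.
move=> mp mf.
rewrite (_ : (fun t => _) = (fun t => \sum_(b : {ffun I -> bool})
    ([forall i, p i t == b i]%:R * if [pick i | b i] is Some i then f i t else c))).
  apply: measurable_sum => b; apply: measurable_funM; last by case: pickP.
  apply: measurable_natr_bool; apply: measurable_forall => i.
  rewrite (_ : (fun t => _) = (fun t => if b i then p i t else ~~ p i t)).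
    by case: (b i) => //; exact: measurable_neg.
  by apply/funext => t; case: (b i); case: (p i t).
apply/funext => t; pose b0 := [ffun i => p i t].
rewrite (bigD1 b0)//= big1 => [|b bb0].
  rewrite addr0 (_ : [forall i, _]); last by apply/forallP => i; rewrite ffunE.
  by rewrite mul1r (eq_pick (Q := b0))// => i; rewrite /b0 ffunE.
rewrite (_ : [forall i, _] = false) ?mul0r//; apply/negbTE/negP => /forallP H.
by case/eqP: bb0; apply/ffunP => i; rewrite ffunE (eqP (H i)).
Qed.

End measurable_pick.

Section sections.
Context d1 d2 (T1 : measurableType d1) (T2 : measurableType d2) (R : realType).
Local Open Scope ereal_scope.

Lemma measurable_set_bool d (T : measurableType d) (b : T -> bool) :
  measurable_fun setT b -> measurable [set t | b t].
Proof. by move=> mb; rewrite -[X in measurable X]setTI; exact: mb. Qed.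

Lemma measurable_bool_setl (b : T1 -> T2 -> bool) :
  measurable_fun setT (fun p => b p.1 p.2) -> forall t, measurable [set q | b t q].
Proof.
move=> mb t; apply: measurable_set_bool.
by apply: (measurableT_comp mb (g := fun q => (t, q))); exact: measurable_pair1.
Qed.

Lemma measurable_section_measure (m : {sigma_finite_measure set T2 -> \bar R})
    (b : T1 -> T2 -> bool) : measurable_fun setT (fun p => b p.1 p.2) ->
  measurable_fun setT (fun t => m [set q | b t q]).
Proof.
move=> mb; have mS := measurable_set_bool mb.
rewrite (_ : (fun t => _) = m \o xsection [set p | b p.1 p.2]).
  exact: measurable_fun_xsection.
by apply/funext => t /=; congr (m _); apply/seteqP; split => q; rewrite /xsection/= inE.
Qed.

End sections.

(** * The mass of the cell *)

Section voronoi_moment.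
Context (R : realType) (d : nat).
Local Notation vec := (d.-tuple R).
Variables (mu : {sigma_finite_measure set vec -> \bar R}) (x : vec).
Local Open Scope ereal_scope.
Hypothesis mu1 : mu setT = 1.
Hypothesis mu_sphere : forall s : R, mu (euclidean_dist x @^-1` [set s]) = 0.

Definition in_cell n (t : n.-tuple vec) (i : 'I_n) (q : vec) : bool :=
  [forall j, euclidean_dist q (tnth t i) <= euclidean_dist q (tnth t j)]%R.

Lemma voronoi_cellE n (t : n.-tuple vec) i :
  voronoi_cell (tnth t) i = [set q | in_cell t i q].
Proof.
apply/seteqP; split => q /= H; last by move=> j _; exact: (forallP H).
by apply/forallP => j; have [->|] := eqVneq j i; [exact: lexx|exact: H].
Qed.

Lemma measurable_in_cell n (i : 'I_n) :
  measurable_fun setT (fun p : n.-tuple vec * vec => in_cell p.1 i p.2).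
Proof.
apply: measurable_forall => j; apply: measurable_fun_ler; apply: measurable_dist => //;
  by apply: (measurableT_comp (measurable_tnth _)); exact: measurable_fst.
Qed.

(** The head is a nucleus and the other entries are test points. A sample point at [q] in the region
    would be strictly closer than the nucleus to [x] or to a test point, that is, would take one of
    them out of its cell. *)
Definition in_region k (p : k.+1.-tuple vec) (q : vec) : bool :=
  (euclidean_dist x q < euclidean_dist x (thead p))%R ||
  [exists i : 'I_k, euclidean_dist (tnth p (lift ord0 i)) q <
                    euclidean_dist (tnth p (lift ord0 i)) (thead p)]%R.

Definition region k (p : k.+1.-tuple vec) : set vec := [set q | in_region p q].

Lemma in_regionC k (p : k.+1.-tuple vec) q : ~~ in_region p q =
  (euclidean_dist x (thead p) <= euclidean_dist x q)%R &&
  [forall i : 'I_k, euclidean_dist (tnth p (lift ord0 i)) (thead p) <=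
                    euclidean_dist (tnth p (lift ord0 i)) q]%R.
Proof.
by rewrite negb_or negb_exists -leNgt; congr andb; apply: eq_forallb => i; rewrite -leNgt.
Qed.

Lemma measurable_in_region k :
  measurable_fun setT (fun p : k.+1.-tuple vec * vec => in_region p.1 p.2).
Proof.
(* The complement is a conjunction over the indices, to which [measurable_forall] applies. *)
rewrite (_ : (fun p => _) = (fun p : k.+1.-tuple vec * vec => ~~ (
  (euclidean_dist x (thead p.1) <= euclidean_dist x p.2)%R &&
  [forall i : 'I_k, euclidean_dist (tnth p.1 (lift ord0 i)) (thead p.1) <=
                    euclidean_dist (tnth p.1 (lift ord0 i)) p.2]%R))); last first.
  by apply/funext => p; rewrite -in_regionC negbK.
have mt i : measurable_fun setT (fun p : k.+1.-tuple vec * vec => tnth p.1 i).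
  by apply: (measurableT_comp (measurable_tnth i)); exact: measurable_fst.
apply: measurable_neg; apply: measurable_and.
  by apply: measurable_fun_ler; apply: measurable_dist => //; exact: mt.
apply: measurable_forall => i.
by apply: measurable_fun_ler; apply: measurable_dist => //; exact: mt.
Qed.

Lemma measurable_region k (p : k.+1.-tuple vec) : measurable (region p).
Proof. exact: (measurable_bool_setl (@measurable_in_region k)). Qed.

Lemma measurable_mu_region k : measurable_fun setT (fun p : k.+1.-tuple vec => mu (region p)).
Proof. exact: (measurable_section_measure _ (@measurable_in_region k)). Qed.

Lemma mu_le1 A : measurable A -> mu A <= 1.
Proof. by move=> mA; rewrite -mu1; apply: le_measure; rewrite ?inE. Qed.

Lemma mu_fin_num A : measurable A -> mu A \is a fin_num.
Proof. by move=> mA; rewrite ge0_fin_numE//; exact: (le_lt_trans (mu_le1 mA) (ltry 1)). Qed.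

Lemma fine_mu01 A : measurable A -> (0 <= fine (mu A) <= 1)%R.
Proof.
move=> mA; rewrite fine_ge0//=; rewrite -lee_fin fineK; first exact: mu_le1.
exact: mu_fin_num.
Qed.

Lemma mu_setC A : measurable A -> fine (mu (~` A)) = (1 - fine (mu A))%R.
Proof.
move=> mA; have mC := measurableC mA.
have H : mu (A `|` ~` A) = mu A + mu (~` A) by rewrite measureU// setICr.
move: H; rewrite setUCr mu1 -[mu A]fineK ?mu_fin_num// -[mu (~` A)]fineK ?mu_fin_num//.
by rewrite -EFinD => -[->]/=; rewrite addrC addKr.
Qed.

Definition cell_mass n (t : n.-tuple vec) : R := fine (mu (voronoi_cell_at (tnth t) x)).

Lemma cell_massE n (t : n.-tuple vec) : cell_mass t =
  if [pick i | in_cell t i x] is Some i then fine (mu [set q | in_cell t i q]) else 0%R.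
Proof.
rewrite /cell_mass /voronoi_cell_at (eq_pick (Q := fun i => in_cell t i x)).
  by case: pickP => [i _|_]; rewrite ?voronoi_cellE// measure0.
by move=> i; rewrite voronoi_cellE; apply/idP/idP; rewrite inE.
Qed.

Lemma measurable_cell n (t : n.-tuple vec) i : measurable [set q | in_cell t i q].
Proof. exact: (measurable_bool_setl (b := fun t q => in_cell t i q) (measurable_in_cell i)
  t). Qed.

Lemma measurable_mu_cell n (i : 'I_n) :
  measurable_fun setT (fun t : n.-tuple vec => fine (mu [set q | in_cell t i q])).
Proof.
apply: (measurableT_comp (fine_measurable measurableT)).
exact: (measurable_section_measure _ (@measurable_in_cell n i)).
Qed.

Lemma measurable_cell_x n (i : 'I_n) :
  measurable_fun setT (fun t : n.-tuple vec => in_cell t i x).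
Proof.
apply: (measurableT_comp (@measurable_in_cell n i) (g := fun t => (t, x))).
exact: measurable_pair2.
Qed.

Lemma measurable_cell_mass n : measurable_fun setT (@cell_mass n).
Proof.
rewrite (_ : @cell_mass n = (fun t => if [pick i | in_cell t i x] is Some i
  then fine (mu [set q | in_cell t i q]) else 0%R)); last exact/funext/cell_massE.
apply: measurable_pick => i; [exact: measurable_cell_x|exact: measurable_mu_cell].
Qed.

Lemma cell_mass01 n (t : n.-tuple vec) : (0 <= cell_mass t <= 1)%R.
Proof.
rewrite cell_massE; case: pickP => [i _|_]; last by rewrite lexx ler01.
by apply: fine_mu01; exact: measurable_cell.
Qed.

Definition ties n : set (n.-tuple vec) :=
  \bigcup_(ij in [set ij : 'I_n * 'I_n | ij.1 != ij.2])
    [set t | euclidean_dist x (tnth t ij.1) = euclidean_dist x (tnth t ij.2)].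

Lemma measurable_tie n (i j : 'I_n) : measurable
  [set t : n.-tuple vec | euclidean_dist x (tnth t i) = euclidean_dist x (tnth t j)].
Proof.
rewrite (_ : mkset _ = [set t : n.-tuple vec | euclidean_dist x (tnth t i) ==
  euclidean_dist x (tnth t j)]).
  by apply: measurable_set_bool; apply: measurable_fun_eqr; apply: measurable_dist => //;
    exact: measurable_tnth.
by apply/seteqP; split => t /eqP.
Qed.

Lemma measurable_ties n : measurable (@ties n).
Proof.
by apply: fin_bigcup_measurable => // -[i j] _; exact: measurable_tie.
Qed.

Lemma power_ties0 n : power_measure mu n (@ties n) = 0.
Proof.
apply/negligibleP; first exact: measurable_ties.
rewrite /ties bigcup_fset_set; last exact: finite_finset.
rewrite big_seq; apply: big_ind; [exact: negligible_set0|exact: negligibleU|].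
move=> [i j]; rewrite in_fset_set; last exact: finite_finset.
move=> /set_mem/= ij; apply/negligibleP; first exact: measurable_tie.
apply: (power_ties (g := euclidean_dist x)) => //.
exact: measurable_dist.
Qed.

(** Without ties exactly one cell contains [x]. The picked cell thus becomes a sum that is symmetric
    in the sample points, whereas the choice by smallest index is not. *)
Lemma cell_mass_sum n k (t : n.+1.-tuple vec) : ~ @ties n.+1 t ->
  (cell_mass t ^+ k = \sum_(i < n.+1) (in_cell t i x)%:R * fine (mu [set q | in_cell t i q])
    ^+ k)%R.
Proof.
move=> nt; rewrite cell_massE; case: pickP => [i ix|none]; last first.
  have [i _ Hi] := @arg_minP _ _ _ ord0 xpredT (fun i => euclidean_dist x (tnth t i)) isT.
  by have := none i; rewrite (_ : in_cell t i x)//; apply/forallP => j; exact: Hi.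
rewrite (bigD1 i)//= ix mul1r big1 ?addr0// => j ji.
rewrite (_ : in_cell t j x = false) ?mul0r//; apply/negbTE/negP => jx.
apply: nt; exists (i, j); first by rewrite /= eq_sym.
by apply/eqP; rewrite eq_le (forallP ix) (forallP jx).
Qed.

Lemma measurable_nearest_cell n k (i : 'I_n) : measurable_fun setT
  (fun t : n.-tuple vec => ((in_cell t i x)%:R * fine (mu [set q | in_cell t i q]) ^+ k)%:E).
Proof.
apply/measurable_EFinP; apply: measurable_funM.
  by apply: measurable_natr_bool; exact: measurable_cell_x.
by apply: measurable_funX; exact: measurable_mu_cell.
Qed.

Lemma nearest_cell_sym n k (i : 'I_n.+1) :
  \int[power_measure mu n.+1]_t
    ((in_cell t i x)%:R * fine (mu [set q | in_cell t i q]) ^+ k)%:E =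
  \int[power_measure mu n.+1]_t
    ((in_cell t ord0 x)%:R * fine (mu [set q | in_cell t ord0 q]) ^+ k)%:E.
Proof.
rewrite -(integral_power_reindex mu (tperm i ord0)); last 2 first.
- exact: measurable_nearest_cell.
- by move=> t; rewrite lee_fin mulr_ge0 ?exprn_ge0 ?fine_ge0.
apply: eq_integral => t _.
have E q : in_cell (tuple_reindex (tperm i ord0) t) i q = in_cell t ord0 q.
  apply/forallP/forallP => H j.
    by have := H (tperm i ord0 j); rewrite !tnth_mktuple tpermL tpermK.
  by rewrite !tnth_mktuple tpermL; exact: H.
by rewrite E; congr (_ * fine (mu _) ^+ _)%:E; apply/seteqP; split => q; rewrite /= E.
Qed.

Lemma prod_fine n (F : 'I_n -> \bar R) (a : R) : (forall i, F i = a%:E) ->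
  \prod_(i < n) F i = (a ^+ n)%:E.
Proof.
move=> FE; elim: n F FE => [|n IH] F FE; first by rewrite big_ord0.
by rewrite big_ord_recl FE IH// exprS EFinM.
Qed.

(* Expand [mu(cell)^k] as the probability that [k] further points fall in the
   cell of [y], then integrate the other sample points first. *)
Lemma nearest_cell_integral n k :
  \int[power_measure mu n.+1]_t
    ((in_cell t ord0 x)%:R * fine (mu [set q | in_cell t ord0 q]) ^+ k)%:E =
  \int[power_measure mu k.+1]_p ((1 - fine (mu (region p))) ^+ n)%:E.
Proof.
rewrite integral_powerS; [|exact: measurable_nearest_cell|]; last first.
  by move=> t; rewrite lee_fin mulr_ge0 ?exprn_ge0 ?fine_ge0.
rewrite integral_powerS; last 2 first.
- apply/measurable_EFinP; apply: measurable_funX; apply: measurable_funB => //.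
  by apply: (measurableT_comp (fine_measurable measurableT)); exact: measurable_mu_region.
- move=> p; rewrite lee_fin exprn_ge0// subr_ge0.
  by have /andP[] := fine_mu01 (measurable_region p).
apply: eq_integral => y _.
pose b (s : n.-tuple vec) (z : k.-tuple vec) : bool :=
  [forall j : 'I_n, ~~ in_region (cons_tuple y z) (tnth s j)].
have mb : measurable_fun setT (fun p : n.-tuple vec * k.-tuple vec => b p.1 p.2).
  apply: measurable_forall => j; apply: measurable_neg.
  apply: (measurableT_comp (@measurable_in_region k)
    (g := fun p : n.-tuple vec * k.-tuple vec => (cons_tuple y p.2, tnth p.1 j))).
  apply: measurable_fun_pair.
    by apply: (measurableT_comp (measurable_fun_consl y)); exact: measurable_snd.
  by apply: (measurableT_comp (measurable_tnth j)); exact: measurable_fst.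
have bP s z : b s z = in_cell (cons_tuple y s) ord0 x &&
    [forall i, in_cell (cons_tuple y s) ord0 (tnth z i)].
  apply/forallP/andP => [H|[/forallP H1 /forallP H2] j].
    split.
      apply/forallP => j; case: (unliftP ord0 j) => [j' ->|->]; last exact: lexx.
      by have := H j'; rewrite in_regionC tnth0 tnthS theadE => /andP[].
    apply/forallP => i; apply/forallP => j; case: (unliftP ord0 j) => [j' ->|->];
      last exact: lexx.
    by have := H j'; rewrite in_regionC tnth0 tnthS theadE => /andP[_ /forallP/(_ i)];
      rewrite tnthS.
  rewrite in_regionC theadE; apply/andP; split.
    by have := H1 (lift ord0 j); rewrite tnth0 tnthS.
  apply/forallP => i; have /forallP/(_ (lift ord0 j)) := H2 i.
  by rewrite tnth0 !tnthS.
transitivity (\int[power_measure mu n]_s \int[power_measure mu k]_z (b s z)%:R%:E).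
  apply: eq_integral => s _.
  pose C := [set q | in_cell (cons_tuple y s) ord0 q].
  have mC : measurable C by exact: measurable_cell.
  transitivity (\int[power_measure mu k]_z (\1_[set z | b s z] z)%:E); last first.
    by apply: eq_integral => z _; rewrite indicE mem_setE.
  rewrite integral_indicT; last exact: (measurable_bool_setl mb).
  have [xC|xC] := boolP (in_cell (cons_tuple y s) ord0 x); last first.
    rewrite mul0r (_ : [set z | _] = set0) ?measure0//.
    by apply/seteqP; split => // z /=; rewrite bP (negbTE xC).
  rewrite mul1r (_ : [set z | _] = rect (fun=> C)); last first.
    apply/seteqP; split => z /=; first by rewrite bP => /andP[_ /forallP H] i; exact: H.
    by move=> H; rewrite bP xC; apply/forallP => i; exact: H.
  rewrite -(prod_fine (n := k) (F := fun=> mu C)); last by move=> i; rewrite fineK// mu_fin_num.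
  by apply/esym; exact: power_rect.
rewrite (fubini_tonelli (fun p : n.-tuple vec * k.-tuple vec => (b p.1 p.2)%:R%:E))//; last first.
  by apply/measurable_EFinP; exact: measurable_natr_bool.
apply: eq_integral => z _.
pose C := ~` region (cons_tuple y z).
have mC : measurable C by apply: measurableC; exact: measurable_region.
rewrite -(mu_setC (measurable_region (cons_tuple y z))).
transitivity (\int[power_measure mu n]_s (\1_(rect (fun=> C)) s)%:E).
  apply: eq_integral => s _; rewrite indicE; congr (nat_of_bool _)%:R%:E.
  apply/forallP/idP => [H|]; first by rewrite inE => j; apply/negP; exact: H.
  by rewrite inE => H j; apply/negP; exact: H.
rewrite integral_indicT; last exact: measurable_rect.
rewrite -(prod_fine (n := n) (F := fun=> mu C)); last by move=> i; rewrite fineK// mu_fin_num.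
exact: power_rect.
Qed.

Lemma sume_const n (c : \bar R) : 0 <= c -> \sum_(i < n) c = (n%:R)%:E * c.
Proof.
move=> c0; elim: n => [|n IH]; first by rewrite big_ord0 mul0e.
by rewrite big_ord_recr/= IH -natr1 EFinD ge0_muleDl ?lee_fin// mul1e.
Qed.

(** Almost surely the power is a sum over the possible nuclei, and by exchangeability its [n.+1]
    terms have the same integral. *)
Lemma voronoi_moment n k :
  \int[power_measure mu n.+1]_t (cell_mass t ^+ k)%:E =
  (n.+1%:R)%:E * \int[power_measure mu k.+1]_p ((1 - fine (mu (region p))) ^+ n)%:E.
Proof.
transitivity (\int[power_measure mu n.+1]_t (\sum_(i < n.+1)
    ((in_cell t i x)%:R * fine (mu [set q | in_cell t i q]) ^+ k)%:E)).
  apply: ge0_ae_eq_integral => //.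
  - by apply/measurable_EFinP; apply: measurable_funX; exact: measurable_cell_mass.
  - by apply: emeasurable_sum => i; exact: measurable_nearest_cell.
  - by move=> t _; rewrite lee_fin exprn_ge0//; have /andP[] := cell_mass01 t.
  - by move=> t _; apply: sume_ge0 => i _; rewrite lee_fin mulr_ge0 ?exprn_ge0 ?fine_ge0.
  exists (@ties n.+1); split; [exact: measurable_ties|exact: power_ties0|].
  move=> t /= H; apply: contrapT => nt; apply: H => _.
  by rewrite cell_mass_sum// sumEFin.
rewrite ge0_integral_sum//; last 2 first.
- by move=> i; exact: measurable_nearest_cell.
- by move=> i t _; rewrite lee_fin mulr_ge0 ?exprn_ge0 ?fine_ge0.
under eq_bigr do rewrite nearest_cell_sym nearest_cell_integral.
apply: sume_const; apply: integral_ge0 => p _; rewrite lee_fin exprn_ge0// subr_ge0.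
by have /andP[] := fine_mu01 (measurable_region p).
Qed.

End voronoi_moment.

(** * Rescaling at a Lebesgue point *)

Section region_geometry.
Context (R : realType) (d : nat) (d_gt0 : (0 < d)%N).
Local Notation vec := (d.-tuple R).
Local Notation leb := (@lebesgue_tuple R d).
Implicit Types (x y z q : vec) (r : R).

(** The centres are within [s] of [x] and the radii are below [2 * s]. *)
Lemma region_sub_ball x k (p : k.+1.-tuple vec) s :
  (forall i, euclidean_dist x (tnth p i) < s) -> region x p `<=` eball x (3 * s).
Proof.
move=> ps q /orP[h|/existsP[i h]]; rewrite /eball/=.
  by have := ps ord0; have := dist_ge0 x (thead p); rewrite -[tnth p ord0]/(thead p); lra.
have t1 := dist_triangle (tnth p (lift ord0 i)) x q.
have t2 := dist_triangle x (tnth p (lift ord0 i)) (thead p).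
rewrite [euclidean_dist (tnth p (lift ord0 i)) x]distC in t2.
have := ps ord0; have := ps (lift ord0 i); rewrite -[tnth p ord0]/(thead p); lra.
Qed.

Lemma largest_coordinate x z : exists j : 'I_d,
  euclidean_dist x z <= d%:R * `|tnth z j - tnth x j|.
Proof.
have [j _ jP] := @arg_maxP _ _ _ (Ordinal d_gt0) xpredT (fun j => `|tnth z j - tnth x j|) isT.
exists j; apply: dist_le_coord => // i; rewrite [leLHS]distrC; exact: jP.
Qed.

(* Moving from [x] towards the far point along its largest coordinate enters the
   ball that the far point contributes to the region. *)
Lemma region_contains_ball x k (p : k.+1.-tuple vec) (i : 'I_k.+1) r : 0 < r ->
  (3 * d%:R + 1) ^+ 2 * r <= euclidean_dist x (tnth p i) ->
  exists2 c, euclidean_dist x c <= 3 * d%:R * r & eball c r `<=` region x p.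
Proof.
move=> r0 far; have D1 : 1 <= d%:R :> R by rewrite ler1n.
have [ry|yr] := leP r (euclidean_dist x (thead p)).
  exists x; first by rewrite distxx !mulr_ge0// ltW.
  by move=> q h; apply/orP; left; exact: lt_le_trans ry.
case: (unliftP ord0 i) far => [i' ->|->] far; last first.
  by move: far; rewrite -[tnth p ord0]/(thead p) => far; exfalso; nra.
set z := tnth p (lift ord0 i') in far *.
have [j jP] := largest_coordinate x z.
(* Moving by [K] changes the squared distance to [z] by [- 2 K |v| + K^2]. Since |v| is at least
   dist(x, z) / d, the first term gains 6 r dist(x, z), and the hypothesis [far] bounds [K^2] by r
   dist(x, z). The net gain of 5 exceeds the 4 needed to come closer by [2 * r]. *)
pose v := tnth z j - tnth x j; pose K : R := 3 * d%:R * r.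
have K0 : 0 <= K by rewrite !mulr_ge0// ltW.
have v0 : v != 0.
  apply/eqP => v0; move: jP; rewrite -/v v0 normr0 mulr0 => jP.
  have H : 0 < (3 * d%:R + 1) ^+ 2 * r by rewrite mulr_gt0// exprn_gt0//; lra.
  by move: H; lra.
pose c : vec := [tuple tnth x l + (l == j)%:R * (K * Num.sg v) | l < d].
have cE l : tnth c l = tnth x l + (l == j)%:R * (K * Num.sg v) by rewrite tnth_mktuple.
have sg2 : Num.sg v * Num.sg v = 1 by rewrite -expr2 sqr_sg v0.
have xc : euclidean_dist x c = K.
  apply: (@pexpIrn _ 2); rewrite ?nnegrE ?dist_ge0// dist_sqr (bigD1 j)//= big1 ?addr0 => [|l lj].
    rewrite cE eqxx mul1r; transitivity (K ^+ 2 * (Num.sg v * Num.sg v)); first by ring.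
    by rewrite sg2 mulr1.
  by rewrite cE (negbTE lj) mul0r addr0 subrr expr0n.
have zc2 : euclidean_dist z c ^+ 2 = euclidean_dist x z ^+ 2 - 2 * K * `|v| + K ^+ 2.
  rewrite !dist_sqr [in LHS](bigD1 j)//= [in RHS](bigD1 j)//=.
  rewrite (eq_bigr (fun l => (tnth x l - tnth z l) ^+ 2)); last first.
    by move=> l lj; rewrite cE (negbTE lj) mul0r addr0 -sqrrN opprB.
  rewrite cE eqxx mul1r normrEsg -(sqrrN (tnth x j - _)) opprB -/v.
  rewrite [X in _ = _ + X](_ : _ = K ^+ 2 * (Num.sg v * Num.sg v)); last by rewrite sg2 mulr1.
  by rewrite (_ : tnth z j - _ = v - K * Num.sg v); [ring|rewrite /v; ring].
have far' : 2 * r <= euclidean_dist x z by nra.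
have zc : euclidean_dist z c <= euclidean_dist x z - 2 * r.
  rewrite -(@ler_pXn2r _ 2)// ?nnegrE ?dist_ge0 ?subr_ge0// zc2.
  rewrite -/v in jP.
  have h1 : 6 * r * euclidean_dist x z <= 2 * K * `|v| by rewrite /K; nra.
  have h2 : K ^+ 2 <= r * euclidean_dist x z.
    by rewrite /K; apply: (@le_trans _ _ (r * ((3 * d%:R + 1) ^+ 2 * r))); [nra|rewrite ler_pM2l].
  nra.
exists c; first by rewrite xc.
move=> q cq; apply/orP; right; apply/existsP; exists i'; rewrite -/z.
have t1 := dist_triangle c z q; have t2 := dist_triangle (thead p) x z.
rewrite [euclidean_dist (thead p) z]distC in t2.
by rewrite /eball/= in cq; lra.
Qed.

Lemma leb_region_fin x k (p : k.+1.-tuple vec) :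
  leb (region x p) \is a fin_num.
Proof.
pose s := 1 + \sum_(i < k.+1) euclidean_dist x (tnth p i).
have ps i : euclidean_dist x (tnth p i) < s.
  rewrite /s (bigD1 i)//=; have : 0 <= \sum_(j < k.+1 | j != i) euclidean_dist x (tnth p j).
    by apply: sumr_ge0 => j _; exact: dist_ge0.
  lra.
have s0 : 0 <= 3 * s by rewrite mulr_ge0// (le_trans (dist_ge0 x (tnth p ord0)))// ltW.
rewrite ge0_fin_numE//; apply: (@le_lt_trans _ _ (leb (eball x (3 * s)))).
  by apply: le_measure; rewrite ?inE; [exact: measurable_region|exact: measurable_eball|exact:
    region_sub_ball].
by rewrite (leb_ball d_gt0)// ltry.
Qed.

Definition region_volume x k (p : k.+1.-tuple vec) : R := fine (leb (region x p)).

Lemma region_volumeE x k (p : k.+1.-tuple vec) :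
  (region_volume x p)%:E = leb (region x p).
Proof. by rewrite fineK// leb_region_fin. Qed.

Lemma measurable_region_volume x k : measurable_fun setT (@region_volume x k).
Proof.
apply: (measurableT_comp (fine_measurable measurableT)).
exact: measurable_mu_region.
Qed.

Lemma region_volume_ge0 x k (p : k.+1.-tuple vec) : 0 <= region_volume x p.
Proof. exact: fine_ge0. Qed.

(** Membership of the region only compares distances, so [S] carries one region onto the other. The
    base point may move, as the blow-up at [x] requires. *)
Lemma region_volume_map x x' r (S : vec -> vec) k (p : k.+1.-tuple vec) :
  0 < r -> measurable_fun setT S -> S x = x' ->
  (forall a b, euclidean_dist (S a) (S b) = r * euclidean_dist a b) ->
  (forall f : vec -> \bar R, measurable_fun setT f -> (forall y, (0 <= f y)%E) ->
    (\int[leb]_y f y = (r ^+ d)%:E * \int[leb]_y f (S y))%E) ->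
  region_volume x' (tuple_map (fun=> S) p) = r ^+ d * region_volume x p.
Proof.
move=> r0 mS <- SS SE; apply: EFin_inj; rewrite EFinM !region_volumeE.
rewrite -integral_indicT; last exact: measurable_region.
rewrite SE => [||y]; [|apply/measurable_EFinP/measurable_indic;
  exact: measurable_region|by rewrite lee_fin].
rewrite -integral_indicT; last exact: measurable_region.
congr (_ * _)%E; apply: eq_integral => q _; rewrite !indicE; congr (nat_of_bool _)%:R%:E.
have E : in_region (S x) (tuple_map (fun=> S) p) (S q) = in_region x p q.
  have tE : thead (tuple_map (fun=> S) p) = S (thead p) by rewrite /thead tnth_mktuple.
  rewrite /in_region tE !SS ltr_pM2l//; congr orb.
  by apply: eq_existsb => i; rewrite tnth_mktuple !SS ltr_pM2l.
by apply/idP/idP; rewrite !inE /region/= E.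
Qed.

End region_geometry.

Section power_scale.
Context d (T : measurableType d) (R : realType).
Local Open Scope ereal_scope.

Lemma integral_power_scale (m m' : {sigma_finite_measure set T -> \bar R}) (c : R) :
  (0 <= c)%R ->
  (forall f : T -> \bar R, measurable_fun setT f -> (forall x, 0 <= f x) ->
     \int[m]_x f x = c%:E * \int[m']_x f x) ->
  forall n (F : n.-tuple T -> \bar R), measurable_fun setT F -> (forall t, 0 <= F t) ->
  \int[power_measure m n]_t F t = (c ^+ n)%:E * \int[power_measure m' n]_t F t.
Proof.
move=> c0 mE n F mF F0; rewrite (integral_power_image (m' := m') (phi := fun=> id) c0)//.
  congr (_ * _); apply: eq_integral => t _; congr F.
  by apply: eq_from_tnth => i; rewrite tnth_mktuple.
Qed.

Lemma integral_weighted_cst (m : {sigma_finite_measure set T -> \bar R}) (c : R)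
    (f : T -> \bar R) : (0 <= c)%R -> measurable_fun setT f -> (forall x, 0 <= f x) ->
  \int[weighted m (cst c)]_x f x = c%:E * \int[m]_x f x.
Proof.
move=> c0 mf f0; rewrite integral_weighted//= ger0_norm// ge0_integralZl//.
Qed.

End power_scale.

(** * Mass near a Lebesgue point *)

Section lebesgue_point.
Context (R : realType) (d : nat) (d_gt0 : (0 < d)%N).
Local Notation vec := (d.-tuple R).
Local Notation leb := (@lebesgue_tuple R d).
Variables (f : {mfun vec >-> R}) (x : vec).
Hypothesis f_ge0 : forall y, 0 <= f y.
Hypothesis fx_gt0 : 0 < f x.
Hypothesis lp : lebesgue_point f x.
Local Notation mu := (weighted leb f).
Hypothesis mu1 : mu setT = 1%E.
Local Notation kappa := (ball_volume R d).
Local Open Scope ereal_scope.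

Definition oscillation (s : R) : \bar R :=
  \int[leb]_(u in eball x s) (`|f u - f x|%R)%:E.

Let mosc : measurable_fun setT (fun u => (`|f u - f x|%R)%:E).
Proof.
by apply/measurable_EFinP; apply: measurableT_comp => //; exact: measurable_funB.
Qed.

Lemma oscillation_small (e : R) : (0 < e)%R ->
  exists2 rho : R, (0 < rho)%R &
    forall s, (0 < s < rho)%R -> oscillation s <= (e * s ^+ d)%:E.
Proof.
move=> e0; have kp := @ball_volume_gt0 R d d_gt0.
have /fine_cvgP[/= Hfin Hcv] := lp.
have ek : (0 < e / kappa)%R by rewrite divr_gt0.
have /cvgrPdist_lt/(_ _ ek) Hc := Hcv.
have /nbhs_ballP[rho /= rho0 Hrho] : \forall s \near (0 : R)^'+,
    oscillation s <= (e * s ^+ d)%:E.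
  near=> s.
  have s0 : (0 < s)%R by near: s; exact: nbhs_right_gt.
  have H1 : (fine (leb (eball x s)))^-1%:E * oscillation s \is a fin_num by near: s.
  have H2 : (`|0 - fine ((fine (leb (eball x s)))^-1%:E * oscillation s)| < e / kappa)%R by
    near: s.
  rewrite sub0r normrN in H2; have H3 := le_lt_trans (ler_norm _) H2.
  rewrite -lte_fin fineK// (leb_ball d_gt0) ?ltW//= in H3.
  have b0 : (0 < kappa * s ^+ d)%R by rewrite mulr_gt0// exprn_gt0.
  move: H3; rewrite lte_pdivrMl// => /ltW; rewrite -EFinM.
  by rewrite (_ : kappa * s ^+ d * (e / kappa) = e * s ^+ d)%R//; field; rewrite gt_eqF.
exists rho => // s /andP[s0 sr]; apply: (Hrho s) => //=.
by rewrite /ball/= sub0r normrN gtr0_norm.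
Unshelve. all: by end_near. Qed.

(** Pointwise, [h] times the difference of [f u] and [f x] is at most [|f u - f x|] on the ball. Two
    additive bounds avoid subtracting extended reals. *)
Lemma near_density (h : vec -> \bar R) s : measurable_fun setT h ->
  (forall u, 0 <= h u <= (\1_(eball x s) u)%:E) ->
  \int[mu]_u h u <= (f x)%:E * \int[leb]_u h u + oscillation s /\
  (f x)%:E * \int[leb]_u h u <= \int[mu]_u h u + oscillation s.
Proof.
move=> mh h1; have h0 u : 0 <= h u by have /andP[] := h1 u.
have mB : measurable (eball x s) by exact: measurable_eball.
rewrite integral_weighted// -ge0_integralZl//; last by rewrite lee_fin ltW.
have oscE : oscillation s = \int[leb]_u ((\1_(eball x s) u)%:E * (`|f u - f x|%R)%:E).
  by rewrite integral_indicM.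
have mo : measurable_fun setT (fun u => (\1_(eball x s) u)%:E * (`|f u - f x|%R)%:E).
  by apply: emeasurable_funM => //; apply/measurable_EFinP/measurable_indic.
have o0 u : 0 <= (\1_(eball x s) u)%:E * (`|f u - f x|%R)%:E by rewrite mule_ge0// lee_fin.
have mfh : measurable_fun setT (fun u => (`|f u|%R)%:E * h u).
  by apply: emeasurable_funM => //; apply/measurable_EFinP; exact: measurableT_comp.
have mah : measurable_fun setT (fun u => (f x)%:E * h u) by exact: measurable_funeM.
have hfin u : h u \is a fin_num.
  by rewrite ge0_fin_numE//; have /andP[_ /le_lt_trans] := h1 u; apply; exact: ltry.
have hr u : exists2 c : R, h u = c%:E & (0 <= c <= \1_(eball x s) u)%R.
  by exists (fine (h u)); [rewrite fineK|rewrite -!lee_fin fineK].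
split.
  rewrite oscE -ge0_integralD//; last by move=> u _; rewrite mule_ge0// lee_fin ltW.
  apply: le_integralT => //; first exact: emeasurable_funD.
    by move=> u; rewrite mule_ge0// lee_fin.
  move=> u; have [c -> /andP[c0 c1]] := hr u; rewrite -!EFinM -EFinD lee_fin (ger0_norm (f_ge0
    u)).
  have := ler_norm (f u - f x)%R; have := normr_ge0 (f u - f x)%R.
  by move: c1; rewrite indicE; case: (u \in _) => /=; nra.
rewrite oscE -ge0_integralD//; last by move=> u _; rewrite mule_ge0// lee_fin.
apply: le_integralT => //; first exact: emeasurable_funD.
  by move=> u; rewrite mule_ge0// lee_fin ltW.
move=> u; have [c -> /andP[c0 c1]] := hr u; rewrite -!EFinM -EFinD lee_fin (ger0_norm (f_ge0 u)).
have := ler_norm (f x - f u)%R; rewrite distrC; have := normr_ge0 (f u - f x)%R.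
by move: c1; rewrite indicE; case: (u \in _) => /=; nra.
Qed.

Lemma near_density_set (A : set vec) s : measurable A -> A `<=` eball x s ->
  mu A <= (f x)%:E * leb A + oscillation s /\
  (f x)%:E * leb A <= mu A + oscillation s.
Proof.
move=> mA As; rewrite -!integral_indicT//; apply: near_density.
  exact/measurable_EFinP/measurable_indic.
move=> u; rewrite !lee_fin; apply/andP; split => //; rewrite !indicE.
have [uA|//] := boolP (u \in A); rewrite mem_set//; exact/As/set_mem.
Qed.

Lemma density_ball_lower : exists b rho : R, [/\ (0 < b)%R, (0 < rho)%R &
  forall c r, (0 < r <= rho)%R -> (euclidean_dist x c <= 3 * d%:R * r)%R ->
    (b * r ^+ d)%:E <= mu (eball c r)].
Proof.
have kp := @ball_volume_gt0 R d d_gt0.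
pose K : R := (3 * d%:R + 1)%R.
have K0 : (0 < K)%R by rewrite /K ltr_wpDl// mulr_ge0.
(* The off-centre ball lies in the ball of radius [K * r] about [x]; this [e] lets the oscillation
   there consume only half of [f x * kappa * r ^+ d]. *)
pose e := (f x * kappa / 2 / K ^+ d)%R.
have e0 : (0 < e)%R by rewrite !divr_gt0 ?mulr_gt0// exprn_gt0.
have [rho rho0 H] := oscillation_small e0.
exists (f x * kappa / 2)%R, (rho / K / 2)%R; split; rewrite ?divr_gt0 ?mulr_gt0//.
move=> c r /andP[r0 rr] xc.
have sub : eball c r `<=` eball x (K * r).
  by move=> q; rewrite /eball/= => h; have := dist_triangle c x q; rewrite /K; lra.
have [_] := near_density_set (measurable_eball c r) sub.
rewrite (leb_ball d_gt0); last exact: ltW.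
move=> h1.
have h2 : oscillation (K * r) <= (e * (K * r) ^+ d)%:E.
  apply: H; rewrite mulr_gt0//= mulrC -ltr_pdivlMr//.
  by apply: (le_lt_trans rr); rewrite ltr_pdivrMr// ltr_pMr ?divr_gt0// ltr1n.
have h3 := le_trans h1 (leeD2l _ h2).
have muf : mu (eball c r) \is a fin_num by apply: mu_fin_num => //; exact: measurable_eball.
rewrite -(fineK muf) -EFinD -EFinM lee_fin in h3.
rewrite -(fineK muf) lee_fin.
have E : (e * (K * r) ^+ d = f x * kappa / 2 * r ^+ d)%R.
  by rewrite /e exprMn; field; rewrite gt_eqF// exprn_gt0.
by rewrite E in h3; lra.
Qed.

Lemma density_ball_upper : exists2 C : R, (0 < C)%R &
  forall s, (0 < s)%R -> mu (eball x s) <= (C * s ^+ d)%:E.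
Proof.
have kp := @ball_volume_gt0 R d d_gt0.
have [rho rho0 H] := oscillation_small (@ltr01 R).
(* The volume term, the oscillation with [e = 1], and for radii above [rho] the total mass 1, which
   is at most [(s / rho) ^+ d]. *)
exists (f x * kappa + 1 + rho ^- d)%R.
  by rewrite !addr_gt0 ?mulr_gt0// invr_gt0 exprn_gt0.
move=> s s0; have sd : (0 < s ^+ d)%R by rewrite exprn_gt0.
have [sr|rs] := ltP s rho.
  have [h1 _] := near_density_set (measurable_eball x s) (@subset_refl _ _).
  have h2 : oscillation s <= (1 * s ^+ d)%:E by apply: H; rewrite s0.
  apply: (le_trans h1); apply: (le_trans (leeD2l _ h2)).
  rewrite (leb_ball d_gt0); last exact: ltW.
  rewrite -EFinM -EFinD lee_fin.
  have : (0 <= rho ^- d)%R by rewrite invr_ge0 exprn_ge0// ltW.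
  by nra.
apply: (@le_trans _ _ 1); first by apply: mu_le1 => //; exact: measurable_eball.
rewrite lee_fin !mulrDl mul1r.
have h1 : (1 <= rho ^- d * s ^+ d)%R.
  by rewrite mulrC -exprVn -exprMn exprn_ege1// ler_pdivlMr// mul1r.
have h2 : (0 <= f x * kappa * s ^+ d)%R by rewrite !mulr_ge0// ltW.
by move: h1 h2 sd; lra.
Qed.

End lebesgue_point.

Section exponential_bounds.
Context (R : realType).
Implicit Types a b p u : R.

Lemma expRN_lip a b : 0 <= a -> 0 <= b -> `|expR (- a) - expR (- b)| <= `|a - b|.
Proof.
wlog ab : a b / a <= b => [H a0 b0|a0 b0].
  have [ab|ba] := leP a b; first exact: H.
  by rewrite distrC [leRHS]distrC; apply: H => //; exact: ltW.
rewrite ger0_norm ?subr_ge0 ?ler_expR ?lerN2// distrC [leRHS]ger0_norm ?subr_ge0//.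
have -> : - b = - a + - (b - a) by ring.
rewrite expRD -[X in X - _]mulr1 -mulrBr.
apply: (@le_trans _ _ (1 * (b - a))); last by rewrite mul1r.
have h := expR_ge1Dx (- (b - a)).
apply: ler_pM; rewrite ?expR_ge0// ?subr_ge0 ?expR_le1 ?oppr_le0 ?subr_ge0//; lra.
Qed.

Lemma one_sub_pow_le n p : 0 <= p <= 1 -> (1 - p) ^+ n <= expR (- (n%:R * p)).
Proof.
move=> /andP[p0 p1]; rewrite -mulrN expRM_natl lerXn2r ?nnegrE ?expR_ge0 ?subr_ge0//.
exact: expR_ge1Dx.
Qed.

(** Since 1 / (1 - p) = 1 + p / (1 - p) <= exp (p / (1 - p)), it suffices that p / (1 - p) <= p + 2
    p^2 for p <= 1/2. *)
Lemma one_sub_pow_ge n p : 0 <= p <= 2^-1 ->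
  expR (- (n%:R * (p + 2 * p ^+ 2))) <= (1 - p) ^+ n.
Proof.
move=> /andP[p0 p2]; have q0 : 0 < 1 - p by lra.
rewrite -mulrN expRM_natl lerXn2r ?nnegrE ?expR_ge0 ?(ltW q0)//.
apply: (@le_trans _ _ (expR (- (p / (1 - p))))).
  by rewrite ler_expR lerN2 ler_pdivrMr//; nra.
rewrite expRN -[leRHS]invrK lef_pV2 ?posrE ?expR_gt0 ?invr_gt0//.
apply: le_trans (expR_ge1Dx _); rewrite le_eqVlt; apply/orP; left; apply/eqP.
by field; rewrite gt_eqF.
Qed.

(** The exponent is [n] because the nucleus is not tested against itself, while the scaling uses the
    sample size [n.+1]; the term [p] pays for the difference. *)
Lemma one_sub_pow_close n p u : 0 <= p <= 2^-1 -> 0 <= u ->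
  `|(1 - p) ^+ n - expR (- u)| <= `|n.+1%:R * p - u| + p + 2 * n%:R * p ^+ 2.
Proof.
move=> pp u0; have /andP[p0 p2] := pp.
have np0 : 0 <= n%:R * p by rewrite mulr_ge0.
have np20 : 0 <= n%:R * (p + 2 * p ^+ 2) by rewrite mulr_ge0// addr_ge0// mulr_ge0// exprn_ge0.
have h1 : (1 - p) ^+ n <= expR (- (n%:R * p)) by apply: one_sub_pow_le; lra.
have h2 := one_sub_pow_ge n pp.
have h3 := le_trans (ler_norm _) (expRN_lip np0 u0).
have h4 := le_trans (ler_norm _) (expRN_lip u0 np20).
have h5 : `|n%:R * p - u| <= `|n.+1%:R * p - u| + p.
  rewrite (_ : n%:R * p - u = (n.+1%:R * p - u) - p); last by rewrite -natr1; ring.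
  by apply: (le_trans (ler_normB _ _)); rewrite lerD2l ger0_norm.
have n0 : 0 <= 2 * n%:R * p ^+ 2 by rewrite !mulr_ge0// exprn_ge0.
have h6 : `|u - n%:R * (p + 2 * p ^+ 2)| <= `|n%:R * p - u| + 2 * n%:R * p ^+ 2.
  rewrite (_ : u - _ = - (n%:R * p - u) - 2 * n%:R * p ^+ 2); last by ring.
  apply: (le_trans (ler_normB _ _)); by rewrite normrN lerD2l ger0_norm.
by rewrite ler_norml; apply/andP; split; lra.
Qed.

End exponential_bounds.

(** * Tuples with a far point *)

Section tail.
Context (R : realType) (d : nat) (d_gt0 : (0 < d)%N).
Local Notation vec := (d.-tuple R).
Variables (mu : {sigma_finite_measure set vec -> \bar R}) (x : vec).
Hypothesis mu1 : mu setT = 1%E.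
Variables (b rho C : R).
Hypotheses (b_gt0 : 0 < b) (rho_gt0 : 0 < rho) (C_gt0 : 0 < C).
Hypothesis ball_lower : forall c r, 0 < r <= rho ->
  euclidean_dist x c <= 3 * d%:R * r -> ((b * r ^+ d)%:E <= mu (eball c r))%E.
Hypothesis ball_upper : forall s, 0 < s -> (mu (eball x s) <= (C * s ^+ d)%:E)%E.

Let K : R := (3 * d%:R + 1) ^+ 2.
Let K_gt0 : 0 < K. Proof. by rewrite exprn_gt0// ltr_wpDl// mulr_ge0. Qed.

(** If the farthest point is at distance M, [region_contains_ball] gives a ball of radius M / K, so
    a mass of at least [b' * M ^+ d]. This holds while M / K <= [rho]; beyond that only [m0] is
    guaranteed. *)
Let b' : R := b / K ^+ d.
Let b'_gt0 : 0 < b'. Proof. by rewrite divr_gt0// exprn_gt0. Qed.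
Let nb'_ge0 (n : nat) : 0 <= n%:R * b'. Proof. by apply: mulr_ge0 => //; exact: ltW. Qed.
Let nb'_gt0 (n : nat) : (0 < n)%N -> 0 < n%:R * b'.
Proof. by move=> n0; apply: mulr_gt0 => //; rewrite ltr0n. Qed.

Let m0 : R := b * rho ^+ d.

Definition escapes k (s : R) (p : k.+1.-tuple vec) : bool :=
  [exists i, s <= euclidean_dist x (tnth p i)].

Lemma measurable_escapes k s : measurable_fun setT (@escapes k s).
Proof.
rewrite (_ : @escapes k s = (fun p => ~~ [forall i, euclidean_dist x (tnth p i) < s])).
  apply: measurable_neg; apply: measurable_forall => i; apply: measurable_fun_ltr => //.
  by apply: measurable_dist => //; exact: measurable_tnth.
apply/funext => p; rewrite negb_forall; apply: eq_existsb => i; by rewrite -leNgt.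
Qed.

Definition within_radii k (n : nat) (v : R) (p : k.+1.-tuple vec) : bool :=
  [forall i, n%:R * b' * euclidean_dist x (tnth p i) ^+ d <= v].

Lemma measurable_within_radii k n : measurable_fun setT
  (fun pv : k.+1.-tuple vec * R => within_radii n pv.2 pv.1).
Proof.
apply: measurable_forall => i; apply: measurable_fun_ler => //.
apply: measurable_funM => //; apply: measurable_funX; apply: measurable_dist => //.
by apply: (measurableT_comp (measurable_tnth i)); exact: measurable_fst.
Qed.

(** The decay is exponential in the largest distance to [x], which is not a product over the entries
    of [p]. Written as an integral over [v] it becomes one: all entries must lie in the same
    ball. *)
Lemma region_decay k n (p : k.+1.-tuple vec) :
  (((1 - fine (mu (region x p))) ^+ n)%:E <=
   \int[lebesgueR]_v ((within_radii n v p)%:R * expR (- v))%:E +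
   (expR (- (n%:R * m0)))%:E)%E.
Proof.
have [i _ iP] := @arg_maxP _ _ _ (ord0 : 'I_k.+1) xpredT (fun i => euclidean_dist x (tnth p i))
  isT.
set M := euclidean_dist x (tnth p i) in iP *.
have M0 : 0 <= M by exact: dist_ge0.
have u0 : 0 <= n%:R * b' * M ^+ d by apply: mulr_ge0 => //; exact: exprn_ge0.
have -> : (\int[lebesgueR]_v ((within_radii n v p)%:R * expR (- v))%:E =
    (expR (- (n%:R * b' * M ^+ d)))%:E)%E.
  have mI : measurable (`[n%:R * b' * M ^+ d, +oo[%classic : set R) by exact: measurable_itv.
  rewrite -exp_tail_integral// -(integral_indicM lebesgueR _ mI).
  apply: eq_integral => v _; rewrite -EFinM indicE; congr (_ * _)%:E; congr (nat_of_bool _)%:R.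
  apply/forallP/idP => [H|]; first by rewrite inE/= in_itv/= andbT; exact: H.
  rewrite inE/= in_itv/= andbT => H j; apply: le_trans H.
  rewrite ler_wpM2l// lerXn2r ?nnegrE ?dist_ge0//.
  exact: iP.
rewrite -EFinD lee_fin; have mV := fine_mu01 mu1 (measurable_region x p).
apply: (le_trans (one_sub_pow_le n mV)).
have lower r : 0 < r <= rho -> K * r <= M -> b * r ^+ d <= fine (mu (region x p)).
  move=> /andP[r0 rr] far; have [c xc sub] := region_contains_ball d_gt0 r0 far.
  rewrite -lee_fin fineK; last by apply: (mu_fin_num mu1); exact: measurable_region.
  apply: (le_trans (ball_lower _ xc)); first by rewrite r0.
  by apply: le_measure; rewrite ?inE; [exact: measurable_eball|exact: measurable_region|].
have n0 : 0 <= n%:R :> R by [].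
move: M0; rewrite le_eqVlt => /predU1P[M0|M0].
  rewrite -M0 expr0n gtn_eqF// mulr0 oppr0 expR0.
  apply: (@le_trans _ _ 1); last by rewrite lerDl expR_ge0.
  by rewrite expR_le1 oppr_le0 mulr_ge0 ?fine_ge0.
have [Mr|rM] := leP (M / K) rho.
  apply: (@le_trans _ _ (expR (- (n%:R * b' * M ^+ d)))); last by rewrite lerDl expR_ge0.
  rewrite ler_expR lerN2 -mulrA ler_wpM2l//.
  rewrite (_ : b' * M ^+ d = b * (M / K) ^+ d); last first.
    by rewrite /b' expr_div_n; field; rewrite gt_eqF// exprn_gt0.
  by apply: lower; rewrite ?Mr ?divr_gt0//= mulrC divfK// gt_eqF.
apply: (@le_trans _ _ (expR (- (n%:R * m0)))); last by rewrite lerDr expR_ge0.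
rewrite ler_expR lerN2 ler_wpM2l//; apply: lower; first by rewrite rho_gt0 lexx.
by rewrite mulrC -ler_pdivlMr// ltW.
Qed.

Lemma power_mu_T n : power_measure mu n setT = 1%E.
Proof.
rewrite (_ : setT = rect (fun _ : 'I_n => setT)); last by apply/seteqP; split.
rewrite power_rect//; elim: n => [|n IH]; first by rewrite big_ord0.
by rewrite big_ord_recl IH mule1; exact: mu1.
Qed.

Lemma within_radii_mass k n v : (0 < n)%N -> 0 < v ->
  (power_measure mu k.+1 [set p | within_radii n v p] <=
   ((C * 2 ^+ d / b' * v / n%:R) ^+ k.+1)%:E)%E.
Proof.
move=> n0 v0; have nR : 0 < n%:R :> R by rewrite ltr0n.
have w0 : 0 <= v / (n%:R * b') by apply: divr_ge0 => //; exact: ltW.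
have [s s0 sE] := root_exists d_gt0 w0.
have sp : 0 < s.
  rewrite lt_neqAle s0 andbT; apply/eqP => s00; move: sE;
    rewrite -s00 expr0n gtn_eqF// => /esym/eqP.
  by rewrite mulf_eq0 invr_eq0 (gt_eqF v0) (gt_eqF (nb'_gt0 n0)).
(* The condition defines closed balls of radius [s]; doubling the radius puts them inside open ones,
   at the price of [2 ^+ d]. *)
apply: (@le_trans _ _ (power_measure mu k.+1 (rect (fun=> eball x (2 * s))))).
  apply: le_measure; rewrite ?inE.
  - apply: measurable_set_bool; apply: (measurableT_comp (@measurable_within_radii k n) (g :=
    fun p => (p, v))).
    exact: measurable_pair2.
  - by apply: measurable_rect => i; exact: measurable_eball.
  move=> p /= /forallP H i; rewrite /eball/=.
  apply: (@le_lt_trans _ _ s); last by rewrite ltr_pMl// ltr1n.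
  rewrite -(@ler_pXn2r _ d)// ?nnegrE ?dist_ge0// sE ler_pdivlMr; [rewrite mulrC;
    exact: H|exact: nb'_gt0].
have mfin : mu (eball x (2 * s)) \is a fin_num by apply: (mu_fin_num mu1);
  exact: measurable_eball.
have -> : power_measure mu k.+1 (rect (fun=> eball x (2 * s))) = ((fine (mu (eball x (2 * s))))
  ^+ k.+1)%:E.
  rewrite -(prod_fine (n := k.+1) (F := fun=> mu (eball x (2 * s)))); last by move=> i;
    rewrite fineK.
  by apply: power_rect => i; exact: measurable_eball.
have s2 : 0 < 2 * s by rewrite mulr_gt0.
rewrite lee_fin lerXn2r ?nnegrE ?fine_ge0//.
  have h : 0 <= C * 2 ^+ d by rewrite mulr_ge0 ?exprn_ge0// ltW.
  by rewrite divr_ge0// mulr_ge0 ?(ltW v0)//; apply: divr_ge0 => //; exact: ltW.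
rewrite -lee_fin fineK//; apply: (le_trans (ball_upper s2)).
rewrite lee_fin exprMn sE le_eqVlt; apply/orP; left; apply/eqP.
by field; rewrite !gt_eqF.
Qed.

(** For fixed [v] the tuples have mass of order [(v / n) ^+ k.+1], which cancels the prefactor; what
    remains is a gamma integral over large [v]. The second term comes from regions of mass at least
    [m0]. *)
Lemma tail_bound k n (t r : R) : (0 < n)%N -> 0 < t -> 0 < r -> n.+1%:R * r ^+ d = 1 ->
  ((n.+1%:R ^+ k.+1)%:E *
   \int[power_measure mu k.+1]_p
      ((escapes (t * r) p)%:R * (1 - fine (mu (region x p))) ^+ n)%:E <=
  ((2 * C * 2 ^+ d / b') ^+ k.+1 * ((k.+1)`!%:R * 2 ^+ k.+2) * expR (- (b' / 4 * t ^+ d)) +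
   n.+1%:R ^+ k.+1 * expR (- (n%:R * m0)))%:E)%E.
Proof.
move=> n0 t0 r0 nr; have nR : 0 < n%:R :> R by rewrite ltr0n.
pose pm := power_measure mu k.+1.
pose G (p : k.+1.-tuple vec) (v : R) : R :=
  (escapes (t * r) p)%:R * ((within_radii n v p)%:R * expR (- v)).
have G0 p v : 0 <= G p v by rewrite !mulr_ge0 ?expR_ge0.
have mesc := @measurable_escapes k (t * r).
have mG : measurable_fun setT (fun pv => (G pv.1 pv.2)%:E).
  apply/measurable_EFinP; apply: measurable_funM.
    apply: measurable_natr_bool; apply: (measurableT_comp mesc); exact: measurable_fst.
  apply: measurable_funM; first by apply: measurable_natr_bool; exact: measurable_within_radii.
  apply: measurableT_comp => //; apply: measurable_funN; exact: measurable_snd.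
have mGp : measurable_fun setT (fun p => \int[lebesgueR]_v (G p v)%:E)%E.
  by apply: (measurable_fun_fubini_tonelli_F (fun pv => (G pv.1 pv.2)%:E)) => // pv;
    rewrite lee_fin G0.
have Gp0 p : (0 <= \int[lebesgueR]_v (G p v)%:E)%E.
  by apply: integral_ge0 => v _; rewrite lee_fin G0.
have step1 : (\int[pm]_p ((escapes (t * r) p)%:R * (1 - fine (mu (region x p))) ^+ n)%:E <=
    \int[pm]_p (\int[lebesgueR]_v (G p v)%:E + (expR (- (n%:R * m0)))%:E))%E.
  apply: le_integralT.
  - apply/measurable_EFinP; apply: measurable_funM; first exact: measurable_natr_bool.
    apply: measurable_funX; apply: measurable_funB => //.
    by apply: (measurableT_comp (fine_measurable measurableT)); exact: measurable_mu_region.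
  - exact: emeasurable_funD.
  - move=> p; rewrite lee_fin mulr_ge0// exprn_ge0// subr_ge0.
    by have /andP[] := fine_mu01 mu1 (measurable_region x p).
  move=> p; rewrite /G; case: (escapes _ p); last first.
    rewrite mul0r; apply: adde_ge0; last by rewrite lee_fin expR_ge0.
    by apply: integral_ge0 => v _; rewrite mul0r.
  rewrite mul1r; apply: (le_trans (region_decay n p)); rewrite leeD2r//.
  rewrite le_eqVlt; apply/orP; left; apply/eqP.
  by apply: eq_integral => v _; rewrite mul1r.
have step2 : (\int[pm]_p (\int[lebesgueR]_v (G p v)%:E) <=
    ((C * 2 ^+ d / b' / n%:R) ^+ k.+1 * ((k.+1)`!%:R * 2 ^+ k.+2)
      * expR (- (b' / 4 * t ^+ d)))%:E)%E.
  rewrite (fubini_tonelli (fun pv : k.+1.-tuple vec * R => (G pv.1 pv.2)%:E))//.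
  pose c1 := (C * 2 ^+ d / b' / n%:R) ^+ k.+1 * expR (- (b' / 4 * t ^+ d)).
  have c10 : 0 <= c1.
    apply: mulr_ge0; last exact: expR_ge0.
    apply: exprn_ge0; apply: divr_ge0 => //; apply: divr_ge0; last exact: ltW.
    by rewrite mulr_ge0 ?exprn_ge0// ltW.
  have D0m : measurable (`[0%R, +oo[%classic : set R) by exact: measurable_itv.
  have mg : measurable_fun setT (fun v : R => (v ^+ k.+1 * expR (- 2^-1 * v))%:E).
    apply/measurable_EFinP; apply: measurable_funM; first exact: measurable_funX.
    by apply: measurableT_comp => //; exact: measurable_funM.
  apply: (@le_trans _ _ (\int[lebesgueR]_v ((\1_(`[0%R, +oo[%classic : set R) v)%:E *
      (c1%:E * (v ^+ k.+1 * expR (- 2^-1 * v))%:E)))%E); last first.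
    rewrite integral_indicM// ge0_integralZl//; last 2 first.
    - by apply: measurable_funTS.
    - by move=> v /=; rewrite in_itv/= andbT => v0; rewrite lee_fin mulr_ge0 ?exprn_ge0 ?expR_ge0.
    rewrite gamma_integral// -EFinM lee_fin le_eqVlt; apply/orP; left; apply/eqP.
    by rewrite /c1 exprVn invrK; ring.
  apply: ge0_le_integral => //.
  - by move=> v _; apply: integral_ge0 => p _; rewrite lee_fin G0.
  - apply: (measurable_fun_fubini_tonelli_G (fun pv : k.+1.-tuple vec * R => (G pv.1 pv.2)%:E))
    => //.
    by move=> pv; rewrite lee_fin G0.
  - apply: emeasurable_funM; first exact/measurable_EFinP/measurable_indic.
    exact: measurable_funeM.
  (* An escaping point forces [v >= u1], because [n / n.+1 >= 1/2]. There exp (- v) <= exp (- v / 2)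
     exp (- b' t^d / 4): one half gives the decay in [t], the other keeps the integral over [v]
     finite. *)
  move=> v _ /=; pose u1 := b' / 2 * t ^+ d.
  have u10 : 0 < u1 by apply: mulr_gt0; [exact: divr_gt0|exact: exprn_gt0].
  have [vu|uv] := ltP v u1.
    rewrite integral0_eq => [|p _]; last first.
      rewrite /G; have [/existsP[i hi]|] := boolP (escapes _ p); last by rewrite mul0r.
      rewrite (_ : within_radii n v p = false) ?mul0r ?mulr0//.
      apply/negbTE/negP => /forallP/(_ i) H; move: vu; rewrite ltNge => /negP; apply.
      apply: le_trans H; apply: (@le_trans _ _ (n%:R * b' * (t * r) ^+ d)); last first.
        rewrite ler_wpM2l// lerXn2r ?nnegrE ?dist_ge0// mulr_ge0// ltW//.
      rewrite exprMn (_ : r ^+ d = n.+1%:R^-1); last first.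
        by apply: (mulfI (x := n.+1%:R)); rewrite ?pnatr_eq0// nr mulfV.
      rewrite /u1 (_ : n%:R * b' * _ = b' * t ^+ d * (n%:R / n.+1%:R)); last by ring.
      rewrite (_ : b' / 2 * t ^+ d = b' * t ^+ d * 2^-1); last by ring.
      apply: ler_wpM2l; first by apply: mulr_ge0; [exact: ltW|rewrite exprn_ge0// ltW].
      by rewrite ler_pdivlMr// ler_pdivrMl// -natrM ler_nat mul2n -addnn -addn1 leq_add2l.
    rewrite indicE; case: (boolP (v \in _)) => [|_]; last by rewrite mul0e.
    rewrite inE/= in_itv/= andbT => v0.
    rewrite mul1e -EFinM lee_fin; apply: mulr_ge0 => //.
    by apply: mulr_ge0; [exact: exprn_ge0|exact: expR_ge0].
  have v0 : 0 < v by exact: lt_le_trans uv.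
  rewrite indicE mem_set ?mul1e; last by rewrite /= in_itv/= andbT ltW.
  apply: (@le_trans _ _ (\int[pm]_p ((expR (- v))%:E * (\1_[set p | within_radii n v p]
    p)%:E)))%E.
    apply: le_integralT.
    - apply: (measurableT_comp mG (g := fun p => (p, v))); exact: measurable_pair2.
    - apply: measurable_funeM; apply/measurable_EFinP/measurable_indic/measurable_set_bool.
      apply: (measurableT_comp (@measurable_within_radii k n) (g := fun p => (p, v))).
      exact: measurable_pair2.
    - by move=> p; rewrite lee_fin G0.
    move=> p; rewrite -EFinM lee_fin /G indicE mulrC.
    have -> : (p \in [set p | within_radii n v p]) = within_radii n v p by apply/idP/idP;
      rewrite inE.
    by case: (escapes _ p); case: (within_radii _ _ _);
      rewrite ?mul0r ?mulr0 ?mulr1 ?mul1r ?expR_ge0.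
  have mW : measurable [set p : k.+1.-tuple vec | within_radii n v p].
    apply: measurable_set_bool.
    apply: (measurableT_comp (@measurable_within_radii k n) (g := fun p => (p, v))).
    exact: measurable_pair2.
  rewrite ge0_integralZl//; last by apply/measurable_EFinP/measurable_indic.
  rewrite integral_indicT//; apply: (le_trans (lee_wpmul2l _ (within_radii_mass k n0 v0))).
    by rewrite lee_fin expR_ge0.
  rewrite -!EFinM lee_fin /c1.
  rewrite (_ : C * 2 ^+ d / b' * v / n%:R = (C * 2 ^+ d / b' / n%:R) * v); last by ring.
  rewrite exprMn mulrCA -[leRHS]mulrA; apply: ler_wpM2l.
    apply: exprn_ge0; apply: divr_ge0 => //; apply: divr_ge0; last exact: ltW.
    by rewrite mulr_ge0 ?exprn_ge0// ltW.
  rewrite [leRHS]mulrCA [leLHS]mulrC; apply: ler_wpM2l; first by rewrite exprn_ge0// ltW.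
  by rewrite -expRD ler_expR; rewrite /u1 in uv; lra.
  by move=> pv; rewrite lee_fin G0.
apply: (le_trans (lee_wpmul2l _ step1)); first by rewrite lee_fin exprn_ge0.
rewrite ge0_integralD//.
have -> : (\int[pm]__ (expR (- (n%:R * m0)))%:E = (expR (- (n%:R * m0)))%:E)%E.
  rewrite integral_cst//; transitivity ((expR (- (n%:R * m0)))%:E * 1)%E; last exact: mule1.
  by congr (_ * _)%E; exact: power_mu_T.
rewrite ge0_muleDr; [|by apply: integral_ge0|by rewrite lee_fin expR_ge0].
rewrite -EFinM [leRHS]EFinD leeD2r//.
apply: (le_trans (lee_wpmul2l _ step2)); first by rewrite lee_fin exprn_ge0.
rewrite -EFinM lee_fin.
have aux (N X Y Z W : R) : 0 <= Y -> 0 <= Z -> N * X <= W -> N * (X * Y * Z) <= W * Y * Z.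
  by move=> Y0 Z0 NX; rewrite mulrA ler_wpM2r// mulrA ler_wpM2r.
apply: aux; [by rewrite mulr_ge0 ?exprn_ge0|exact: expR_ge0|].
have A0 : 0 <= C * 2 ^+ d / b'.
  by apply: divr_ge0; [rewrite mulr_ge0 ?exprn_ge0// ltW|exact: ltW].
have An0 : 0 <= n.+1%:R * (C * 2 ^+ d / b' / n%:R).
  by apply: mulr_ge0 => //; exact: divr_ge0.
have E : n.+1%:R * (C * 2 ^+ d / b' / n%:R) <= 2 * C * 2 ^+ d / b'; last first.
  by rewrite -exprMn lerXn2r ?nnegrE//; exact: le_trans E.
rewrite (_ : n.+1%:R * _ = (C * 2 ^+ d / b') * (n.+1%:R / n%:R)); last by ring.
rewrite (_ : 2 * C * 2 ^+ d / b' = (C * 2 ^+ d / b') * 2); last by ring.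
apply: ler_wpM2l => //.
by rewrite ler_pdivrMr// -natrM ler_nat mul2n -addnn -addn1 leq_add2l.
Qed.

End tail.

(** * Comparison with Lebesgue measure at bounded scale *)

Section main_term.
Context (R : realType) (d : nat) (d_gt0 : (0 < d)%N).
Local Notation vec := (d.-tuple R).
Local Notation leb := (@lebesgue_tuple R d).
Variables (f : {mfun vec >-> R}) (x : vec).
Hypothesis f_ge0 : forall y, 0 <= f y.
Hypothesis fx_gt0 : 0 < f x.
Hypothesis lp : lebesgue_point f x.
Local Notation mu := (weighted leb f).
Hypothesis mu1 : mu setT = 1%E.
Local Notation kappa := (ball_volume R d).
Local Open Scope ereal_scope.

Lemma affine_origin r : affine r x origin = x.
Proof. by apply: eq_from_tnth => i; rewrite tnth_affine tnth_mktuple mulr0 add0r. Qed.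

Lemma measurable_exp_volume k (y : vec) (c : R) : measurable_fun setT
  (fun p : k.+1.-tuple vec => expR (- (c * region_volume y p))).
Proof.
apply: measurableT_comp => //; apply: measurable_funN; apply: measurable_funM => //.
exact: measurable_region_volume.
Qed.

Definition truncated_limit k (t : R) : \bar R :=
  (f x ^+ k.+1)%:E * \int[power_measure leb k.+1]_p
    ((~~ escapes origin t p)%:R * expR (- (f x * region_volume origin p)))%:E.

Lemma measurable_within k (y : vec) t :
  measurable_fun setT (fun p : k.+1.-tuple vec => (~~ escapes y t p)%:R : R).
Proof. by apply: measurable_natr_bool; apply: measurable_neg; exact: measurable_escapes. Qed.

(** Under [affine r x] the measure [n.+1%:R * f x] times Lebesgue becomes [f x] times Lebesgue, and
    scaled volumes match. The identity is exact, so all the error lies in replacing [mu]. *)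
Lemma scaled_integral k n (t r : R) : (0 < r)%R -> (n.+1%:R * r ^+ d = 1)%R ->
  \int[power_measure (weighted leb (cst (n.+1%:R * f x)%R)) k.+1]_p
    ((~~ escapes x (t * r) p)%:R * expR (- (n.+1%:R * f x * region_volume x p)))%:E =
  truncated_limit k t.
Proof.
move=> r0 nr; have a0 : (0 <= n.+1%:R * f x)%R by rewrite mulr_ge0// ltW.
have escE (p : k.+1.-tuple vec) :
    escapes x (t * r) (tuple_map (fun=> affine r x) p) = escapes origin t p.
  apply: eq_existsb => i.
  by rewrite tnth_mktuple -[X in euclidean_dist X _](affine_origin r)
    dist_affine ?(ltW r0)// mulrC ler_pM2l.
have volE (p : k.+1.-tuple vec) :
    expR (- (n.+1%:R * f x * region_volume x (tuple_map (fun=> affine r x) p))) =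
    expR (- (f x * region_volume origin p)).
  rewrite (@region_volume_map _ _ d_gt0 origin x r)//.
  - rewrite (_ : n.+1%:R * f x * _ = n.+1%:R * r ^+ d * (f x * region_volume origin p))%R;
    last by ring.
    by rewrite nr mul1r.
  - exact: measurable_affine.
  - exact: affine_origin.
  - by move=> a b; rewrite dist_affine// ltW.
  - by move=> g mg g0; exact: integral_affine.
rewrite /truncated_limit (integral_power_image (m' := leb) (phi := fun=> affine r x) (c := f x)).
- under eq_integral => p _ do rewrite escE volE.
  by [].
- exact: ltW.
- by move=> i; exact: measurable_affine.
- move=> _ g mg g0; rewrite integral_weighted_cst// (@integral_affine _ _ r x)// muleA -EFinM.
  by congr (_%:E * _); rewrite mulrAC nr mul1r.
- apply/measurable_EFinP; apply: measurable_funM; first exact: measurable_within.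
  exact: measurable_exp_volume.
- by move=> p; rewrite lee_fin mulr_ge0 ?expR_ge0.
Qed.

Definition main_term k n (s : R) : \bar R :=
  (n.+1%:R ^+ k.+1)%:E * \int[power_measure mu k.+1]_p
    ((~~ escapes x s p)%:R * (1 - fine (mu (region x p))) ^+ n)%:E.

Lemma within_rect k s (p : k.+1.-tuple vec) : ~~ escapes x s p = (p \in rect (fun=> eball x s)).
Proof.
apply/idP/idP; last first.
  rewrite inE => H; rewrite negb_exists; apply/forallP => i; rewrite -ltNge; exact: H.
rewrite negb_exists inE => /forallP H i; rewrite /eball/= ltNge; exact: H.
Qed.

(** Two replacements: [(1 - mu V) ^+ n] by an exponential of the volume, pointwise on bounded
    tuples, and the scaled [mu] by scaled Lebesgue measure in each factor, by [power_close]. [K] is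
    chosen before [e], so the error can be made small at fixed [t]. *)
Lemma main_term_close k (t : R) : (0 < t)%R -> exists2 K : R, (0 <= K)%R &
  forall e, (0 < e <= 1)%R -> exists2 rho : R, (0 < rho)%R &
  forall n r, (0 < r < rho)%R -> (n.+1%:R * r ^+ d = 1)%R ->
    main_term k n (t * r) <= truncated_limit k t + (K * e)%:E /\
    truncated_limit k t <= main_term k n (t * r) + (K * e)%:E.
Proof.
move=> t0; have kp := @ball_volume_gt0 R d d_gt0.
have td : (0 < t ^+ d)%R by rewrite exprn_gt0.
have t3d : (0 < (3 * t) ^+ d)%R by rewrite exprn_gt0// mulr_gt0.
have ak : (0 < f x * kappa)%R by rewrite mulr_gt0.
(* Bounds the mass of the ball under both scaled measures; the last summand ensures [1 <= A], as
   [power_close] asks. *)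
pose A := (f x * kappa * t ^+ d + t ^+ d + 1)%R.
have A1 : (1 <= A)%R by rewrite /A lerDr addr_ge0 ?mulr_ge0 ?ltW.
have A0 : (0 <= A)%R by exact: le_trans A1.
(* By [region_sub_ball] the region has mass at most [Q * r ^+ d]. *)
pose Q := (f x * kappa * (3 * t) ^+ d + (3 * t) ^+ d)%R.
have Q0 : (0 < Q)%R by rewrite addr_gt0// mulr_gt0.
exists (((3 * t) ^+ d + 1 + k.+1%:R * t ^+ d) * A ^+ k.+1)%R.
  by rewrite mulr_ge0 ?exprn_ge0// !addr_ge0 ?mulr_ge0 ?ltW.
move=> e /andP[e0 e1].
have [rho rho0 oscP] := oscillation_small d_gt0 lp e0.
(* With [q * r ^+ d <= e <= 1], the mass of the region is at most 1/2 and the errors [p + 2 n p^2]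
   of [one_sub_pow_close] are at most [e]. *)
pose q := (2 * Q + 2 * Q ^+ 2 + 1)%R.
have q0 : (0 < q)%R by rewrite /q; have := exprn_ge0 2 (ltW Q0); nra.
exists (Num.min (rho / (3 * t)) (Num.min 1 (e / q)))%R.
  by rewrite !lt_min ltr01 !divr_gt0// mulr_gt0.
move=> n r /andP[r0]; rewrite !lt_min => /andP[rrho /andP[r1 req]] nr.
have rd : (r ^+ d <= r)%R by rewrite -[leRHS]expr1 ler_wiXn2l// ltW.
have nE : n.+1%:R = r ^- d :> R.
  by apply: (mulIf (x := r ^+ d)); rewrite ?expf_neq0 ?gt_eqF// nr mulVf ?expf_neq0 ?gt_eqF.
have rdp : (0 < r ^+ d)%R by rewrite exprn_gt0.
have t3 : (0 < 3 * t)%R by rewrite mulr_gt0.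
have osc3 : oscillation f x (3 * (t * r)) <= (e * (3 * t) ^+ d * r ^+ d)%:E.
  rewrite -mulrA -exprMn mulrA; apply: oscP; rewrite mulr_gt0//= mulrC -ltr_pdivlMr//.
have osc1 : oscillation f x (t * r) <= (e * t ^+ d * r ^+ d)%:E.
  rewrite -mulrA -exprMn; apply: oscP; rewrite mulr_gt0//=.
  by move: rrho; rewrite ltr_pdivlMr//; nra.
have tr0 : (0 < t * r)%R by rewrite mulr_gt0.
pose N : R := n.+1%:R; have N0 : (0 < N)%R by rewrite ltr0n.
have Na0 : (0 <= N * f x)%R by rewrite mulr_ge0 ?ltW.
pose alpha := weighted mu (cst N); pose beta := weighted leb (cst (N * f x)%R).
pose B := eball x (t * r).
have mB : measurable B by exact: measurable_eball.
have Nrd (c : R) : (N * (c * r ^+ d) = c)%R by rewrite mulrCA nr mulr1.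
have alphaE (h : vec -> \bar R) : measurable_fun setT h -> (forall u, 0 <= h u) ->
    \int[alpha]_u h u = N%:E * \int[mu]_u h u.
  by move=> mh h0; apply: integral_weighted_cst => //; exact: ltW.
have betaE (h : vec -> \bar R) : measurable_fun setT h -> (forall u, 0 <= h u) ->
    \int[beta]_u h u = N%:E * ((f x)%:E * \int[leb]_u h u).
  by move=> mh h0; rewrite integral_weighted_cst// muleA -EFinM.
have close (h : vec -> \bar R) : measurable_fun setT h -> (forall u, 0 <= h u <= (\1_B u)%:E) ->
    \int[alpha]_u h u <= \int[beta]_u h u + (e * t ^+ d)%:E /\
    \int[beta]_u h u <= \int[alpha]_u h u + (e * t ^+ d)%:E.
  move=> mh h1; have h0 u : 0 <= h u by have /andP[] := h1 u.
  have [u1 u2] := near_density f_ge0 fx_gt0 mh h1.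
  have Ie0 (m : {measure set vec -> \bar R}) : 0 <= \int[m]_u h u by exact: integral_ge0.
  have ED : (e * t ^+ d)%:E = N%:E * (e * t ^+ d * r ^+ d)%:E by rewrite -EFinM Nrd.
  rewrite alphaE// betaE// !ED.
  have fI0 : 0 <= (f x)%:E * \int[leb]_u h u by rewrite mule_ge0// lee_fin ltW.
  have e'0 : 0 <= (e * t ^+ d * r ^+ d)%:E by rewrite lee_fin !mulr_ge0// ltW.
  rewrite -!ge0_muleDr//; split; apply: lee_wpmul2l; rewrite ?lee_fin ?(ltW N0)//.
    by apply: (le_trans u1); rewrite leeD2l.
  by apply: (le_trans u2); rewrite leeD2l.
have ballE (m : {measure set vec -> \bar R}) : m B = \int[m]_u (\1_B u)%:E by rewrite
  integral_indicT.
have mIB : measurable_fun setT (fun u : vec => (\1_B u)%:E : \bar R)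
  by exact/measurable_EFinP/measurable_indic.
have lebB : leb B = (kappa * (t * r) ^+ d)%:E.
  by rewrite /B (leb_ball d_gt0)//; exact: ltW.
have betaI : \int[beta]_u (\1_B u)%:E = (f x * kappa * t ^+ d)%:E.
  transitivity (N%:E * ((f x)%:E * leb B)); first by rewrite betaE// integral_indicT.
  by rewrite lebB -!EFinM; congr EFin; rewrite exprMn -[RHS]Nrd; ring.
have betaB : beta B = (f x * kappa * t ^+ d)%:E by rewrite -betaI; exact: ballE.
have alphaB : alpha B <= A%:E.
  have I01 u : 0 <= (\1_B u : R)%:E <= (\1_B u : R)%:E by rewrite lexx andbT lee_fin.
  have [H _] := close _ mIB I01.
  apply: (@le_trans _ _ (\int[alpha]_u (\1_B u)%:E)); first by rewrite -ballE.
  apply: (le_trans H); rewrite betaI -EFinD lee_fin /A -addrA lerD2l.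
  have : (e * t ^+ d <= 1 * t ^+ d)%R by rewrite ler_wpM2r// ltW.
  lra.
have betaA : beta B <= A%:E by rewrite betaB lee_fin /A -addrA lerDl addr_ge0// ltW.
have et0 : (0 <= e * t ^+ d)%R by rewrite mulr_ge0// ltW.
pose W (p : k.+1.-tuple vec) : R := (~~ escapes x (t * r) p)%:R.
have mW : measurable_fun setT W by exact: measurable_within.
pose F1 (p : k.+1.-tuple vec) : R := (W p * (1 - fine (mu (region x p))) ^+ n)%R.
pose F2 (p : k.+1.-tuple vec) : R := (W p * expR (- (N * f x * region_volume x p)))%R.
have mF1 : measurable_fun setT F1.
  apply: measurable_funM => //; apply: measurable_funX; apply: measurable_funB => //.
  by apply: (measurableT_comp (fine_measurable measurableT)); exact: measurable_mu_region.
have mF2 : measurable_fun setT F2 by apply: measurable_funM => //; exact: measurable_exp_volume.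
have F10 p : (0 <= F1 p)%R.
  rewrite /F1 mulr_ge0// exprn_ge0// subr_ge0.
  by have /andP[] := fine_mu01 mu1 (measurable_region x p).
have F20 p : (0 <= F2 p)%R by rewrite /F2 mulr_ge0 ?expR_ge0.
have F21 p : 0 <= (F2 p)%:E <= (\1_(rect (fun=> B)) p)%:E.
  rewrite !lee_fin F20/= /F2 /W indicE -within_rect; case: (~~ _); rewrite ?mul0r// mul1r.
  by rewrite expR_le1 oppr_le0 mulr_ge0// region_volume_ge0.
pose eta := (e * ((3 * t) ^+ d + 1))%R.
have eta0 : (0 <= eta)%R by rewrite mulr_ge0 ?addr_ge0 ?ltW.
have F12 p : (`|F1 p - F2 p| <= eta * W p)%R.
  rewrite /F1 /F2 -mulrBr normrM [X in (X * _)%R]ger0_norm// mulrC.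
  have [pB|] := boolP (~~ escapes x (t * r) p); last by rewrite /W => /negbTE->; rewrite !mulr0.
  apply: ler_wpM2r => //.
  have sub : region x p `<=` eball x (3 * (t * r)).
    by apply: region_sub_ball => i; move: pB; rewrite within_rect inE => /(_ i).
  have mV := measurable_region x p.
  have [h1 h2] := near_density_set f_ge0 fx_gt0 mV sub.
  have mVfin := mu_fin_num mu1 mV; have /andP[P0 P1] := fine_mu01 mu1 mV.
  set P := fine (mu (region x p)) in P0 P1 *.
  pose v := region_volume x p; have v0 : (0 <= v)%R by exact: region_volume_ge0.
  have Po : (P <= f x * v + e * (3 * t) ^+ d * r ^+ d)%R.
    rewrite -lee_fin EFinD [(f x * v)%:E]EFinM /v (region_volumeE d_gt0) /P fineK//.
    by apply: (le_trans h1); rewrite leeD2l.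
  have oP : (f x * v <= P + e * (3 * t) ^+ d * r ^+ d)%R.
    rewrite -lee_fin EFinD [(f x * v)%:E]EFinM /v (region_volumeE d_gt0) /P fineK//.
    by apply: (le_trans h2); rewrite leeD2l.
  have vB : (v <= kappa * ((3 * t) ^+ d * r ^+ d))%R.
    rewrite -lee_fin /v (region_volumeE d_gt0) -exprMn -mulrA.
    rewrite -(leb_ball d_gt0 x); last by rewrite !mulr_ge0// ltW.
    by apply: le_measure; rewrite ?inE//; exact: measurable_eball.
  have PQ : (P <= Q * r ^+ d)%R.
    apply: (le_trans Po).
    have a1 : (f x * v <= f x * (kappa * ((3 * t) ^+ d * r ^+ d)))%R by rewrite ler_wpM2l// ltW.
    have a2 : (e * (3 * t) ^+ d * r ^+ d <= 1 * ((3 * t) ^+ d * r ^+ d))%R.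
      by rewrite -mulrA ler_wpM2r// mulr_ge0// ltW.
    rewrite (_ : Q * r ^+ d = f x * (kappa * ((3 * t) ^+ d * r ^+ d)) + 1 * ((3 * t)
      ^+ d * r ^+ d))%R.
      exact: lerD.
    by rewrite /Q mul1r mulrDl !mulrA.
  have rq : (q * r ^+ d <= e)%R.
    by move: req; rewrite ltr_pdivlMr// => /ltW; apply: le_trans; rewrite mulrC ler_wpM2r// ltW.
  have Q2 : (0 <= Q ^+ 2 * r ^+ d)%R by rewrite mulr_ge0 ?exprn_ge0// ltW.
  have Qr : (0 <= Q * r ^+ d)%R by rewrite mulr_ge0// ltW.
  have qE : (q * r ^+ d = 2 * (Q * r ^+ d) + 2 * (Q ^+ 2 * r ^+ d) + r ^+ d)%R by rewrite /q;
    ring.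
  rewrite qE in rq.
  have Phalf : (0 <= P <= 2^-1)%R.
    by rewrite P0/=; move: PQ rq Q2 rdp Qr e1; clear; lra.
  have u0 : (0 <= N * f x * v)%R by rewrite mulr_ge0.
  apply: (le_trans (one_sub_pow_close n Phalf u0)).
  have c1 : (`|N * P - N * f x * v| <= e * (3 * t) ^+ d)%R.
    rewrite -mulrA -mulrBr normrM (gtr0_norm N0) -[leRHS]Nrd; apply: ler_wpM2l; first exact: ltW.
    by move: Po oP; clear; rewrite ler_norml => h1 h2; apply/andP; split; lra.
  have c2 : (2 * n%:R * P ^+ 2 <= 2 * (Q ^+ 2 * r ^+ d))%R.
    rewrite -mulrA; apply: ler_wpM2l => //.
    apply: (@le_trans _ _ (N * (Q * r ^+ d) ^+ 2))%R.
      apply: ler_pM => //; rewrite ?exprn_ge0// ?ler_nat//.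
      by rewrite lerXn2r ?nnegrE.
    by rewrite exprMn expr2 mulrA -(Nrd (Q * Q * r ^+ d)%R) le_eqVlt; apply/orP; left;
      apply/eqP; ring.
  by move: c1 c2 PQ rq Q2 Qr rdp; rewrite /eta -/N; clear; lra.
pose pa := power_measure alpha k.+1; pose pb := power_measure beta k.+1.
have mainE : main_term k n (t * r) = \int[pa]_p (F1 p)%:E.
  rewrite /main_term -/N -(integral_power_scale (m := alpha) (ltW N0))//;
    first exact/measurable_EFinP.
have truncE : truncated_limit k t = \int[pb]_p (F2 p)%:E.
  by rewrite /pb /beta /F2 /W /N; exact/esym/scaled_integral.
have WI : \int[pa]_p (W p)%:E <= (A ^+ k.+1)%:E.
  have -> : \int[pa]_p (W p)%:E = pa (rect (fun=> B)).
    transitivity (\int[pa]_p (\1_(rect (fun=> B)) p)%:E); last by apply: integral_indicT;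
      exact: measurable_rect.
    by apply: eq_integral => p _; rewrite /W within_rect indicE.
  have aBfin : alpha B \is a fin_num by rewrite ge0_fin_numE//;
    exact: le_lt_trans alphaB (ltry _).
  have -> : pa (rect (fun=> B)) = (fine (alpha B) ^+ k.+1)%:E.
    rewrite -(prod_fine (n := k.+1) (F := fun=> alpha B)); last by move=> i; rewrite fineK.
    exact: power_rect.
  by rewrite lee_fin lerXn2r ?nnegrE ?fine_ge0// -lee_fin fineK.
have etaW : \int[pa]_p (eta * W p)%:E <= (eta * A ^+ k.+1)%:E.
  under eq_integral do rewrite EFinM.
  rewrite ge0_integralZl; [|exact: measurableT|exact/measurable_EFinP|by move=> p _;
    rewrite lee_fin|by rewrite lee_fin].
  by rewrite [leRHS]EFinM; apply: lee_wpmul2l => //; rewrite lee_fin.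
have metaW : measurable_fun setT (fun p => (eta * W p)%:E).
  by apply/measurable_EFinP; exact: measurable_funM.
have swap (G1 G2 : k.+1.-tuple vec -> R) : measurable_fun setT G1 -> measurable_fun setT G2 ->
    (forall p, 0 <= G1 p)%R -> (forall p, 0 <= G2 p)%R ->
    (forall p, `|G1 p - G2 p| <= eta * W p)%R ->
    \int[pa]_p (G1 p)%:E <= \int[pa]_p (G2 p)%:E + (eta * A ^+ k.+1)%:E.
  move=> mG1 mG2 G10 G20 G12.
  apply: (@le_trans _ _ (\int[pa]_p (G2 p)%:E + \int[pa]_p (eta * W p)%:E));
    last by rewrite leeD2l.
  rewrite -ge0_integralD; [|exact: measurableT|by move=> p _;
    rewrite lee_fin|exact/measurable_EFinP|by move=> p _; rewrite lee_fin mulr_ge0|by []].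
  apply: le_integralT => //; [exact/measurable_EFinP|by apply: emeasurable_funD => //;
    exact/measurable_EFinP|].
  by move=> p; rewrite -EFinD lee_fin; have := G12 p; rewrite ler_norml => /andP[_];
    rewrite lerBlDl.
have c1 := power_close mB A1 et0 alphaB betaA (fun h mh h1 => (close h mh h1).1).
have c2 := power_close mB A1 et0 betaA alphaB (fun h mh h1 => (close h mh h1).2).
have KE : ((((3 * t) ^+ d + 1 + k.+1%:R * t ^+ d) * A ^+ k.+1 * e) =
    k.+1%:R * (e * t ^+ d) * A ^+ k.+1 + eta * A ^+ k.+1)%R by rewrite /eta; ring.
have meF2 : measurable_fun setT (EFin \o F2) by exact/measurable_EFinP.
rewrite mainE.
rewrite truncE.
rewrite KE.
rewrite EFinD.
rewrite addeA.
split.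
  by apply: (le_trans (swap _ _ mF1 mF2 F10 F20 F12)); rewrite leeD2r//; exact: c1.
apply: (le_trans (c2 _ _ meF2 F21)); rewrite [X in _ <= _ + X]addeC addeA leeD2r//.
by apply: swap => // p; rewrite distrC.
Qed.

End main_term.

(** * Convergence of the scaled moments *)

Section moment_limit.
Context (R : realType) (d : nat) (d_gt0 : (0 < d)%N).
Local Notation vec := (d.-tuple R).
Local Notation leb := (@lebesgue_tuple R d).
Variables (f : {mfun vec >-> R}) (x : vec).
Hypothesis f_ge0 : forall y, 0 <= f y.
Hypothesis fx_gt0 : 0 < f x.
Hypothesis lp : lebesgue_point f x.
Local Notation mu := (weighted leb f).
Hypothesis mu1 : mu setT = 1%E.
Local Open Scope ereal_scope.

Definition limit_integral k (a : R) : \bar R :=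
  (a ^+ k.+1)%:E * \int[power_measure leb k.+1]_p (expR (- (a * region_volume origin p)))%:E.

Lemma truncated_limit_cvg k :
  truncated_limit f x k m%:R @[m --> \oo] --> limit_integral k (f x).
Proof.
have mE : measurable_fun setT (fun p : k.+1.-tuple vec =>
    (expR (- (f x * region_volume origin p)))%:E).
  by apply/measurable_EFinP; exact: measurable_exp_volume.
pose g (m : nat) (p : k.+1.-tuple vec) : \bar R :=
  ((~~ escapes origin m%:R p)%:R * expR (- (f x * region_volume origin p)))%:E.
have mg m : measurable_fun setT (g m).
  apply/measurable_EFinP; apply: measurable_funM; first exact: measurable_within.
  exact: measurable_exp_volume.
have g0 m p : 0 <= g m p by rewrite lee_fin mulr_ge0 ?expR_ge0.
rewrite /limit_integral /truncated_limit; apply: cvgeZl => //.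
have -> : \int[power_measure leb k.+1]_p (expR (- (f x * region_volume origin p)))%:E =
    \int[power_measure leb k.+1]_p limn (g ^~ p).
  apply: eq_integral => p _; apply/esym/cvg_lim => //; apply: cvg_near_cst.
  near=> m; rewrite /g (_ : escapes _ _ _ = false) ?mul1r//.
  apply/negbTE; rewrite negb_exists; apply/forallP => i; rewrite -ltNge.
  have : (\sum_(j < k.+1) euclidean_dist origin (tnth p j) < m%:R)%R by near: m;
    exact: nbhs_infty_gtr.
  apply: le_lt_trans; rewrite (bigD1 i)//= lerDl; apply: sumr_ge0 => j _; exact: dist_ge0.
apply: (@cvg_monotone_convergence _ _ _ (power_measure leb k.+1) _ measurableT g) => //.
move=> p _ m m' mm; rewrite lee_fin ler_wpM2r ?expR_ge0// ler_nat.
have [/existsP[i hi]|] := boolP (escapes origin m'%:R p); last by rewrite leq_b1.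
rewrite (_ : escapes origin m%:R p)//; apply/existsP; exists i; apply: le_trans hi.
by rewrite ler_nat.
Unshelve. all: by end_near. Qed.

Definition scaled_moment k n : R := fine ((n.+1%:R ^+ k.+1)%:E *
  \int[power_measure mu k.+1]_p ((1 - fine (mu (region x p))) ^+ n)%:E).

Lemma moment_integral_le1 k n :
  0 <= \int[power_measure mu k.+1]_p ((1 - fine (mu (region x p))) ^+ n)%:E <= 1.
Proof.
have P01 p : (0 <= 1 - fine (mu (region x (p : k.+1.-tuple vec))) <= 1)%R.
  by have /andP[] := fine_mu01 mu1 (measurable_region x p); lra.
apply/andP; split.
  by apply: integral_ge0 => p _; rewrite lee_fin exprn_ge0//; have /andP[] := P01 p.
apply: (@le_trans _ _ (\int[power_measure mu k.+1]_p (cst 1 p))); last first.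
  rewrite integral_cst// mul1e le_eqVlt; apply/orP; left; apply/eqP; exact: power_mu_T.
apply: le_integralT => //.
- apply/measurable_EFinP; apply: measurable_funX; apply: measurable_funB => //.
  by apply: (measurableT_comp (fine_measurable measurableT)); exact: measurable_mu_region.
- by move=> p; rewrite lee_fin exprn_ge0//; have /andP[] := P01 p.
- by move=> p; rewrite lee_fin exprn_ile1//; have /andP[] := P01 p.
Qed.

Lemma scaled_momentE k n : (scaled_moment k n)%:E = (n.+1%:R ^+ k.+1)%:E *
  \int[power_measure mu k.+1]_p ((1 - fine (mu (region x p))) ^+ n)%:E.
Proof.
rewrite fineK// fin_numM//; have /andP[h0 h1] := moment_integral_le1 k n.
by rewrite ge0_fin_numE//; exact: le_lt_trans h1 (ltry _).
Qed.

Lemma pow_exp_small k (m0 e : R) : (0 < m0)%R -> (0 < e)%R ->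
  \forall n \near \oo, (n.+1%:R ^+ k.+1 * expR (- (n%:R * m0)) <= e)%R.
Proof.
move=> m00 e0; have e'0 : (0 < e / expR m0)%R by rewrite divr_gt0 ?expR_gt0.
have /cvgrPdist_lt/(_ _ e'0)[M [_ HM]] := exprn_expRN_cvg0 k.+1 m00.
near=> n.
have nM : (M < n.+1%:R)%R.
  apply: (@lt_trans _ _ n%:R); last by rewrite ltr_nat.
  by near: n; exact: nbhs_infty_gtr.
have := HM _ nM; rewrite sub0r normrN ger0_norm ?mulr_ge0 ?exprn_ge0 ?expR_ge0//.
rewrite ltr_pdivlMr ?expR_gt0// => /ltW; apply: le_trans.
rewrite -mulrA -expRD le_eqVlt; apply/orP; left; apply/eqP; congr (_ * expR _)%R.
by rewrite -natr1; ring.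
Unshelve. all: by end_near. Qed.

(** [j] is the limit, [T] its truncation, [M] the main term and [s] the scaled moment; [a + b] is
    the tail and [c] the error of [main_term_close]. *)
Let sandwich (j T s M a b c e : R) : (M <= s -> s <= M + (a + b) -> T <= M + c ->
  M <= T + c -> c <= e -> b <= e -> a <= e -> `|j - T| < e -> `|j - s| <= 4 * e)%R.
Proof.
move=> h1 h2 lo up ce be ae; rewrite ltr_norml => /andP[j1 j2].
by rewrite ler_norml; apply/andP; split; lra.
Qed.

Lemma scaled_moment_cvg k : limit_integral k (f x) \is a fin_num ->
  scaled_moment k n @[n --> \oo] --> fine (limit_integral k (f x)).
Proof.
move=> Jfin; set J := limit_integral k (f x) in Jfin *.
have [b [rho0 [b0 rho00 lower]]] := density_ball_lower d_gt0 f_ge0 fx_gt0 lp mu1.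
have [C C0 upper] := density_ball_upper d_gt0 f_ge0 fx_gt0 lp mu1.
apply/cvgrPdist_le => eps eps0; pose e := (eps / 4)%R.
have e0 : (0 < e)%R by rewrite divr_gt0.
have tail := tail_bound d_gt0 mu1 b0 rho00 C0 lower upper k.
move: tail; set c1 := (_ ^+ k.+1 * _)%R; set c2 := (_ / 4)%R; set m0 := (b * _)%R => tail.
have K0 : (0 < (3 * d%:R + 1) ^+ 2 :> R)%R by rewrite exprn_gt0// ltr_wpDl// mulr_ge0.
have b'0 : (0 < b / ((3 * d%:R + 1) ^+ 2) ^+ d)%R by rewrite divr_gt0// exprn_gt0.
have c20 : (0 < c2)%R by rewrite divr_gt0.
have c10 : (0 < c1)%R.
  apply: mulr_gt0; first apply: exprn_gt0.
    by apply: divr_gt0 => //; rewrite !mulr_gt0// exprn_gt0.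
  by rewrite mulr_gt0 ?exprn_gt0// ltr0n fact_gt0.
have m00 : (0 < m0)%R by rewrite mulr_gt0// exprn_gt0.
(* The truncation radius is fixed before [n]: both the truncated limit and the part of the tail
   bound that is free of [n] are under control from here on. *)
have [m [m_gt0 mfin mJ mt]] : exists m : nat, [/\ (0 < m%:R :> R)%R,
    truncated_limit f x k m%:R \is a fin_num,
    (`|fine J - fine (truncated_limit f x k m%:R)| < e)%R &
    (c1 * expR (- (c2 * m%:R ^+ d)) <= e)%R].
  have /fine_cvgP[fT cT] : truncated_limit f x k m%:R @[m --> \oo] --> (fine J)%:E.
    by rewrite fineK//; exact: truncated_limit_cvg.
  have /cvgrPdist_lt/(_ _ e0) nT := cT.
  have H : \forall m \near \oo, [/\ (0 < m%:R :> R)%R,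
      truncated_limit f x k m%:R \is a fin_num,
      (`|fine J - fine (truncated_limit f x k m%:R)| < e)%R &
      (c1 * expR (- (c2 * m%:R ^+ d)) <= e)%R].
    near=> m.
    have m1 : (1 <= m%:R :> R)%R by near: m; exact: nbhs_infty_ger.
    have mc : (c1 / e / c2 <= m%:R)%R by near: m; exact: nbhs_infty_ger.
    have m0' : (0 < m%:R :> R)%R by exact: lt_le_trans m1.
    split => //; [by near: m|by near: m|].
    rewrite expRN ler_pdivrMr ?expR_gt0// mulrC -ler_pdivrMr//.
    apply: le_trans (expR_ge1Dx _); apply: (@le_trans _ _ (c2 * m%:R ^+ d))%R;
      last by rewrite lerDr.
    rewrite -ler_pdivrMl// mulrC; apply: (le_trans mc).
    by rewrite -[leLHS]expr1 ler_weXn2l.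
  exact: filter_ex H.
pose t : R := m%:R.
have [K K0' mainP] := main_term_close d_gt0 f_ge0 fx_gt0 lp mu1 k (m_gt0 : (0 < t)%R).
(* Adding 1 keeps the denominator positive when [K] is 0. *)
pose e' := Num.min 1%R (e / (K + 1))%R.
have K1 : (0 < K + 1)%R by rewrite ltr_wpDl.
have e'1 : (0 < e' <= 1)%R by rewrite /e' lt_min ltr01 divr_gt0//= ge_min lexx.
have Ke : (K * e' <= e)%R.
  apply: (@le_trans _ _ (K * (e / (K + 1))))%R; first by rewrite ler_wpM2l// /e' ge_min lexx orbT.
  by rewrite mulrCA ler_piMr ?(ltW e0)// ler_pdivrMr// mul1r lerDl.
have [rho rho_gt0 rhoP] := mainP _ e'1.
near=> n.
have n_gt0 : (0 < n)%N by near: n; exact: nbhs_infty_gt.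
have nN : (0 < n.+1%:R :> R)%R by [].
have [r r_ge0 rE] : exists2 r : R, (0 <= r)%R & (r ^+ d = n.+1%:R^-1)%R.
  by apply: root_exists => //; rewrite invr_ge0.
have r_gt0 : (0 < r)%R.
  rewrite lt_neqAle r_ge0 andbT; apply/eqP => r0; move: rE;
    rewrite -r0 expr0n gtn_eqF//= => /esym/eqP.
  by rewrite invr_eq0 pnatr_eq0.
have nr : (n.+1%:R * r ^+ d = 1)%R by rewrite rE mulfV.
have r_rho : (r < rho)%R.
  rewrite -(@ltr_pXn2r _ d)// ?nnegrE ?(ltW rho_gt0)// rE.
  rewrite -[ltRHS]invrK ltf_pV2 ?posrE ?invr_gt0 ?exprn_gt0//.
  apply: (@lt_trans _ _ n%:R); last by rewrite ltr_nat.
  by near: n; exact: nbhs_infty_gtr.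
have r_bd : (0 < r < rho)%R by rewrite r_gt0.
have [up lo] := rhoP n r r_bd nr.
have tl := tail n t r n_gt0 m_gt0 r_gt0 nr.
have small : (n.+1%:R ^+ k.+1 * expR (- (n%:R * m0)) <= e)%R.
  by near: n; exact: pow_exp_small.
pose G (p : k.+1.-tuple vec) : R := ((1 - fine (mu (region x p))) ^+ n)%R.
have G0 p : (0 <= G p)%R.
  by rewrite /G exprn_ge0// subr_ge0; have /andP[] := fine_mu01 mu1 (measurable_region x p).
have mG : measurable_fun setT G.
  apply: measurable_funX; apply: measurable_funB => //.
  by apply: (measurableT_comp (fine_measurable measurableT)); exact: measurable_mu_region.
have split_int : (scaled_moment k n)%:E = main_term f x k n (t * r) +
    (n.+1%:R ^+ k.+1)%:E * \int[power_measure mu k.+1]_p ((escapes x (t * r) p)%:R * G p)%:E.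
  rewrite scaled_momentE /main_term -ge0_muleDr; last 2 first.
  - by apply: integral_ge0 => p _; rewrite lee_fin mulr_ge0// G0.
  - by apply: integral_ge0 => p _; rewrite lee_fin mulr_ge0// G0.
  rewrite -ge0_integralD; [|exact: measurableT|by move=> p _; rewrite lee_fin mulr_ge0// G0| |
    by move=> p _; rewrite lee_fin mulr_ge0// G0|].
  - congr (_ * _); apply: eq_integral => p _; rewrite -EFinD; congr EFin.
    by rewrite -mulrDl; case: (escapes _ _ _); rewrite /= ?add0r ?addr0 mul1r.
  - by apply/measurable_EFinP; apply: measurable_funM => //; exact: measurable_within.
  - apply/measurable_EFinP; apply: measurable_funM => //.
    by apply: measurable_natr_bool; exact: measurable_escapes.
have tail0 : 0 <= (n.+1%:R ^+ k.+1)%:E *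
    \int[power_measure mu k.+1]_p ((escapes x (t * r) p)%:R * G p)%:E.
  apply: mule_ge0; first by rewrite lee_fin exprn_ge0.
  by apply: integral_ge0 => p _; rewrite lee_fin mulr_ge0// G0.
rewrite -(fineK mfin) -EFinD in up.
have mainfin : main_term f x k n (t * r) \is a fin_num.
  rewrite ge0_fin_numE; first exact: le_lt_trans up (ltry _).
  apply: mule_ge0; first by rewrite lee_fin exprn_ge0.
  by apply: integral_ge0 => p _; rewrite lee_fin mulr_ge0// G0.
rewrite -(fineK mfin) -(fineK mainfin) -EFinD lee_fin in lo.
rewrite -(fineK mainfin) lee_fin in up.
have h1 : (fine (main_term f x k n (t * r)) <= scaled_moment k n)%R.
  by rewrite -lee_fin (fineK mainfin) split_int leeDl.
have h2 : (scaled_moment k n <= fine (main_term f x k n (t * r)) +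
    (c1 * expR (- (c2 * t ^+ d)) + n.+1%:R ^+ k.+1 * expR (- (n%:R * m0))))%R.
  by rewrite -lee_fin EFinD (fineK mainfin) split_int leeD2l.
have eE : eps = (4 * e)%R by rewrite /e; field.
by rewrite eE; exact: (sandwich h1 h2 lo up Ke small mt mJ).
Unshelve. all: by end_near. Qed.

End moment_limit.

(** * Evaluation of the limit integral *)

Section split_by_farthest.
Context (R : realType) (d : nat) (d_gt0 : (0 < d)%N).
Local Notation vec := (d.-tuple R).
Local Notation leb := (@lebesgue_tuple R d).
Local Notation kappa := (ball_volume R d).
Local Notation norm := (@euclidean_dist R d origin).
Local Open Scope ereal_scope.

Lemma norm_e1 : norm e1 = 1%R.
Proof.
rewrite /euclidean_dist (bigD1 (Ordinal d_gt0))//= !tnth_mktuple/=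
  sub0r sqrrN expr1n big1 ?addr0 ?sqrtr1//.
move=> i i0; rewrite !tnth_mktuple (_ : (i == 0%N :> nat) = false) ?subrr ?expr0n//.
by apply/negbTE; apply: contra i0 => /eqP i0; apply/eqP/val_inj.
Qed.

Definition farthest k (p : k.+1.-tuple vec) (i : 'I_k.+1) : bool :=
  [forall j, (j != i) ==> (norm (tnth p j) < norm (tnth p i))%R].

Lemma farthest0 k (p : k.+1.-tuple vec) : farthest p ord0 = dominates p.
Proof.
apply/forallP/forallP => H j; first exact: (implyP (H (lift ord0 j))).
by apply/implyP; case: (unliftP ord0 j) => [j' -> _|->]; [exact: H|rewrite eqxx].
Qed.

Lemma farthest_reindex k (p : k.+1.-tuple vec) (s : {perm 'I_k.+1}) i :
  farthest (tuple_reindex s p) i = farthest p (s i).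
Proof.
apply/forallP/forallP => H j; apply/implyP => ji.
  have := implyP (H (s^-1 j)%g); rewrite !tnth_mktuple permKV; apply.
  by apply: contra ji => /eqP<-; rewrite permKV.
rewrite !tnth_mktuple; apply: (implyP (H (s j))).
by rewrite (inj_eq perm_inj).
Qed.

Lemma measurable_farthest k (i : 'I_k.+1) :
  measurable_fun setT (fun p : k.+1.-tuple vec => farthest p i).
Proof.
apply: measurable_forall => j; case: (j != i) => //=.
by apply: measurable_fun_ltr; apply: measurable_dist => //; exact: measurable_tnth.
Qed.

Lemma region_volume_reindex k (p : k.+1.-tuple vec) (s : {perm 'I_k.+1}) :
  s ord0 = ord0 -> region_volume origin (tuple_reindex s p) = region_volume origin p.
Proof.
move=> s0; rewrite /region_volume; congr (fine (leb _)); apply/seteqP.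
have tE : thead (tuple_reindex s p) = thead p by rewrite /thead tnth_mktuple s0.
have E q : in_region origin (tuple_reindex s p) q = in_region origin p q.
  rewrite /in_region tE; congr orb; apply/existsP/existsP => -[i hi].
    rewrite tnth_mktuple in hi; case: (unliftP ord0 (s (lift ord0 i))) hi => [j ->|];
      first by exists j.
    by rewrite -[X in _ = X]s0 => /perm_inj.
  case: (unliftP ord0 (s^-1 (lift ord0 i))%g) => [j|] jE.
    by exists j; rewrite tnth_mktuple -jE permKV.
  by have := congr1 s jE; rewrite permKV s0.
by split => q; rewrite /region/= E.
Qed.

Definition second k : 'I_k.+2 := lift ord0 ord0.

(** Here the second entry is the nucleus. The head is then free for the farthest point, which
    [polar] moves to [e1]. *)
Definition swap_volume k (p : k.+2.-tuple vec) : R :=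
  region_volume origin (tuple_reindex (tperm ord0 (second k)) p).

Lemma measurable_swap_volume k : measurable_fun setT (@swap_volume k).
Proof.
apply: (measurableT_comp (@measurable_region_volume _ _ _ _)).
exact: measurable_tuple_reindex.
Qed.

(** A transposition fixing the head brings the farthest point to the second place without changing
    the region; swapping the first two entries then makes it the head. *)
Lemma farthest_integral k (c : R) (i : 'I_k.+1) :
  \int[power_measure leb k.+2]_p ((farthest p (lift ord0 i))%:R * expR (- (c * region_volume
    origin p)))%:E =
  \int[power_measure leb k.+2]_p ((dominates p)%:R * expR (- (c * swap_volume p)))%:E.
Proof.
pose F (p : k.+2.-tuple vec) : \bar R :=
  ((farthest p (second k))%:R * expR (- (c * region_volume origin p)))%:E.
have mF : measurable_fun setT F.
  apply/measurable_EFinP; apply: measurable_funM; last exact: measurable_exp_volume.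
  by apply: measurable_natr_bool; exact: measurable_farthest.
have F0 p : 0 <= F p by rewrite lee_fin mulr_ge0 ?expR_ge0.
transitivity (\int[power_measure leb k.+2]_p F p).
  rewrite -(integral_power_reindex leb (tperm (second k) (lift ord0 i)) mF F0).
  apply: eq_integral => p _; rewrite /F farthest_reindex tpermL region_volume_reindex//.
  by rewrite tpermD// eq_sym neq_lift.
apply: (etrans (esym (integral_power_reindex leb (tperm ord0 (second k)) mF F0))).
by apply: eq_integral => p _; rewrite /F farthest_reindex tpermR farthest0.
Qed.

Lemma farthest_sum k (p : k.+1.-tuple vec) : ~ ties origin p ->
  (\sum_(i < k.+1) (farthest p i)%:R = 1 :> R)%R.
Proof.
move=> nt.
have [i _ iP] := @arg_maxP _ _ _ (ord0 : 'I_k.+1) xpredT (fun i => norm (tnth p i)) isT.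
have {}iP j : (norm (tnth p j) <= norm (tnth p i))%R by exact: iP.
have fi : farthest p i.
  apply/forallP => j; apply/implyP => ji; rewrite lt_neqAle iP// andbT; apply/eqP => E.
  by apply: nt; exists (j, i).
rewrite (bigD1 i)//= fi big1 ?addr0// => j ji.
rewrite (_ : farthest p j = false)//; apply/negbTE/negP => /forallP/(_ i)/implyP H.
by have := H; rewrite eq_sym ji => /(_ isT); rewrite ltNge iP.
Qed.

Lemma split_by_farthest k (c : R) :
  \int[power_measure leb k.+2]_p (expR (- (c * region_volume origin p)))%:E =
  \int[power_measure leb k.+2]_p ((dominates p)%:R * expR (- (c * region_volume origin p)))%:E +
  (k.+1%:R)%:E *
  \int[power_measure leb k.+2]_p ((dominates p)%:R * expR (- (c * swap_volume p)))%:E.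
Proof.
have mf i : measurable_fun setT (fun p : k.+2.-tuple vec =>
    ((farthest p i)%:R * expR (- (c * region_volume origin p)))%:E).
  apply/measurable_EFinP; apply: measurable_funM; last exact: measurable_exp_volume.
  by apply: measurable_natr_bool; exact: measurable_farthest.
transitivity (\int[power_measure leb k.+2]_p (\sum_(i < k.+2)
    ((farthest p i)%:R * expR (- (c * region_volume origin p)))%:E)).
  apply: ge0_ae_eq_integral => //.
  - by apply/measurable_EFinP; exact: measurable_exp_volume.
  - by apply: emeasurable_sum => i; exact: mf.
  - by move=> p _; apply: sume_ge0 => i _; rewrite lee_fin mulr_ge0 ?expR_ge0.
  exists (@ties _ _ origin k.+2); split; [exact: measurable_ties| |].
    by apply: power_ties0 => s; exact: leb_sphere.
  move=> p /= H; apply: contrapT => nt; apply: H => _.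
  by rewrite sumEFin -mulr_suml farthest_sum// mul1r.
rewrite ge0_integral_sum//.
rewrite big_ord_recl; congr (_ + _).
  by apply: eq_integral => p _; rewrite farthest0.
under eq_bigr do rewrite farthest_integral.
by apply: sume_const; apply: integral_ge0 => p _; rewrite lee_fin mulr_ge0 ?expR_ge0.
Qed.

Lemma region_volume_similarity k r S (p : k.+1.-tuple vec) : (0 < r)%R -> is_similarity r S ->
  (region_volume origin (tuple_map (fun=> S) p) = r ^+ d * region_volume origin p)%R.
Proof. by move=> r0 [mS S0 SS SE]; exact: (region_volume_map d_gt0). Qed.

Lemma swap_volume_similarity k r S (p : k.+2.-tuple vec) : (0 < r)%R -> is_similarity r S ->
  (swap_volume (tuple_map (fun=> S) p) = r ^+ d * swap_volume p)%R.
Proof.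
move=> r0 simS; rewrite -(region_volume_similarity _ r0 simS); congr region_volume.
by apply: eq_from_tnth => i; rewrite !tnth_mktuple.
Qed.

(** The farthest point sits at [e1]. It is the nucleus when [w] is false; otherwise the nucleus is
    [U_1] and [e1] is one of the test points. *)
Definition cell_ratio (w : bool) k (u : k.+1.-tuple vec) : R :=
  if w then swap_volume (cons_tuple e1 u) else region_volume origin (cons_tuple e1 u).

Lemma cell_ratioE w k (u : k.+1.-tuple vec) : (cell_ratio w u = kappa * Dk w u)%R.
Proof.
have kp := @ball_volume_gt0 R d d_gt0.
rewrite /Dk mulrCA divff ?mulr1 ?gt_eqF//; case: w; rewrite /cell_ratio.
  rewrite /swap_volume /region_volume; congr (fine (leb _)).
  set s := tperm _ _.
  have t0 : thead (tuple_reindex s (cons_tuple e1 u)) = tnth u ord0.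
    by rewrite /thead tnth_mktuple /s tpermL tnthS.
  have u1E : nth origin u 0 = tnth u ord0 by rewrite (tnth_nth origin).
  apply/seteqP; split => q; rewrite /region/= /in_region t0 u1E.
    move=> /orP[h|/existsP[i]]; first by right; rewrite /eball/= distC [ltRHS]distC distC.
    rewrite tnth_mktuple; have [->|i0] := eqVneq i ord0.
      by rewrite /s tpermR tnth0 => h; left; left.
    rewrite /s tpermD ?tnthS; last 2 first.
    - by rewrite neq_lift.
    - by rewrite (inj_eq (@lift_inj _ _)) eq_sym.
    move=> h; left; right; exists i; first by rewrite /= lt0n; apply: contra i0 => /eqP i0;
      apply/eqP/val_inj.
    by rewrite /eball/= [ltRHS]distC.
  move=> [[h|[i /= i0 h]]|h].
  - apply/orP; right; apply/existsP; exists ord0; rewrite tnth_mktuple /s tpermR tnth0; exact: h.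
  - apply/orP; right; apply/existsP; exists i; rewrite tnth_mktuple /s tpermD ?tnthS.
    + by move: h; rewrite /eball/= [ltRHS]distC.
    + by rewrite neq_lift.
    + by rewrite (inj_eq (@lift_inj _ _)); apply/eqP => i00; rewrite -i00 in i0.
  - by apply/orP; left; move: h; rewrite /eball/= [ltRHS]distC.
rewrite /region_volume; congr (fine (leb _)).
apply/seteqP; split => q; rewrite /region/= /in_region theadE norm_e1.
  move=> /orP[h|/existsP[i]]; first by right.
  by rewrite tnthS => h; left; exists i => //; rewrite /eball/= [ltRHS]distC.
move=> [[i _ h]|h]; apply/orP; [right|by left].
by apply/existsP; exists i; rewrite tnthS; move: h; rewrite /eball/= [ltRHS]distC.
Qed.

Lemma measurable_Dk w k : measurable_fun setT (@Dk R d k.+1 w).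
Proof.
have kp := @ball_volume_gt0 R d d_gt0.
rewrite (_ : @Dk R d k.+1 w = (fun u => kappa^-1 * cell_ratio w u)%R); last first.
  by apply/funext => u; rewrite cell_ratioE mulrA mulVf ?mul1r// gt_eqF.
apply: measurable_funM => //; case: w.
  by apply: (measurableT_comp (@measurable_swap_volume k)); exact: measurable_fun_consl.
by apply: (measurableT_comp (@measurable_region_volume _ _ _ _)); exact: measurable_fun_consl.
Qed.

Lemma region_volume_ball k (p : k.+1.-tuple vec) c r : (0 <= r)%R ->
  eball c r `<=` region origin p -> (kappa * r ^+ d <= region_volume origin p)%R.
Proof.
move=> r0 sub; rewrite -lee_fin (region_volumeE d_gt0) -(leb_ball d_gt0 c)//.
by apply: le_measure; rewrite ?inE//; [exact: measurable_eball|exact: measurable_region].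
Qed.

(** When [U_1] is the nucleus it is at distance at least 1/2 from the origin or from [e1], since
    these are at distance 1; the ball about that point already has the required volume. *)
Lemma cell_ratio_ge w k (u : k.+1.-tuple vec) : (kappa * 2^-1 ^+ d <= cell_ratio w u)%R.
Proof.
have kp := @ball_volume_gt0 R d d_gt0.
have h2 : (0 <= 2^-1 :> R)%R by rewrite invr_ge0.
case: w; rewrite /cell_ratio; last first.
  apply: (@region_volume_ball _ _ origin) => // q h; apply/orP; left.
  by rewrite theadE norm_e1; apply: (lt_trans h); rewrite invf_lt1// ltr1n.
set s := tperm ord0 (second k).
have t0 : thead (tuple_reindex s (cons_tuple e1 u)) = tnth u ord0.
  by rewrite /thead tnth_mktuple /s tpermL tnthS.
have [n1|n1] := leP 2^-1%R (norm (tnth u ord0)).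
  apply: (@region_volume_ball _ _ origin) => // q h; apply/orP; left.
  by rewrite t0; exact: lt_le_trans n1.
apply: (@region_volume_ball _ _ e1) => // q h; apply/orP; right; apply/existsP; exists ord0.
rewrite t0 tnth_mktuple /s tpermR tnth0; apply: (lt_le_trans h).
have := dist_triangle (tnth u ord0) e1 (@origin R d).
rewrite [euclidean_dist e1 origin]distC norm_e1 [euclidean_dist _ origin]distC.
lra.
Qed.

Lemma cell_ratio_gt0 w k (u : k.+1.-tuple vec) : (0 < cell_ratio w u)%R.
Proof.
apply: lt_le_trans (cell_ratio_ge w u); by rewrite mulr_gt0 ?ball_volume_gt0// exprn_gt0//
  invr_gt0.
Qed.

Lemma Dk_ge w k (u : k.+1.-tuple vec) : (2^-1 ^+ d <= Dk w u)%R.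
Proof. by rewrite -(ler_pM2l (ball_volume_gt0 R d_gt0)) -cell_ratioE cell_ratio_ge. Qed.

(** The prefactor [a ^+ k.+2] cancels against the gamma integral, so the limit does not remember the
    value [f x]. *)
Lemma limit_integral_polar k (a : R) : (0 < a)%R ->
  limit_integral d k.+1 a =
  ((k.+1)`!%:R * kappa)%:E *
  (\int[power_measure leb k.+1]_u ((in_unit_balls u)%:R / cell_ratio false u ^+ k.+2)%:E +
   (k.+1%:R)%:E *
   \int[power_measure leb k.+1]_u ((in_unit_balls u)%:R / cell_ratio true u ^+ k.+2)%:E).
Proof.
move=> a0; have kp := @ball_volume_gt0 R d d_gt0.
have I0 w : 0 <= \int[power_measure leb k.+1]_u ((in_unit_balls u)%:R / cell_ratio w u ^+
  k.+2)%:E.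
  by apply: integral_ge0 => u _; rewrite lee_fin divr_ge0// exprn_ge0// ltW// cell_ratio_gt0.
have P0 := @polar _ _ d_gt0 k.+1 (@region_volume R d origin k.+1) a isT a0
  (@measurable_region_volume _ _ _ _) (@region_volume_similarity k.+1) (@cell_ratio_gt0 false k).
have P1 := @polar _ _ d_gt0 k.+1 (@swap_volume k) a isT a0
  (@measurable_swap_volume k) (@swap_volume_similarity k) (@cell_ratio_gt0 true k).
have q0 : 0 <= ((k.+1)`!%:R * kappa / a ^+ k.+2)%:E.
  by rewrite lee_fin; apply: divr_ge0; [rewrite mulr_ge0// ltW|rewrite exprn_ge0// ltW].
rewrite /limit_integral split_by_farthest.
rewrite P0.
rewrite P1.
move: (I0 false) (I0 true); rewrite /cell_ratio; set A := \int[_]_u _; set B := \int[_]_u _.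
move: A B => A B A0 B0.
rewrite [_ * (_ * B)]muleCA -ge0_muleDr//; last by rewrite mule_ge0// lee_fin.
rewrite muleA -EFinM; congr (_%:E * _).
by rewrite mulrCA mulfV ?mulr1// expf_neq0 ?gt_eqF.
Qed.

End split_by_farthest.

(** * The expectation over the Bernoulli variable and the uniform points *)

Section power_weighted.
Context d (T : measurableType d) (R : realType).
Variables (m : {sigma_finite_measure set T -> \bar R}) (g : {mfun T >-> R}).
Local Open Scope ereal_scope.

Lemma measurable_prod_density n :
  measurable_fun setT (fun t : n.-tuple T => (\prod_(i < n) `|g (tnth t i)|)%R).
Proof.
apply: measurable_prod => i _; apply: measurableT_comp => //; apply: measurableT_comp => //.
exact: measurable_tnth.
Qed.

Lemma integral_power_weighted n (F : n.-tuple T -> \bar R) :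
  measurable_fun setT F -> (forall t, 0 <= F t) ->
  \int[power_measure (weighted m g) n]_t F t =
  \int[power_measure m n]_t ((\prod_(i < n) `|g (tnth t i)|)%R%:E * F t).
Proof.
elim: n F => [|n IH] F mF F0.
  rewrite !integral_power0//; first by rewrite big_ord0 mul1e.
  by apply: emeasurable_funM => //; apply/measurable_EFinP; exact: measurable_prod_density.
have mFx x : measurable_fun setT (fun t => F (cons_tuple x t)).
  by apply: measurableT_comp => //; exact: measurable_fun_consl.
have mp n' : measurable_fun setT (fun t : n'.-tuple T => (\prod_(i < n') `|g (tnth t i)|)%R%:E).
  by apply/measurable_EFinP; exact: measurable_prod_density.
rewrite !integral_powerS//; last 2 first.
- by apply: emeasurable_funM => //; exact: mp.
- by move=> t; rewrite mule_ge0// lee_fin prodr_ge0.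
rewrite integral_weighted; last 2 first.
- exact: measurable_integral_cons.
- by move=> x; exact: integral_ge0.
apply: eq_integral => x _; rewrite IH// -ge0_integralZl;
  [|exact: measurableT|by apply: emeasurable_funM => //; exact: mp|
  by move=> t _; rewrite mule_ge0// lee_fin prodr_ge0|by rewrite lee_fin].
apply: eq_integral => t _; rewrite muleA -EFinM; congr (_%:E * _).
by rewrite big_ord_recl tnth0; congr (_ * _)%R; apply: eq_bigr => i _; rewrite tnthS.
Qed.

End power_weighted.

Section uniform_density.
Context (R : realType) (d : nat).
Local Notation vec := (d.-tuple R).
Local Notation leb := (@lebesgue_tuple R d).
Local Notation kappa := (ball_volume R d).

Definition uniform_density (y : vec) : R := kappa^-1 * \1_unit_ball y.

Lemma measurable_uniform_density : measurable_fun setT uniform_density.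
Proof.
by apply: measurable_funM => //; apply: measurable_indic; exact: measurable_eball.
Qed.

HB.instance Definition _ := isMeasurableFun.Build _ _ _ _ uniform_density
  measurable_uniform_density.

Hypothesis d_gt0 : (0 < d)%N.

Lemma uniform_density_ge0 y : 0 <= uniform_density y.
Proof. by rewrite mulr_ge0// invr_ge0 ltW// ball_volume_gt0. Qed.

Local Open Scope ereal_scope.

Lemma uniform_measureE A : measurable A -> @uniform_unit_ball R d A =
  weighted leb uniform_density A.
Proof.
move=> mA; have mB : measurable (@unit_ball R d) by exact: measurable_eball.
have mAB : measurable (A `&` unit_ball) by exact: measurableI.
have fin : leb (A `&` unit_ball) \is a fin_num.
  rewrite ge0_fin_numE//; apply: (le_lt_trans _ (leb_unit_ball_lty R d)).
  by apply: le_measure; rewrite ?inE//; exact: subIsetr.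
have k0 : (0 <= kappa^-1)%R by rewrite invr_ge0 ltW// ball_volume_gt0.
transitivity ((kappa^-1)%:E * leb (A `&` unit_ball)).
  by rewrite /uniform_unit_ball -[X in _ * X]fineK// -EFinM mulrC.
rewrite /weighted -integral_indicM//.
rewrite -[X in _ * X]/(_) -(integral_indicT leb mAB) -ge0_integralZl//; last first.
  by apply/measurable_EFinP/measurable_indic.
apply: eq_integral => y _; rewrite ger0_norm ?uniform_density_ge0// /uniform_density.
by rewrite indicI /= !EFinM muleCA.
Qed.

End uniform_density.

Section uniform_mass.
Context (R : realType) (d : nat) (d_gt0 : (0 < d)%N).

Lemma uniform_mass1 : weighted (lebesgue_tuple d) (@uniform_density R d) setT = 1%E.
Proof.
rewrite -uniform_measureE// /uniform_unit_ball setTI divff// gt_eqF//.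
exact: (ball_volume_gt0 R d_gt0).
Qed.

End uniform_mass.

Section limit_moment_formula.
Context (R : realType) (d : nat) (d_gt0 : (0 < d)%N) (k : nat).
Local Notation vec := (d.-tuple R).
Local Notation leb := (@lebesgue_tuple R d).
Local Notation kappa := (ball_volume R d).
Context dQ (OQ : measurableType dQ) (Q : probability OQ R).
Variables (W : {RV Q >-> bool}) (U : 'I_k.+1 -> {RV Q >-> vec}).
Hypothesis W_law : has_law Q W (bernoulli_prob (k.+1%:R / k.+2%:R : R)).
Hypothesis U_iid : iid Q (@uniform_unit_ball R d) (fun i w => U i w).
Hypothesis W_indep_U : independent_pair Q W (fun w => [tuple U i w | i < k.+1]).
Local Open Scope ereal_scope.

Let nu := power_measure (weighted leb (@uniform_density R d)) k.+1.
Let p : R := (k.+1%:R / k.+2%:R)%R.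

Let p01 : (0 <= p <= 1)%R.
Proof. by rewrite divr_ge0//= ler_pdivrMr// mul1r ler_nat. Qed.

Let weight w (u : k.+1.-tuple vec) : R := ((k.+2)`!%:R / Dk w u ^+ k.+2)%R.

Let Dk_gt0 w u : (0 < @Dk R d k.+1 w u)%R.
Proof. by apply: lt_le_trans (Dk_ge d_gt0 w u); rewrite exprn_gt0// invr_gt0. Qed.

Let weight_ge0 w u : (0 <= weight w u)%R.
Proof. by rewrite divr_ge0// exprn_ge0// ltW. Qed.

Let measurable_weight w : measurable_fun setT (weight w).
Proof.
apply: measurable_funM => //.
rewrite (_ : (fun u => _) = (fun u => (Dk w u ^+ k.+2) `^ (-1)))%R.
  apply: (measurableT_comp (measurable_powR (-1)%R)).
  by apply: measurable_funX; exact: measurable_Dk.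
by apply/funext => u; rewrite powR_inv1// exprn_ge0// ltW.
Qed.

(** By independence the pair of [W] and the sample has a product law, and the integral over [W] has
    two terms. The number of points is written [k.+1] so that [U_1] exists. *)
Lemma limit_moment_mixture :
  'E_Q[fun w => ((k.+2)`!%:R / Dk (W w) [tuple U i w | i < k.+1] ^+ k.+2)%R] =
  p%:E * \int[nu]_u (weight true u)%:E + (1 - p)%:E * \int[nu]_u (weight false u)%:E.
Proof.
pose S := sample U; have mS : measurable_fun setT S by exact: measurable_sample.
pose phi w := (W w, S w).
have mphi : measurable_fun setT phi by apply: measurable_fun_pair.
pose G (wu : bool * k.+1.-tuple vec) : \bar R := (weight wu.1 wu.2)%:E.
have mG : measurable_fun setT G.
  apply/measurable_EFinP.
  rewrite (_ : (fun wu => _) = (fun wu : bool * k.+1.-tuple vec =>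
      if wu.1 then weight true wu.2 else weight false wu.2)); last by apply/funext => -[[] u].
  apply: measurable_fun_ifT; first exact: measurable_fst.
    by apply: (measurableT_comp (measurable_weight true)); exact: measurable_snd.
  by apply: (measurableT_comp (measurable_weight false)); exact: measurable_snd.
have G0 wu : 0 <= G wu by rewrite lee_fin weight_ge0.
have I0 w : 0 <= \int[nu]_u (weight w u)%:E by apply: integral_ge0 => u _;
  rewrite lee_fin weight_ge0.
transitivity (\int[pushforward Q phi]_wu G wu).
  rewrite ge0_integral_pushforward// preimage_setT unlock; exact: eq_integral.
transitivity (\int[bernoulli_prob p \x nu]_wu G wu).
  apply: eq_measure_integral => A mA _; apply/esym.
  apply: product_measure_unique => // B C mB mC.
  rewrite /pushforward /= -[RHS]/(bernoulli_prob p B * nu C) -(W_law mB).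
  rewrite -(sample_law (uniform_measureE d_gt0) U_iid mC) -W_indep_U//.
rewrite fubini_tonelli1// integral_bernoulli_prob// => w.
Qed.

(** The [k.+1] uniform densities give [kappa ^- k.+1] and the ratio [cell_ratio = kappa * Dk] gives
    [kappa ^+ k.+2]; one factor [kappa] remains. *)
Lemma weight_integral w : \int[nu]_u (weight w u)%:E =
  ((k.+2)`!%:R * kappa)%:E *
  \int[power_measure leb k.+1]_u ((in_unit_balls u)%:R / cell_ratio w u ^+ k.+2)%:E.
Proof.
have kp := @ball_volume_gt0 R d d_gt0.
have mw : measurable_fun setT (fun u => (weight w u)%:E) by exact/measurable_EFinP.
have E u : (\prod_(i < k.+1) `|uniform_density (tnth u i)|)%R%:E * (weight w u)%:E =
    ((k.+2)`!%:R * kappa)%:E * ((in_unit_balls u)%:R / cell_ratio w u ^+ k.+2)%:E.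
  have -> : (\prod_(i < k.+1) `|uniform_density (tnth u i)| =
      kappa^-1 ^+ k.+1 * (in_unit_balls u)%:R)%R.
    have [/forallP H|] := boolP (in_unit_balls u).
      rewrite mulr1 -[in RHS](card_ord k.+1) -prodr_const; apply: eq_bigr => i _.
      by rewrite ger0_norm ?uniform_density_ge0// /uniform_density indicE mem_set ?mulr1//;
        exact: H.
    rewrite negb_forall => /existsP[i hi]; rewrite mulr0 (bigD1 i)//= /uniform_density indicE.
    by rewrite memNset ?mulr0 ?normr0 ?mul0r// => h; move: hi; rewrite h.
  rewrite -!EFinM /weight (cell_ratioE d_gt0); congr EFin; move: (Dk_gt0 w u).
  move: (Dk w u) ((in_unit_balls u)%:R)%R ((k.+2)`!%:R)%R => D b F D0.
  rewrite exprMn (exprS kappa k.+1) exprVn.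
  by field; rewrite ?expf_neq0 ?gt_eqF.
rewrite integral_power_weighted//; last by move=> u; rewrite lee_fin weight_ge0.
rewrite (eq_integral _ _ (fun u _ => E u)) ge0_integralZl//.
- have -> : (fun u : k.+1.-tuple vec => ((in_unit_balls u)%:R / cell_ratio w u ^+ k.+2)%:E) =
      (fun u => ((in_unit_balls u)%:R * (((k.+2)`!%:R * kappa ^+ k.+2)^-1 * weight w u))%:E).
    apply/funext => u; congr EFin; rewrite /weight (cell_ratioE d_gt0) exprMn.
    by field; rewrite ?pnatr_eq0 -?lt0n ?fact_gt0 !gt_eqF// exprn_gt0.
  apply/measurable_EFinP; apply: measurable_funM.
    by apply: measurable_natr_bool; exact: measurable_in_unit_balls.
  exact: measurable_funM.
- by move=> u _; rewrite lee_fin divr_ge0// exprn_ge0// ltW// cell_ratio_gt0.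
- by rewrite lee_fin mulr_ge0// ltW.
Qed.

(** The Bernoulli weights times [(k.+2)!] are [(k.+1)!] and [k.+1 * (k.+1)!], the weights of the two
    terms of [limit_integral_polar]. *)
Lemma limit_moment_integral (a : R) : (0 < a)%R ->
  'E_Q[fun w => ((k.+2)`!%:R / Dk (W w) [tuple U i w | i < k.+1] ^+ k.+2)%R] =
  limit_integral d k.+1 a.
Proof.
move=> a0; have kp := @ball_volume_gt0 R d d_gt0.
have I0 w : 0 <= \int[power_measure leb k.+1]_u ((in_unit_balls u)%:R / cell_ratio w u ^+
  k.+2)%:E.
  by apply: integral_ge0 => u _; rewrite lee_fin divr_ge0// exprn_ge0// ltW// cell_ratio_gt0.
rewrite limit_moment_mixture (limit_integral_polar d_gt0 k a0) !weight_integral.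
move: (I0 true) (I0 false); set A := \int[_]_u _; set B := \int[_]_u _.
move: A B => A B A0 B0.
rewrite !muleA -!EFinM addeC ge0_muleDr//; last by rewrite mule_ge0// lee_fin.
rewrite muleA -EFinM; congr (_%:E * _ + _%:E * _).
  by rewrite /p [(k.+2)`!]factS natrM !mulrA divfK ?pnatr_eq0//; ring.
have -> : (1 - p = k.+2%:R^-1)%R.
  by apply: (mulIf (x := k.+2%:R)); rewrite ?pnatr_eq0// mulrBl divfK ?mulVf ?pnatr_eq0// mul1r
    -natrB// subSnn.
by rewrite [(k.+2)`!]factS natrM !mulrA mulVf ?pnatr_eq0// mul1r.
Qed.

Lemma limit_moment_le :
  'E_Q[fun w => ((k.+2)`!%:R / Dk (W w) [tuple U i w | i < k.+1] ^+ k.+2)%R] <=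
  ((k.+2)`!%:R * (2 ^+ d) ^+ k.+2)%:E.
Proof.
set c := ((k.+2)`!%:R * _)%R.
have wc w u : (weight w u <= c)%R.
  rewrite /weight /c ler_wpM2l// -exprVn lerXn2r ?nnegrE ?invr_ge0 ?exprn_ge0 ?(ltW (Dk_gt0 _
    _))//.
  rewrite -[leRHS]invrK lef_pV2 ?posrE ?invr_gt0 ?exprn_gt0//.
  by rewrite -exprVn Dk_ge.
have Ic w : \int[nu]_u (weight w u)%:E <= c%:E.
  apply: (@le_trans _ _ (\int[nu]_u (cst c%:E u))).
    apply: le_integralT => //; first exact/measurable_EFinP.
    by move=> u; rewrite lee_fin weight_ge0.
    by move=> u; rewrite lee_fin.
  rewrite integral_cst//; apply: (@le_trans _ _ (c%:E * 1)); last by rewrite mule1.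
  rewrite le_eqVlt; apply/orP; left; apply/eqP; congr (_ * _).
  by apply: power_mu_T; exact: uniform_mass1.
have /andP[p0 p1] := p01.
rewrite limit_moment_mixture; apply: (@le_trans _ _ (p%:E * c%:E + (1 - p)%:E * c%:E)).
  by apply: leeD; apply: lee_wpmul2l; rewrite ?lee_fin ?subr_ge0.
by rewrite -!EFinM -EFinD lee_fin -mulrDl subrKC mul1r.
Qed.

End limit_moment_formula.

(** * Convergence in law *)

Section integral_half_line.
Context (R : realType).
Implicit Types D : probability R R.

Lemma integral_half_line D (f : R -> \bar R) : D (@half_line R) = 1%E ->
  measurable_fun setT f ->
  (\int[D]_y f y = \int[D]_(y in @half_line R) f y)%E.
Proof.
move=> D1 mf; have mH := @measurable_half_line R.
rewrite [RHS]integral_mkcond; apply: ae_eq_integral => //.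
  exact/(measurable_restrictT _ mH)/measurable_funTS.
exists (~` @half_line R); split; first exact: measurableC.
  by have := probability_setC D mH; rewrite D1 subee.
by move=> y /= H hy; apply: H => _; rewrite patchE mem_set.
Qed.

Lemma mean_fin D h : int D h -> (\int[D]_(y in @half_line R) (h y)%:E = (mean D h)%:E)%E.
Proof.
move=> ih; rewrite /mean /Rintegral fineK//; apply: integrable_fin_num => //.
exact: measurable_half_line.
Qed.

Lemma mean_moment D k (l : R) : D (@half_line R) = 1%E ->
  (\int[D]_y (y ^+ k)%:E = l%:E)%E ->
  int D (fun y => y ^+ k) /\ mean D (fun y => y ^+ k) = l.
Proof.
move=> D1; rewrite integral_half_line//; last first.
  by apply/measurable_EFinP; exact: exprn_measurable.
move=> E; split; last by rewrite /mean /Rintegral E.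
apply/integrableP; split.
  by apply/measurable_EFinP; apply: measurable_funTS; exact: exprn_measurable.
rewrite (_ : integral _ _ _ = l%:E) ?ltry// -E; apply: eq_integral => y /set_mem/half_lineP y0.
by rewrite /= ger0_norm// exprn_ge0.
Qed.

End integral_half_line.

Section cell_law.
Context (R : realType) (d : nat) (d_gt0 : (0 < d)%N).
Local Notation vec := (d.-tuple R).
Local Notation leb := (@lebesgue_tuple R d).
Variables (f : {mfun vec >-> R}) (x : vec).
Local Notation mu := (weighted leb f).
Hypothesis mu1 : mu setT = 1%E.

Let mu_sphere s : mu (euclidean_dist x @^-1` [set s]) = 0%E.
Proof.
have mS : measurable (euclidean_dist x @^-1` [set s]).
  by rewrite -[X in measurable X]setTI; apply: measurable_dist.
apply: null_set_integral => //; last exact: leb_sphere.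
by apply/measurable_EFinP; apply: measurable_funTS; exact: measurableT_comp.
Qed.

Definition sample_probability n : set (n.-tuple vec) -> \bar R := power_measure mu n.

HB.instance Definition _ n := isMeasure.Build _ _ _ (@sample_probability n)
  (measure0 (power_measure mu n)) (measure_ge0 (power_measure mu n))
  (@measure_semi_sigma_additive _ _ _ (power_measure mu n)).

HB.instance Definition _ n := Measure_isProbability.Build _ _ _ (@sample_probability n)
  (power_mu_T mu1 n).

Definition scaled_mass n (t : n.-tuple vec) : R := n%:R * cell_mass mu x t.

Lemma measurable_scaled_mass n : measurable_fun setT (@scaled_mass n).
Proof. by apply: measurable_funM => //; exact: measurable_cell_mass. Qed.

HB.instance Definition _ n := isMeasurableFun.Build _ _ _ _ (@scaled_mass n)
  (@measurable_scaled_mass n).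

(** The law on a canonical sample space. The spaces in the theorem are arbitrary and vary with [n];
    their expectations are transferred here, where the moment method runs. Index [n] stands for
    [n.+1] points, as an empty sample has no cell. *)
Definition cell_law n : probability R R :=
  distribution (@sample_probability n.+1) (@scaled_mass n.+1).

Lemma scaled_mass01 n (t : n.-tuple vec) : 0 <= scaled_mass t <= n%:R.
Proof.
have /andP[c0 c1] := cell_mass01 x mu1 t.
by rewrite /scaled_mass mulr_ge0//= ler_piMr.
Qed.

Lemma cell_law_half_line n : cell_law n (@half_line R) = 1%E.
Proof.
rewrite -(power_mu_T mu1 n.+1) /cell_law /distribution /pushforward;
  congr (power_measure mu n.+1 _).
by apply/seteqP; split => // t _; apply/half_lineP; have /andP[] := scaled_mass01 t.
Qed.

Lemma cell_law_moment n k :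
  (\int[cell_law n]_y (y ^+ k)%:E = if k == 0%N then 1 else (scaled_moment f x k n)%:E)%E.
Proof.
have mk : measurable_fun setT (fun y : R => (y ^+ k)%:E) by apply/measurable_EFinP;
  exact: exprn_measurable.
rewrite (integral_half_line (cell_law_half_line n))//.
have mak : measurable_fun setT (fun y : R => (`|y| ^+ k)%:E).
  by apply/measurable_EFinP; apply: measurable_funX; apply: continuous_measurable_fun;
    exact: norm_continuous.
(* The image formula wants an integrand that is nonnegative on the whole line, which odd powers are
   not. *)
transitivity (\int[cell_law n]_(y in @half_line R) (`|y| ^+ k)%:E)%E.
  by apply: eq_integral => y /set_mem/half_lineP y0; rewrite ger0_norm.
rewrite -(integral_half_line (cell_law_half_line n))// ge0_integral_distribution//.
transitivity (\int[power_measure mu n.+1]_t ((n.+1%:R ^+ k)%:E * (cell_mass mu x t ^+ k)%:E))%E.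
  apply: eq_integral => t _; rewrite -EFinM -exprMn /= ger0_norm//.
  by have /andP[] := scaled_mass01 t.
rewrite ge0_integralZl; [|exact: measurableT|
  by apply/measurable_EFinP; apply: measurable_funX; exact: measurable_cell_mass|
  by move=> t _; rewrite lee_fin exprn_ge0//; have /andP[] := cell_mass01 x mu1 t|
  by rewrite lee_fin exprn_ge0].
case: k mk mak => [|k] mk mak.
  rewrite expr0 mul1e eqxx -[RHS](power_mu_T mu1 n.+1) -integral_indicT//.
  by apply: eq_integral => t _; rewrite expr0 indicE in_setT.
rewrite scaled_momentE// voronoi_moment// muleA -EFinM; congr (_%:E * _)%E.
by rewrite [RHS]exprSr.
Qed.

Lemma cell_law_all_moments n : all_moments (cell_law n).
Proof.
split=> [|k]; first exact: cell_law_half_line.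
have [] := @mean_moment _ (cell_law n) k (if k == 0%N then 1 else scaled_moment f x k n)
  (cell_law_half_line n).
  by rewrite cell_law_moment; case: ifP.
by [].
Qed.

Lemma mean_cell_law n k :
  mean (cell_law n) (fun y => y ^+ k) = if k == 0%N then 1 else scaled_moment f x k n.
Proof.
have [] := @mean_moment _ (cell_law n) k (if k == 0%N then 1 else scaled_moment f x k n)
  (cell_law_half_line n).
  by rewrite cell_law_moment; case: ifP.
by [].
Qed.

Section iid_expectation.
Variables (m0 : set vec -> \bar R).
Hypothesis m0E : forall A, m0 A = mu A.
Context dP (OP : measurableType dP) (P : probability OP R) (n : nat).
Variable X : 'I_n.+1 -> {RV P >-> vec}.
Hypothesis Xiid : iid P m0 (fun i w => X i w).

Lemma sample_massE w : n.+1%:R * fine (m0 (voronoi_cell_at (fun i => X i w) x)) =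
  scaled_mass (sample X w).
Proof.
rewrite m0E /scaled_mass /cell_mass; congr (_ * fine (mu (voronoi_cell_at _ x))).
by apply/funext => i; rewrite tnth_mktuple.
Qed.

Let mY : measurable_fun setT (fun w => n.+1%:R * fine (m0 (voronoi_cell_at (fun i => X i w) x))).
Proof.
rewrite (_ : (fun w => _) = @scaled_mass n.+1 \o sample X).
  by apply: measurableT_comp; [exact: measurable_scaled_mass|exact: measurable_sample].
exact/funext/sample_massE.
Qed.

Lemma expectation_cell_law (h : R -> R) (B : R) : measurable_fun setT h -> (forall y, `|h y| <=
  B) ->
  ('E_P[(h \o (fun w => n.+1%:R * fine (m0 (voronoi_cell_at (fun i => X i w) x))))%R] =
   (mean (cell_law n) h)%:E)%E.
Proof.
move=> mh hB.
pose Y : {RV P >-> R} := HB.pack (fun w => n.+1%:R * fine (m0 (voronoi_cell_at (fun i => X i w)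
  x)))
  (isMeasurableFun.Build _ _ _ _ _ mY).
have mhE : measurable_fun setT (EFin \o h) by exact/measurable_EFinP.
have ih : int (cell_law n) h by apply: (@int_bounded _ _ _ B).
rewrite -(mean_fin ih) -(integral_half_line (cell_law_half_line n))// unlock.
transitivity (\int[distribution P Y]_y (h y)%:E)%E.
  rewrite integral_distribution//.
  apply: (@le_integrable _ _ _ _ _ measurableT _ (EFin \o cst B)).
  - by apply: measurableT_comp => //; exact: measurableT_comp.
  - by move=> w _; rewrite /= lee_fin; apply: (le_trans (hB _)); exact: ler_norm.
  - exact: finite_measure_integrable_cst.
apply: eq_measure_integral => A mA _.
rewrite /distribution /pushforward /=.
have mS : measurable (@scaled_mass n.+1 @^-1` A).
  by rewrite -[X in measurable X]setTI; exact: measurable_scaled_mass.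
rewrite -(sample_law (fun A _ => m0E A) Xiid mS); congr (P _).
by apply/seteqP; split => w /=; rewrite -sample_massE.
Qed.

Lemma expectation_moment k : (0 < k)%N ->
  ('E_P[fun w => (n.+1%:R ^+ k * fine (m0 (voronoi_cell_at (fun i => X i w) x)) ^+ k)%R] =
   (scaled_moment f x k n)%:E)%E.
Proof.
move=> k0; have := cell_law_moment n k; rewrite gtn_eqF// => <-.
have mak : measurable_fun setT (fun y : R => (`|y| ^+ k)%:E).
  by apply/measurable_EFinP; apply: measurable_funX; apply: continuous_measurable_fun;
    exact: norm_continuous.
have mk : measurable_fun setT (fun y : R => (y ^+ k)%:E) by apply/measurable_EFinP;
  exact: exprn_measurable.
rewrite (integral_half_line (cell_law_half_line n))//.
transitivity (\int[cell_law n]_(y in @half_line R) (`|y| ^+ k)%:E)%E; last first.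
  by apply: eq_integral => y /set_mem/half_lineP y0; rewrite ger0_norm.
rewrite -(integral_half_line (cell_law_half_line n))// ge0_integral_distribution//.
rewrite unlock; transitivity (\int[P]_w ((fun t => (`|scaled_mass t| ^+ k)%:E) (sample X w)))%E.
  apply: eq_integral => w _; rewrite -sample_massE -exprMn ger0_norm//.
  by rewrite mulr_ge0// fine_ge0// m0E.
apply: (integral_sample (fun A _ => m0E A) Xiid); last by move=> t; rewrite lee_fin exprn_ge0.
by apply: (measurableT_comp mak); exact: measurable_scaled_mass.
Qed.

End iid_expectation.
End cell_law.

Section density_data.
Context (R : realType) (d : nat) (d_gt0 : (0 < d)%N).
Local Notation vec := (d.-tuple R).

Lemma density_mfun (f : vec -> R) : probability_density f ->
  exists2 g : {mfun vec >-> R}, g =1 f &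
    (forall A, density_measure f A = weighted (lebesgue_tuple d) g A) /\
    weighted (lebesgue_tuple d) g setT = 1%E.
Proof.
move=> [mf f0 f1].
pose g : {mfun vec >-> R} := HB.pack f (isMeasurableFun.Build _ _ _ _ f mf).
have E A : density_measure f A = weighted (lebesgue_tuple d) g A.
  by apply: eq_integral => y _; rewrite ger0_norm.
by exists g => //; split => //; rewrite -E.
Qed.

Lemma uniform_lebesgue_point : lebesgue_point (@uniform_density R d) origin.
Proof.
apply: cvg_near_cst; near=> r.
have r1 : r < 1 by near: r; exact: nbhs_right_lt.
rewrite integral0_eq ?mule0// => u ur.
rewrite /uniform_density !indicE !mem_set ?subrr ?normr0//; last exact: lt_trans r1.
by rewrite /unit_ball /eball/= distxx.
Unshelve. all: by end_near. Qed.

Lemma uniform_origin_gt0 : 0 < @uniform_density R d origin.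
Proof.
rewrite /uniform_density indicE mem_set ?mulr1 ?invr_gt0 ?ball_volume_gt0//.
by rewrite /unit_ball /eball/= distxx.
Qed.

End density_data.

(** * Universality of the limit *)

Section limit_moments.
Context (R : realType) (d : nat) (d_ge1 : (1 <= d)%N).
Local Notation vec := (d.-tuple R).
Variable limit_moment : nat -> \bar R.
Hypothesis limit_momentE : forall k (a : R), (1 <= k)%N -> 0 < a ->
  limit_moment k = limit_integral d k a.
Hypothesis limit_moment_bound : forall k, (1 <= k)%N ->
  (limit_moment k <= ((k.+1)`!%:R * (2 ^+ d) ^+ k.+1)%:E)%E.

Lemma limit_moment_fin k : (1 <= k)%N -> limit_moment k \is a fin_num.
Proof.
move=> k1; rewrite ge0_fin_numE; first exact: le_lt_trans (limit_moment_bound k1) (ltry _).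
rewrite (limit_momentE k1 ltr01) /limit_integral mule_ge0 ?lee_fin ?exprn_ge0//.
by apply: integral_ge0 => p _; rewrite lee_fin expR_ge0.
Qed.

(** The formula with [D_k] covers positive orders only; the moment method also needs the total
    mass. *)
Definition moment k : R := if k == 0%N then 1 else fine (limit_moment k).

Lemma momentE k : (1 <= k)%N -> (moment k)%:E = limit_moment k.
Proof. by move=> k1; rewrite /moment gtn_eqF// fineK// limit_moment_fin. Qed.

Lemma moment_le k : moment k <= k.+1`!%:R * (2 ^+ d) ^+ k.+1.
Proof.
case: k => [|k]; first by rewrite /moment/= (_ : 1`! = 1)%N// mul1r expr1 exprn_ege1// ler1n.
by rewrite -lee_fin momentE//; exact: limit_moment_bound.
Qed.

Let rho_gt0 : 0 < 2 ^+ d :> R. Proof. exact: exprn_gt0. Qed.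

Section one_density.
Variables (f : {mfun vec >-> R}) (x : vec).
Hypothesis f_ge0 : forall y, 0 <= f y.
Hypothesis fx_gt0 : 0 < f x.
Hypothesis lp : lebesgue_point f x.
Hypothesis mu1 : weighted (lebesgue_tuple d) f setT = 1%E.

Lemma scaled_moment_limit k : (1 <= k)%N -> scaled_moment f x k n @[n --> \oo] --> moment k.
Proof.
move=> k1; rewrite /moment gtn_eqF// (limit_momentE k1 fx_gt0).
by apply: scaled_moment_cvg => //; rewrite -(limit_momentE k1 fx_gt0) limit_moment_fin.
Qed.

Lemma cell_law_moment_cvg k :
  mean (cell_law x mu1 n) (fun y => y ^+ k) @[n --> \oo] --> moment k.
Proof.
rewrite (_ : (fun n => _) = (fun n => if k == 0%N then 1 else scaled_moment f x k n)); last first.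
  by apply/funext => n; exact: mean_cell_law.
case: k => [|k]; first exact: cvg_cst.
exact: scaled_moment_limit.
Qed.

End one_density.

(** Realised by one sample model: the uniform density is constant near the origin, so the origin is
    a Lebesgue point of positive density. *)
Lemma limit_law : exists D : probability R R, all_moments D /\
  forall k, mean D (fun y => y ^+ k) = moment k.
Proof.
have m1 := uniform_mass1 R d_ge1.
have [D [D1 Dm _]] := limit_distribution (cell_law_all_moments d_ge1 origin m1)
  (cell_law_moment_cvg (uniform_density_ge0 d_ge1) (uniform_origin_gt0 R d_ge1)
    (@uniform_lebesgue_point R d) m1)
  rho_gt0 moment_le.
by exists D; split => [|k]; [split => // k|]; have [] := Dm k.
Qed.

End limit_moments.

Theorem theorem1p4 (R : realType) (d : nat) (d_ge1 : (1 <= d)%N)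
    (dQ : nat -> measure_display) (OQ : forall k, measurableType (dQ k))
    (Q : forall k, probability (OQ k) R)
    (W : forall k, {RV (Q k) >-> bool})
    (U : forall k, 'I_k -> {RV (Q k) >-> d.-tuple R})
    (W_law : forall k, (1 <= k)%N ->
       has_law (Q k) (W k) (bernoulli_prob (k%:R / k.+1%:R : R)))
    (U_iid : forall k, (1 <= k)%N ->
       iid (Q k) (@uniform_unit_ball R d) (fun i w => U k i w))
    (W_indep_U : forall k, (1 <= k)%N ->
       independent_pair (Q k) (W k) (fun w => [tuple U k i w | i < k])) :
  let limit_moment k : \bar R :=
    ('E_(Q k)[fun w => ((k.+1)`!%:R /
                        Dk (W k w) [tuple U k i w | i < k] ^+ k.+1)%R])%E in
  (forall (f : d.-tuple R -> R) (x : d.-tuple R),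
     probability_density f -> lebesgue_point f x -> 0 < f x ->
   forall (dP : nat -> measure_display) (OP : forall n, measurableType (dP n))
     (P : forall n, probability (OP n) R)
     (X : forall n, 'I_n -> {RV (P n) >-> d.-tuple R}),
     (forall n, (1 <= n)%N ->
        iid (P n) (density_measure f) (fun i w => X n i w)) ->
   forall k, (1 <= k)%N ->
     limit_moment k \is a fin_num /\
     (fun n => 'E_(P n)[fun w => (n%:R ^+ k *
        fine (density_measure f (voronoi_cell_at (fun i => X n i w) x)) ^+ k)%R])%E
       @ \oo --> limit_moment k)
  /\
  exists D : probability R R,
    [/\ D `[0, +oo[%classic = 1%E,
        (forall k, (1 <= k)%N ->
           (\int[D]_y (y ^+ k)%:E)%E = limit_moment k),
        (forall D' : probability R R, D' `[0, +oo[%classic = 1%E ->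
           (forall k, (1 <= k)%N ->
              (\int[D']_y (y ^+ k)%:E)%E = limit_moment k) ->
           forall A, measurable A -> D' A = D A) &
        (forall (f : d.-tuple R -> R) (x : d.-tuple R),
           probability_density f -> lebesgue_point f x -> 0 < f x ->
         forall (dP : nat -> measure_display)
           (OP : forall n, measurableType (dP n))
           (P : forall n, probability (OP n) R)
           (X : forall n, 'I_n -> {RV (P n) >-> d.-tuple R}),
           (forall n, (1 <= n)%N ->
              iid (P n) (density_measure f) (fun i w => X n i w)) ->
         cvg_in_law P
           (fun n w => n%:R *
              fine (density_measure f (voronoi_cell_at (fun i => X n i w) x)))
           D)].
Proof.
move=> limit_moment.
have lmE k (a : R) : (1 <= k)%N -> 0 < a -> limit_moment k = limit_integral d k a.
  case: k => // k k1 a0; apply: (limit_moment_integral d_ge1 (W_law _ k1) (U_iid _ k1)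
    (W_indep_U _ k1) a0).
have lmB k : (1 <= k)%N -> (limit_moment k <= ((k.+1)`!%:R * (2 ^+ d) ^+ k.+1)%:E)%E.
  by case: k => // k k1; exact: (limit_moment_le d_ge1 (W_law _ k1) (U_iid _ k1)
    (W_indep_U _ k1)).
have lmfin k : (1 <= k)%N -> limit_moment k \is a fin_num by exact: (limit_moment_fin lmE lmB).
have mE := momentE lmE lmB.
split.
  move=> f x fd lp fx dP OP P X Xiid k k1; split; first exact: lmfin.
  have [g gf [dE mu1]] := density_mfun fd.
  have [_ f0 _] := fd.
  have {}gf : g = f :> (_ -> _) by exact/funext.
  have g0 y : 0 <= g y by rewrite gf.
  have gx : 0 < g x by rewrite gf.
  have lpg : lebesgue_point g x by rewrite gf.
  (* The shift discards the empty sample: from here on the sample size is [n.+1]. *)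
  rewrite -cvg_shiftS -mE//.
  rewrite (_ : (fun n => _) = (fun n => (scaled_moment g x k n)%:E)).
    apply: cvg_EFin; first by near=> n.
    exact: (scaled_moment_limit d_ge1 lmE lmB g0 gx lpg mu1 k1).
  apply/funext => n; exact: (expectation_moment d_ge1 x mu1 dE (Xiid n.+1 isT) k1).
have [D [aD Dm]] := limit_law d_ge1 lmE lmB.
have [D1 iD] := aD.
have rho0 : 0 < 2 ^+ d :> R by exact: exprn_gt0.
have mle := moment_le lmE lmB.
exists D; split.
- exact: D1.
- move=> k k1; rewrite (integral_half_line D1).
    by rewrite (mean_fin (iD k)) Dm mE.
  by apply/measurable_EFinP; exact: exprn_measurable.
- move=> D' D'1 D'm A mA.
  (* Finiteness of the integrals, which [int] requires, follows from the finiteness of the limit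
     moments; order 0 holds because [D'] has mass 1 on the half-line. *)
  have H k : int D' (fun y => y ^+ k) /\ mean D' (fun y => y ^+ k) = moment limit_moment k.
    case: k => [|k].
      split; last by rewrite (@eq_mean _ _ _ (fun=> 1)) ?mean_cst.
      by apply: (@int_bounded _ _ _ 1) => // y _; rewrite normr1.
    by apply: mean_moment => //; rewrite D'm// mE.
  have aD' : all_moments D' by split => // k; have [] := H k.
  by apply: (moments_determinate rho0 mle aD aD' Dm _ mA) => k; have [] := H k.
- move=> f x fd lp fx dP OP P X Xiid h ch [B hB].
  have [g gf [dE mu1]] := density_mfun fd.
  have [_ f0 _] := fd.
  have {}gf : g = f :> (_ -> _) by exact/funext.
  have g0 y : 0 <= g y by rewrite gf.
  have gx : 0 < g x by rewrite gf.
  have lpg : lebesgue_point g x by rewrite gf.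
  have mh : measurable_fun setT h by exact: continuous_measurable_fun.
  have ih : int D h by apply: (@int_bounded _ _ _ B).
  rewrite -cvg_shiftS (integral_half_line D1); last exact/measurable_EFinP.
  rewrite (mean_fin ih).
  rewrite (_ : (fun n => _) = (fun n => (mean (cell_law x mu1 n) h)%:E)).
    apply: cvg_EFin; first by near=> n.
    apply: (moments_weak_convergence rho0 mle (B := B)) => //.
    - exact: cell_law_all_moments.
    - exact: (cell_law_moment_cvg d_ge1 lmE lmB g0 gx lpg).
  apply/funext => n; exact: (expectation_cell_law x mu1 dE (Xiid n.+1 isT) mh hB).
Unshelve. all: by end_near. Qed.
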